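(* Let $C$ be an integral non-ACM curve in $\mathbb P^n$. Then there is an integer $N$, depending only on the regularity of $I_C$, such that $C$ contains no arithmetically Gorenstein zero-dimensional scheme of degree $>N$. In fact, $N=\deg C\cdot\operatorname{reg} I_C$ has this property.
   Context: $R=K[x_0,\dots,x_n]$ with $K$ an infinite field; $I_X$ denotes the saturated homogeneous ideal of a subscheme $X\subset\mathbb P^n$. $X$ is ACM (arithmetically Cohen-Macaulay) if $R/I_X$ is Cohen-Macaulay, and arithmetically Gorenstein if $R/I_X$ is Gorenstein. $\operatorname{reg} I_C$ is the Castelnuovo-Mumford regularity of $I_C$. *)

(* Defs.v *)
From HB Require Import structures.
From mathcomp Require Import all_boot all_order all_algebra.
From mathcomp Require Import generic_quotient ring_quotient.
From mathcomp Require Import mpoly.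

Set Implicit Arguments.
Unset Strict Implicit.
Unset Printing Implicit Defensive.

Import GRing.Theory.
Local Open Scope ring_scope.

Definition infinite_type (T : eqType) : Prop :=
  forall s : seq T, exists x, x \notin s.

Definition is_max (S : nat -> Prop) (d : nat) : Prop :=
  S d /\ forall e, S e -> (e <= d)%N.

(* [idealr A] and [prime_idealr A] are the proper, resp. prime, ideals of A   *)
(* given by boolean predicates; with excluded middle every such ideal is of   *)
(* this form.                                                                 *)

Section CommutativeAlgebra.
Variable A : comNzRingType.

Definition maximal_ideal (P : idealr A) : Prop :=
  forall J : idealr A, {subset P <= J} -> {subset J <= P}.

Definition generated_by (s : seq A) (a : A) : Prop :=
  exists c : nat -> A, a = \sum_(i < size s) c i * s`_i.

Definition noetherian : Prop :=
  forall J : idealr A, exists s : seq A, forall a, a \in J <-> generated_by s a.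

Definition prime_chain (c : nat -> prime_idealr A) (d : nat) : Prop :=
  forall i, (i < d)%N ->
    {subset c i <= c i.+1} /\ ~ {subset c i.+1 <= c i}.

Definition has_height (P : idealr A) (d : nat) : Prop :=
  is_max (fun e => exists2 c : nat -> prime_idealr A,
                     prime_chain c e & c e =i P) d.

Definition regular_sequence (s : seq A) : Prop :=
  ~ generated_by s 1 /\
  forall i, (i < size s)%N -> forall a,
    generated_by (take i s) (s`_i * a) -> generated_by (take i s) a.

Definition has_depth (P : idealr A) (d : nat) : Prop :=
  is_max (fun e => exists s : seq A,
                     [/\ regular_sequence s, {subset s <= P} & size s = e]) d.

(* Eisenbud's form of the definition: depth(P, A) = codim P for every maximal *)
(* ideal P, with no localization.                                             *)
Definition cohen_macaulay : Prop :=
  noetherian /\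
  forall P : idealr A, maximal_ideal P ->
    exists2 d, has_depth P d & has_height P d.

Definition injective_module (E : lmodType A) : Prop :=
  forall (M N : lmodType A) (f : {linear M -> N}) (g : {linear M -> E}),
    injective f -> exists h : {linear N -> E}, forall x, h (f x) = g x.

(* 0 -> M -> E 0 -> E 1 -> ... -> E m -> 0 exact with every E i injective. *)
Definition finite_injective_dimension (M : lmodType A) : Prop :=
  exists (E : nat -> lmodType A) (eta : {linear M -> E 0%N})
         (d : forall i, {linear E i -> E i.+1}),
    [/\ forall i, injective_module (E i),
        injective eta,
        forall y, d 0%N y = 0 <-> exists x, y = eta x,
        forall i y, d i.+1 y = 0 <-> exists x, y = d i x
      & exists m, forall i, (m < i)%N -> forall x : E i, x = 0].

(* iota exhibits B as the localization of A at the prime P. *)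
Definition is_localization (P : idealr A) (B : comNzRingType)
    (iota : {rmorphism A -> B}) : Prop :=
  [/\ forall s, s \notin P -> exists u, iota s * u = 1,
      forall b, exists a s, s \notin P /\ iota s * b = iota a
    & forall a, iota a = 0 <-> exists2 s, s \notin P & s * a = 0].

End CommutativeAlgebra.

(* A local Noetherian ring is Gorenstein if it has finite injective dimension *)
(* over itself, and a Noetherian ring is Gorenstein if its localizations at   *)
(* the maximal ideals are.  The localization is unique up to isomorphism, so  *)
(* that "some localization" and "every localization" mean the same.           *)
Definition gorenstein (A : comNzRingType) : Prop :=
  noetherian A /\
  forall P : idealr A, maximal_ideal P ->
    exists (B : comNzRingType) (iota : {rmorphism A -> B}),
      is_localization P iota /\ finite_injective_dimension (B^o : lmodType B).

Section ProjectiveSchemes.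
Variables (K : fieldType) (n : nat).
Local Notation R := {mpoly K[n.+1]}.

Definition homogeneous (I : {pred R}) : Prop :=
  forall f, f \in I -> forall d, pihomog mdeg d f \in I.

Definition saturated (I : {pred R}) : Prop :=
  forall f,
    (exists k, forall m : 'X_{1..n.+1}, mdeg m = k -> 'X_[m] * f \in I) ->
    f \in I.

(* A closed subscheme X of P^n is represented by its saturated homogeneous    *)
(* ideal I_X; the ideal is proper, i.e. X is nonempty.                        *)
Record closed_subscheme := ClosedSubscheme {
  ideal_of : idealr R;
  ideal_of_homogeneous : homogeneous ideal_of;
  ideal_of_saturated : saturated ideal_of }.

Definition coordinate_ring (X : closed_subscheme) : comNzRingType :=
  {ideal_quot (ideal_of X)}.

Definition subscheme_of (Z X : closed_subscheme) : Prop :=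
  {subset ideal_of X <= ideal_of Z}.

Definition integral_scheme (X : closed_subscheme) : Prop :=
  prime_idealr_closed (ideal_of X).

Definition proj_point (P : prime_idealr R) : Prop :=
  homogeneous P /\ exists i : 'I_n.+1, 'X_i \notin P.

(* Dimension of the topological space of X = Proj (R / I_X). *)
Definition has_dimension (X : closed_subscheme) (d : nat) : Prop :=
  is_max (fun e => exists c : nat -> prime_idealr R,
    prime_chain c e /\
    forall i, (i <= e)%N -> proj_point (c i) /\ {subset ideal_of X <= c i}) d.

Definition integral_curve (X : closed_subscheme) : Prop :=
  integral_scheme X /\ has_dimension X 1%N.

Definition zero_dimensional (X : closed_subscheme) : Prop :=
  has_dimension X 0%N.

Definition ACM (X : closed_subscheme) : Prop :=
  cohen_macaulay (coordinate_ring X).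

Definition arithmetically_gorenstein (X : closed_subscheme) : Prop :=
  gorenstein (coordinate_ring X).

(* h = dim_K (R / I_X)_t. *)
Definition hilbert_function (X : closed_subscheme) (t h : nat) : Prop :=
  exists V : {vspace dhomog n.+1 K t},
    (forall f : dhomog n.+1 K t, (f \in V) = ((f : R) \in ideal_of X)) /\
    h = (\dim {:dhomog n.+1 K t} - \dim V)%N.

Definition hilbert_polynomial (X : closed_subscheme) (p : {poly rat}) : Prop :=
  exists t0, forall t, (t0 <= t)%N ->
    exists2 h, hilbert_function X t h & p.[t%:R] = h%:R.

(* (dim X)! times the leading coefficient of the Hilbert polynomial. *)
Definition has_degree (X : closed_subscheme) (e : nat) : Prop :=
  exists2 p, hilbert_polynomial X p
    & e%:R = ((size p).-1)`!%:R * lead_coef p.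

(* A minimal graded free resolution 0 -> F_s -> ... -> F_0 -> I -> 0 with     *)
(* F_i = \bigoplus_(j < res_rank i) R(- res_shift i j).  Elements of F_i are  *)
(* row vectors, on which the maps act by right multiplication.                *)
Record min_free_resolution (I : {pred R}) := MinFreeResolution {
  res_rank : nat -> nat;
  res_shift : forall i, 'I_(res_rank i) -> nat;
  res_aug : 'cV[R]_(res_rank 0%N);
  res_diff : forall i, 'M[R]_(res_rank i.+1, res_rank i);
  res_rank_finite : exists s, forall i, (s < i)%N -> res_rank i = 0%N;
  res_aug_graded : forall j, res_aug j 0 \is (res_shift j).-homog;
  res_diff_graded : forall i j k,
    if (res_shift k <= res_shift j)%N
    then res_diff i j k \is (res_shift j - res_shift k).-homog
    else res_diff i j k == 0;
  res_aug_image : forall f, f \in I <-> exists v, f%:M = v *m res_aug;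
  res_aug_exact : forall v : 'rV_(res_rank 0%N),
    v *m res_aug = 0 <-> exists w, v = w *m res_diff 0%N;
  res_diff_exact : forall i (v : 'rV_(res_rank i.+1)),
    v *m res_diff i = 0 <-> exists w, v = w *m res_diff i.+1;
  res_diff_minimal : forall i j k, (res_diff i j k)@_0%MM = 0 }.

(* The maximum of res_shift i j - i.  It is a natural number since minimality *)
(* forces res_shift i j >= i.  The zero ideal, whose regularity is -oo, is    *)
(* not related to any r.                                                      *)
Definition has_regularity (I : {pred R}) (r : nat) : Prop :=
  exists F : min_free_resolution I,
    is_max (fun v => exists i (j : 'I_(res_rank F i)),
                       res_shift j = (v + i)%N) r.

End ProjectiveSchemes.

(* Main.v *)
(* Let A = R/I_C and B = R/I_Z, and let x be a variable outside I_C. Since C is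
   integral and not ACM, A/xA has a nonzero homogeneous element f killed by all
   the variables; such an element lives in some degree t < r = reg I_C, as one
   sees by dividing the minimal free resolution of A by x and then successively
   by the remaining variables. For a linear form h that is regular on B (hence
   nonzero in A), the element (h/x) f gives a socle element q of A/hA of the
   same degree t.

   Suppose that every form of degree <= r in I_Z lies in I_C. Then q is nonzero
   in B/hB, whose socle is one-dimensional because Z is arithmetically
   Gorenstein, so B/hB vanishes in degrees > t. As t + 1 <= r, A/hA vanishes in
   degree t + 1 as well, which contradicts dim C = 1. Hence some form of degree
   j <= r in I_Z is not in I_C, and Bezout gives deg Z <= j deg C.

   When no Hilbert polynomial of C is given, deg C is replaced by the constant
   value of the Hilbert function of A/xA in degrees > r, which is at most the
   number of monomials of degree r + 1. *)
From HB Require Import structures.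
Require Import Defs.
From mathcomp Require Import all_boot all_order all_algebra.
From mathcomp Require Import generic_quotient ring_quotient mpoly.
From mathcomp Require Import boolp zify ring.

Set Implicit Arguments.
Unset Strict Implicit.
Unset Printing Implicit Defensive.

Import Order.TTheory GRing.Theory.
Local Open Scope ring_scope.

(** Three steps of the overview are not formal consequences of the definitions of ACM and
    Gorenstein. (1) Cohen-Macaulayness is tested at every maximal ideal of A, also at
    non-homogeneous ones, so to obtain the socle element f, depth and height have to be computed
    there. One growth argument bounds both by 2: three nonzerodivisor steps would force cubic growth
    on a ring that grows quadratically. Maximal ideals containing no form outside I_C are treated
    apart, by division as in a ring of Laurent polynomials. (2) Gorenstein means finite injective
    dimension of the localization S. From it follows Ext^2(S/a, S) = 0 for every ideal a containing
    h, and then any socle element of S/h is seen inside Ext^1(S/h, S) = S/h to be a multiple of a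
    given nonzero one. (3) The bound t < r arises because a socle element of degree t, carried
    through a full flag of linear forms, ends as a generator of degree t + i of the i-th term of the
    resolution. Dimension, degree and Bezout are all read off Hilbert functions; the infinite field
    provides linear forms that avoid finitely many primes. *)

Section Ideals.
Variable A : comNzRingType.
Implicit Types (I J P : A -> Prop) (a b f g : A).

(** The unit ideal is allowed, in contrast to [idealr], so that [colon] and [adjoin] always produce
    ideals again. *)
Record is_ideal J : Prop := IsIdeal {
  ideal0 : J 0;
  idealD : forall a b, J a -> J b -> J (a + b);
  idealM : forall a b, J b -> J (a * b) }.

Definition is_prime P : Prop :=
  [/\ is_ideal P, ~ P 1 & forall a b, P (a * b) -> P a \/ P b].

Definition ideal_le I J : Prop := forall a, I a -> J a.

Definition colon J f a : Prop := J (a * f).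

Definition adjoin J f a : Prop := exists2 b, J b & exists y, a = b + y * f.

Definition noetherian_ring : Prop :=
  forall J, is_ideal J -> exists s : seq A, forall a, J a <-> generated_by s a.

Lemma idealN J a : is_ideal J -> J a -> J (- a).
Proof. by move=> JI Ja; rewrite -mulN1r; apply: idealM. Qed.

Lemma idealB J a b : is_ideal J -> J a -> J b -> J (a - b).
Proof. by move=> JI Ja Jb; apply: idealD => //; apply: idealN. Qed.

Lemma idealMl J a b : is_ideal J -> J a -> J (a * b).
Proof. by move=> JI Ja; rewrite mulrC; apply: idealM. Qed.

Lemma ideal_sum J (T : Type) (s : seq T) (Q : pred T) (F : T -> A) :
  is_ideal J -> (forall i, Q i -> J (F i)) -> J (\sum_(i <- s | Q i) F i).
Proof.
move=> JI JF; elim/big_rec: _ => [|i x Qi Jx]; first exact: ideal0.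
by apply: idealD => //; apply: JF.
Qed.

Lemma ideal_subP J a b : is_ideal J -> J (a - b) -> (J a <-> J b).
Proof.
move=> JI Jab; split=> [Ja|Jb]; last by rewrite -(subrK b a); apply: idealD.
by rewrite -(subKr a b); apply: idealB.
Qed.

Lemma ideal_colon J f : is_ideal J -> is_ideal (colon J f).
Proof.
move=> JI; split=> [|a b|a b]; rewrite /colon.
- by rewrite mul0r; apply: ideal0.
- by rewrite mulrDl; apply: idealD.
- by rewrite -mulrA; apply: idealM.
Qed.

Lemma ideal_adjoin J f : is_ideal J -> is_ideal (adjoin J f).
Proof.
move=> JI; split.
- by exists 0; [apply: ideal0 | exists 0; rewrite mul0r addr0].
- move=> a b [a' Ja [y ->]] [b' Jb [z ->]]; exists (a' + b'); first exact: idealD.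
  by exists (y + z); ring.
- move=> a b [b' Jb [z ->]]; exists (a * b'); first exact: idealM.
  by exists (a * z); ring.
Qed.

Lemma adjoin_le J f : ideal_le J (adjoin J f).
Proof. by move=> a Ja; exists a => //; exists 0; rewrite mul0r addr0. Qed.

Arguments adjoin_le {J f} a _.

Lemma adjoin_gen J f : is_ideal J -> adjoin J f f.
Proof. by move=> JI; exists 0; [apply: ideal0 | exists 1; rewrite mul1r add0r]. Qed.

Lemma adjoin_mono I J f : ideal_le I J -> ideal_le (adjoin I f) (adjoin J f).
Proof. by move=> IJ a [b Ib H]; exists b => //; apply: IJ. Qed.

Lemma adjoin_min I J f : is_ideal J -> ideal_le I J -> J f -> ideal_le (adjoin I f) J.
Proof.
by move=> JI IJ Jf a [b Ib [y ->]]; apply: idealD; [|apply: IJ|apply: idealM].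
Qed.

Lemma ideal_generated (s : seq A) : is_ideal (generated_by s).
Proof.
split.
- by exists (fun=> 0); rewrite big1 // => i _; rewrite mul0r.
- move=> a b [c ->] [d ->]; exists (fun i => c i + d i).
  by rewrite -big_split; apply: eq_bigr => i _; rewrite mulrDl.
- move=> a b [c ->]; exists (fun i => a * c i).
  by rewrite mulr_sumr; apply: eq_bigr => i _; rewrite mulrA.
Qed.

Lemma generated_by_nth (s : seq A) i : (i < size s)%N -> generated_by s s`_i.
Proof.
move=> lt_i; exists (fun j => (j == i)%:R).
rewrite (bigD1 (Ordinal lt_i)) //= eqxx mul1r big1 ?addr0 // => j /negPf.
by rewrite -val_eqE /= => ->; rewrite mul0r.
Qed.

Lemma generated_by_mem (s : seq A) a : a \in s -> generated_by s a.
Proof. by case/(nthP 0) => i lt_i <-; apply: generated_by_nth. Qed.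

Lemma generated_by_min J (s : seq A) :
  is_ideal J -> {in s, forall a, J a} -> ideal_le (generated_by s) J.
Proof.
move=> JI Js a [c ->]; apply: ideal_sum => // i _.
by apply: idealM => //; apply/Js/mem_nth.
Qed.

Lemma generated_by0 a : generated_by [::] a <-> a = 0.
Proof. by split=> [[c ->]|->]; [rewrite big_ord0|exists (fun=> 0); rewrite big_ord0]. Qed.

Lemma generated_by_rcons (s : seq A) b a :
  generated_by (rcons s b) a <-> adjoin (generated_by s) b a.
Proof.
have gI := ideal_generated; split; last first.
  apply: adjoin_min => //; last by apply: generated_by_mem; rewrite mem_rcons mem_head.
  move=> x; apply: generated_by_min => // y sy.
  by apply: generated_by_mem; rewrite mem_rcons inE sy orbT.
move: a; apply: generated_by_min; first exact: ideal_adjoin.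
move=> y; rewrite mem_rcons inE => /orP[/eqP->|sy]; first exact: adjoin_gen.
by apply/adjoin_le/generated_by_mem.
Qed.

(** Without a maximal member, choice would give a strictly increasing sequence of ideals in the
    family; the finitely many generators of its union already lie in one stage. *)
Lemma ideal_maximal (S : (A -> Prop) -> Prop) : noetherian_ring ->
  (forall J, S J -> is_ideal J) -> (exists J, S J) ->
  exists2 J, S J & forall J', S J' -> ideal_le J J' -> ideal_le J' J.
Proof.
move=> noethA SI [J0 SJ0]; apply: contrapT => nmax.
have next (J : {J | S J}) : exists J' : {J | S J},
    ideal_le (sval J) (sval J') /\ ~ ideal_le (sval J') (sval J).
  case: J => J SJ; apply: contrapT => nJ; apply: nmax; exists J => // J' SJ' le_JJ'.
  by apply: contrapT => nle; apply: nJ; exists (exist _ J' SJ').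
have [F Fle] := choice next.
pose c k := iter k F (exist _ J0 SJ0).
have c_le i j : (i <= j)%N -> ideal_le (sval (c i)) (sval (c j)).
  move=> /subnK <-; elim: (j - i)%N => [|k IH] //= a /IH.
  by have [le _] := Fle (c (k + i)%N); apply: le.
have cI k : is_ideal (sval (c k)) by apply: SI; apply: proj2_sig.
pose U a := exists k, sval (c k) a.
have UI : is_ideal U.
  split; first by exists 0%N; apply: ideal0.
    move=> a b [k ck] [l cl]; exists (maxn k l); apply: idealD => //.
      exact: c_le (leq_maxl _ _) _ ck.
    exact: c_le (leq_maxr _ _) _ cl.
  by move=> a b [k ck]; exists k; apply: idealM.
have [s sU] := noethA _ UI.
have [k ck] : exists k, {in s, forall a, sval (c k) a}.
  have: {in s, forall a, U a} by move=> a sa; apply/sU/generated_by_mem.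
  elim: {sU} s => [|a s IH] sU; first by exists 0%N.
  have [k ck] := IH (fun x sx => sU x (mem_behead (s := a :: s) sx)).
  have [l cl] := sU a (mem_head _ _); exists (maxn k l) => x.
  rewrite inE => /predU1P[->|sx]; first exact: c_le (leq_maxr _ _) _ cl.
  exact: c_le (leq_maxl _ _) _ (ck x sx).
have [_ []] := Fle (c k) => a ca.
have /sU : U a by exists k.+1.
exact: generated_by_min.
Qed.

End Ideals.

(** * Dickson's lemma and Hilbert's basis theorem *)

Section HilbertBasis.
Variables (K : fieldType) (n : nat).
Local Notation R := {mpoly K[n]}.

(** Each chosen index minimizes [g] on the tail that starts right after the previous one. *)
Lemma nondecreasing_subseq (g : nat -> nat) :
  exists2 phi : nat -> nat, (forall i j, (i < j)%N -> (phi i < phi j)%N)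
    & forall i j, (i < j)%N -> (g (phi i) <= g (phi j))%N.
Proof.
have minP N : exists k, (N <= k)%N /\ forall j, (N <= j)%N -> (g k <= g j)%N.
  have ex : exists v, [exists i : 'I_v.+1, true] && `[< exists2 k, (N <= k)%N & g k = v >].
    exists (g N); apply/andP; split; first by apply/existsP; exists ord0.
    by apply/asboolP; exists N.
  case: (ex_minnP ex) => v /andP[_ /asboolP[k Nk gk]] vmin.
  exists k; split=> // j Nj; rewrite gk; apply: vmin; apply/andP; split.
    by apply/existsP; exists ord0.
  by apply/asboolP; exists j.
have [F FP] := choice minP.
pose phi i := iter i (fun k => F k.+1) (F 0%N).
have phiS i : (phi i < phi i.+1)%N by have [] := FP (phi i).+1.
have phi_lt i j : (i < j)%N -> (phi i < phi j)%N.
  elim: j => // j IH; rewrite ltnS leq_eqVlt => /predU1P[->|/IH] //.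
  by move=> h; apply: ltn_trans h _.
exists phi => // i j lt_ij.
case: i lt_ij => [|i] lt_ij; first by have [_ ->] := FP 0%N.
have [_ -> //] := FP (phi i).+1.
by apply: leq_trans (phiS i) _; apply/ltnW/phi_lt.
Qed.

(** Coordinate by coordinate, a subsequence is extracted on which that coordinate is nondecreasing;
    its first two terms are then comparable. *)
Lemma dickson (f : nat -> 'X_{1..n}) :
  exists i j, (i < j)%N /\ (f i <= f j)%MM.
Proof.
suff [phi phi_lt phiP] : exists2 phi : nat -> nat,
    (forall i j, (i < j)%N -> (phi i < phi j)%N)
    & {in enum 'I_n, forall k, forall i j, (i < j)%N -> (f (phi i) k <= f (phi j) k)%N}.
  exists (phi 0%N), (phi 1%N); split; first exact: phi_lt.
  by apply/mnm_lepP => k; apply: phiP; rewrite ?mem_enum.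
elim: (enum 'I_n) => [|k s [phi phi_lt phiP]]; first by exists id.
have [psi psi_lt psiP] := nondecreasing_subseq (fun i => f (phi i) k).
exists (phi \o psi) => [i j ij|l] /=; first exact/phi_lt/psi_lt.
rewrite inE => /predU1P[->|sl] i j ij; first exact: psiP.
by apply: phiP => //; apply: psi_lt.
Qed.

(** An ideal that is not finitely generated would yield a sequence of elements in which no leading
    monomial is divisible by an earlier one, against Dickson's lemma. *)
Theorem hilbert_basis : noetherian_ring R.
Proof.
move=> J JI; apply: contrapT => nfg.
have next (s : seq R) : exists f, {in s, forall g, J g} ->
    [/\ J f, f != 0 & {in s, forall g, g != 0 -> ~~ (mlead g <= mlead f)%MM}].
  apply: contrapT => nf; apply: nfg; exists s.
  have sJ : {in s, forall g, J g}.
    by move=> g sg; apply: contrapT => nJg; apply: nf; exists 0 => /(_ g sg).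
  move=> f; split; last exact: generated_by_min.
  elim/mleadrect: f => f IH Jf.
  have [->|f0] := eqVneq f 0; first exact: ideal0 (ideal_generated s).
  have [g [sg g0 le_gf]] : exists g, [/\ g \in s, g != 0 & (mlead g <= mlead f)%MM].
    apply: contrapT => ng; apply: nf; exists f => _; split=> // g sg g0.
    by apply/negP => le_gf; apply: ng; exists g.
  (* Division step: a multiple [h] of [g] cancels the leading term of [f], and induction applies to
     the remainder. *)
  pose c := mleadc f / mleadc g.
  pose h := c *: 'X_[mlead f - mlead g] * g.
  have Gh : generated_by s h.
    by apply: idealM; [apply: ideal_generated | apply: generated_by_mem].
  have Jh : J h by apply: idealM => //; apply: sJ.
  have hlead : mleadc f = h@_(mlead f).
    have gX : (g * 'X_[mlead f - mlead g])@_(mlead f) = mleadc g.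
      by rewrite -{1}(submK le_gf) mcoeffMX.
    by rewrite /h -scalerAl mcoeffZ ['X_[_] * g]mulrC gX divfK ?mleadc_eq0.
  suff : generated_by s (f - h).
    by move=> gfh; rewrite -(subrK h f); apply: idealD Gh; [apply: ideal_generated|].
  have [->|fh0] := eqVneq (f - h) 0; first exact: ideal0 (ideal_generated s).
  apply: IH; last exact: idealB.
  rewrite lt_neqAle; apply/andP; split.
    apply/eqP => eq_l; move: fh0; rewrite -mleadc_eq0 eq_l mcoeffB hlead subrr.
    by rewrite eqxx.
  apply: le_trans (mleadB_le _ _) _; rewrite leUx lexx /=.
  apply: le_trans (mleadM_le _ _) _.
  apply: (@le_trans _ _ ((mlead f - mlead g) + mlead g)%MM).
    rewrite lemc_add2l; apply: le_trans (mleadZ_le _ _) _; by rewrite mleadXm.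
  by rewrite submK.
have [G GP] := choice next.
pose s k := iter k (fun t => rcons t (G t)) [::].
have sS k : s k.+1 = rcons (s k) (G (s k)) by [].
have sJ k : {in s k, forall g, J g}.
  elim: k => [|k IH] // g; rewrite sS mem_rcons inE => /predU1P[->|]; last exact: IH.
  by have [] := GP _ IH.
have s_mem i j : (i < j)%N -> G (s i) \in s j.
  elim: j => // j IH; rewrite ltnS sS mem_rcons inE leq_eqVlt.
  by move=> /predU1P[->|/IH->]; rewrite ?eqxx ?orbT.
have [i [j [lt_ij le_ij]]] := dickson (fun k => mlead (G (s k))).
have [_ _ /(_ _ (s_mem _ _ lt_ij))] := GP _ (sJ j).
have [_ -> _] := GP _ (sJ i).
by rewrite le_ij => /(_ isT).
Qed.

End HilbertBasis.

(** * Homogeneous ideals and prime filtrations *)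

Section HomogeneousIdeals.
Variables (K : fieldType) (n : nat).
Local Notation R := {mpoly K[n]}.
Local Notation hc d p := (pihomog mdeg d p).
Implicit Types (I J P Q : R -> Prop) (f g a b p q u : R).

Definition homog_ideal J : Prop := forall f d, J f -> J (hc d f).

Lemma idealZ J (c : K) f : is_ideal J -> J f -> J (c *: f).
Proof. by move=> JI Jf; rewrite -mul_mpolyC; apply: idealM. Qed.

Lemma monomial_split (m : 'X_{1..n}) N : mdeg m = N.+1 ->
  exists i m', mdeg m' = N /\ m = (m' + U_(i))%MM.
Proof.
move=> dm; have [i mi] : exists i, m i != 0%N.
  apply: contrapT => no; move: dm; rewrite mdegE big1 // => i _.
  by apply/eqP/negPn/negP => mi; apply: no; exists i.
have le1 : (U_(i) <= m)%MM by rewrite lep1mP.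
exists i, (m - U_(i))%MM; rewrite submK //; split=> //.
by have := congr1 mdeg (submK le1); rewrite mdegD mdeg1 dm; lia.
Qed.

Lemma hc_sum p : p = \sum_(d < msize p) hc d p.
Proof. exact: (@pihomog_partitionE _ _ mdeg _ _ (leqnn _)). Qed.

Lemma hcE d e p : p \is e.-homog -> hc d p = if e == d then p else 0.
Proof.
move=> hp; case: eqVneq => [<-|ne]; first by rewrite pihomog_dE.
exact: (pihomog_ne0 ne hp).
Qed.

Lemma hc_ge d p : (msize p <= d)%N -> hc d p = 0.
Proof.
move=> le_d; rewrite pihomogE big_seq_cond big1 // => m /andP[mp /eqP dm].
have := leq_trans (msize_mdeg_lt mp) le_d; rewrite -dm.
by rewrite ltnn.
Qed.

Lemma hc_mul a i d b : a \is i.-homog ->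
  hc d (a * b) = if (i <= d)%N then a * hc (d - i) b else 0.
Proof.
move=> ha; rewrite {1}(hc_sum b) mulr_sumr raddf_sum /=.
have hE (j : nat) : hc d (a * hc j b) = if (i + j)%N == d then a * hc j b else 0.
  by apply: hcE; apply: dhomogM => //; apply: pihomogP.
under eq_bigr do rewrite hE.
case: leqP => id; last first.
  by rewrite big1 // => j _; case: eqP => // ij; lia.
have [lt_d|le_d] := ltnP (d - i) (msize b).
  rewrite (bigD1 (Ordinal lt_d)) //= subnKC // eqxx big1 ?addr0 // => j.
  by rewrite -val_eqE /= => ne; case: eqP => // ij; case/eqP: ne; lia.
rewrite big1 => [|j _]; last by case: eqP => // ij; have := ltn_ord j; lia.
by rewrite hc_ge ?mulr0.
Qed.

Lemma homog_mem J f : is_ideal J -> (forall d, J (hc d f)) -> J f.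
Proof. by move=> JI Jf; rewrite (hc_sum f); apply: ideal_sum. Qed.

Lemma homog_notin J f : is_ideal J -> ~ J f -> exists d, ~ J (hc d f).
Proof.
move=> JI nJf; apply: contrapT => nex; apply: nJf; apply: homog_mem => // d.
by apply: contrapT => nJ; apply: nex; exists d.
Qed.

Lemma homog_max J f : is_ideal J -> ~ J f ->
  exists2 d, ~ J (hc d f) & forall e, (d < e)%N -> J (hc e f).
Proof.
move=> JI nJf; have [d0 nJd0] := homog_notin JI nJf.
have ex : exists d, `[< ~ J (hc d f) >] by exists d0; apply/asboolP.
have ub d : `[< ~ J (hc d f) >] -> (d <= msize f)%N.
  move/asboolP => nJ; rewrite leqNgt; apply/negP => lt_d; apply: nJ.
  by rewrite hc_ge 1?ltnW //; apply: ideal0.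
case: (ex_maxnP ex ub) => d /asboolP nJ dmax; exists d => // e lt_de.
apply: contrapT => nJe; have /dmax : `[< ~ J (hc e f) >] by apply/asboolP.
by rewrite leqNgt lt_de.
Qed.

(** For a and b outside Q take their highest components outside Q, of degrees d and e: every other
    contribution to the component of a b of degree d + e has a factor in Q. *)
Lemma homog_prime Q : is_ideal Q -> homog_ideal Q -> ~ Q 1 ->
  (forall d e a b, a \is d.-homog -> b \is e.-homog -> Q (a * b) -> Q a \/ Q b) ->
  is_prime Q.
Proof.
move=> QI Qh Q1 Qhom; split=> // a b Qab.
apply: contrapT => /not_orP[nQa nQb].
have [d nQd dmax] := homog_max QI nQa; have [e nQe emax] := homog_max QI nQb.
suff : Q (hc d a * hc e b) by case/(Qhom d e); rewrite ?pihomogP.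
have := Qh _ (d + e)%N Qab; rewrite {1}(hc_sum a) mulr_suml raddf_sum /=.
have lt_d : (d < msize a)%N.
  by rewrite ltnNge; apply/negP => le; apply: nQd; rewrite hc_ge //; apply: ideal0.
rewrite (bigD1 (Ordinal lt_d)) //= (hc_mul _ _ (pihomogP _ _ _)) leq_addr addKn.
set S := \sum_(_ | _) _; suff QS : Q S.
  by move=> QaS; rewrite -[_ * _](addrK S); apply: idealB.
apply: ideal_sum => // i; rewrite -val_eqE /= => ne_id.
rewrite (hc_mul _ _ (pihomogP _ _ _)); case: leqP => id; last exact: ideal0.
have [lt_di|le_id] := ltnP d i; first by apply: idealMl => //; apply: dmax.
have lt_id : (i < d)%N by rewrite ltn_neqAle ne_id.
apply: idealM => //; apply: emax.
by rewrite addnC -addnBA // -[X in (X < _)%N]addn0 ltn_add2l subn_gt0.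
Qed.

Lemma homog_colon J f d : homog_ideal J -> f \is d.-homog ->
  homog_ideal (colon J f).
Proof.
move=> Jh hf g e /(Jh _ (d + e)%N); rewrite mulrC (hc_mul _ _ hf).
by rewrite leq_addr addKn mulrC.
Qed.

Lemma homog_adjoin J f d : is_ideal J -> homog_ideal J -> f \is d.-homog ->
  homog_ideal (adjoin J f).
Proof.
move=> JI Jh hf g e [b Jb [y ->]]; rewrite linearD /= mulrC (hc_mul _ _ hf).
exists (hc e b); first exact: Jh.
exists (if (d <= e)%N then hc (e - d) y else 0).
by case: ifP => _; rewrite ?mul0r // mulrC.
Qed.

(** Taking the component of degree e of a membership relation turns the multiplier of f into a form,
    which vanishes when e < d. *)
Lemma adjoin_homogP J f d e g : is_ideal J -> homog_ideal J -> f \is d.-homog ->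
  g \is e.-homog -> adjoin J f g ->
  exists y, J (g - y * f) /\
    if (d <= e)%N then y \is (e - d).-homog else y == 0.
Proof.
move=> JI Jh hf hg [b Jb [y E]].
exists (if (d <= e)%N then hc (e - d) y else 0); split; last first.
  by case: (d <= e)%N; rewrite ?pihomogP ?eqxx.
have := Jh _ e Jb; have -> : b = g - y * f by rewrite E addrK.
rewrite linearB /= (pihomog_dE hg). rewrite mulrC (hc_mul _ _ hf).
by case: ifP; rewrite ?mul0r // mulrC.
Qed.

(* [Ps] is the list of the primes [P] of a filtration of [R / J] whose successive
   quotients are isomorphic to [R / P]. *)
Inductive filtration : (R -> Prop) -> list (R -> Prop) -> Prop :=
| FiltrationTop J : J 1 -> filtration J [::]
| FiltrationStep J f d Ps : f \is d.-homog -> is_prime (colon J f) ->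
    homog_ideal (colon J f) -> filtration (adjoin J f) Ps ->
    filtration J (colon J f :: Ps).

(** Take a colon ideal that is maximal among those of forms outside [J]. If a b f is in J and a f is
    not, the colon of a f contains that of f and also b, so b was already there. *)
Lemma exists_prime_colon J : is_ideal J -> homog_ideal J -> ~ J 1 ->
  exists f d, [/\ f \is d.-homog, ~ J f & is_prime (colon J f)].
Proof.
move=> JI Jh J1.
pose S I := exists f d, [/\ f \is d.-homog, ~ J f & I = colon J f].
have SI I : S I -> is_ideal I by case=> f [d [_ _ ->]]; apply: ideal_colon.
have S1 : exists I, S I by exists (colon J 1); exists 1, 0%N; rewrite dhomog1.
have [_ [f [d [hf nJf ->]]] fmax] := ideal_maximal (@hilbert_basis K n) SI S1.
exists f, d; split=> //; apply: homog_prime.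
- exact: ideal_colon.
- exact: homog_colon Jh hf.
- by rewrite /colon mul1r.
move=> e _ a b ha _ Jabf; have [Jaf|nJaf] := EM (J (a * f)); [by left|right].
have /fmax : S (colon J (a * f)) by exists (a * f), (e + d)%N; rewrite dhomogM.
apply; last by rewrite /colon mulrA [b * a]mulrC.
by move=> x Jx; rewrite /colon mulrCA; apply: idealM.
Qed.

(** Noetherian induction: an ideal maximal among those without a filtration acquires one from its
    enlargement by the form of [exists_prime_colon]. *)
Lemma filtration_exists J : is_ideal J -> homog_ideal J ->
  exists Ps, filtration J Ps.
Proof.
move=> JI Jh; apply: contrapT => nJ.
pose S I := [/\ is_ideal I, homog_ideal I & ~ exists Ps, filtration I Ps].
have SI I : S I -> is_ideal I by case.
have [I [II Ih nI] Imax] :=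
  ideal_maximal (@hilbert_basis K n) SI (ex_intro _ J (And3 JI Jh nJ)).
have I1 : ~ I 1 by move=> I1; apply: nI; exists [::]; apply: FiltrationTop.
have [f [d [hf nIf prf]]] := exists_prime_colon II Ih I1.
apply: nI; have [[Ps fP]|nP] := EM (exists Ps, filtration (adjoin I f) Ps).
  exists (colon I f :: Ps); apply: (FiltrationStep hf prf _ fP).
  exact: homog_colon Ih hf.
case: nIf; apply: Imax (adjoin_gen _ II); last exact: adjoin_le.
by split=> //; [apply: ideal_adjoin | apply: homog_adjoin Ih hf].
Qed.

Lemma filtration_le J Ps P : is_ideal J -> filtration J Ps -> List.In P Ps ->
  [/\ is_prime P, homog_ideal P & ideal_le J P].
Proof.
move=> JI fP; elim: fP JI => {J Ps} [//|J f d Ps hf prf hPf _ IH] JI /= [<-|/IH].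
  by split=> // a Ja; apply: idealMl.
move/(_ (ideal_adjoin _ JI)) => [? ? le]; split=> // a Ja; exact/le/adjoin_le.
Qed.

(** If b g is in J, then g = c + y f by induction, and b y lies in the prime J : f, which does not
    contain b. *)
Lemma filtration_nzd J Ps b g : is_ideal J -> filtration J Ps ->
  (forall P, List.In P Ps -> ~ P b) -> J (b * g) -> J g.
Proof.
move=> JI fP; elim: fP JI => {J Ps} [J J1 JI _ _|J f d Ps hf prf _ _ IH JI nP Jbg].
  by rewrite -[g]mulr1; apply: idealM.
have /IH : forall P, List.In P Ps -> ~ P b by move=> P PP; apply: nP; right.
case/(_ (ideal_adjoin _ JI) (adjoin_le _ Jbg)) => c Jc [y E].
have [_ _ /(_ b y)] := prf; rewrite /colon -mulrA.
have -> : b * (y * f) = b * g - b * c by rewrite E; ring.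
case; first by apply: idealB => //; apply: idealM.
  by move/(nP (colon J f) (or_introl erefl)).
by move=> Jyf; rewrite E; apply: idealD.
Qed.

(** Here [b] avoids only the relevant primes, and each irrelevant one is paid for by one more degree
    of monomials. With b = 0 and g = 1: if all primes of the filtration are irrelevant, [J] contains
    a power of the irrelevant ideal. *)
Lemma filtration_power J Ps b g : is_ideal J -> filtration J Ps ->
  (forall P, List.In P Ps -> ~ (forall i, P 'X_i) -> ~ P b) -> J (b * g) ->
  exists N, forall m : 'X_{1..n}, mdeg m = N -> J ('X_[m] * g).
Proof.
move=> JI fP; elim: fP JI => {J Ps} [J J1 JI _ _|J f d Ps hf prf _ _ IH JI nP Jbg].
  by exists 0%N => m _; rewrite -[_ * _]mulr1; apply: idealM.
have [|N HN] := IH (ideal_adjoin _ JI) _ (adjoin_le _ Jbg).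
  by move=> P PP; apply: nP; right.
have [fI _ fP] := prf.
have [mP|/(nP _ (or_introl erefl)) nPb] := EM (forall i, colon J f 'X_i); last first.
  exists N => m /HN [c Jc [y E]].
  have /fP : colon J f (b * y).
    rewrite /colon -mulrA (_ : b * (y * f) = 'X_[m] * (b * g) - b * c).
      by apply: idealB => //; apply: idealM.
    by have -> : y * f = 'X_[m] * g - c; [rewrite E|]; ring.
  by case=> // Jyf; rewrite E; apply: idealD.
exists N.+1 => m /monomial_split[i [m' [dm' ->]]].
have [c Jc [y E]] : adjoin J f ('X_[m'] * g) by apply: HN.
rewrite mpolyXD mulrAC E mulrDl; apply: idealD => //.
  exact: idealMl.
by rewrite -mulrA; apply: idealM => //; rewrite mulrC; apply: mP.
Qed.

End HomogeneousIdeals.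

(** * Prime avoidance over an infinite field *)

Section Avoidance.
Variables (K : fieldType) (n : nat).
Hypothesis Kinf : infinite_type K.
Local Notation R := {mpoly K[n]}.

(** A line v + K u not contained in an ideal meets it in at most one point, since two points would
    put u and then v in the ideal. Hence a general point of the line avoids one ideal more. *)
Lemma avoidance (V : R -> Prop) (Ps : list (R -> Prop)) :
  V 0 -> (forall c f g, V f -> V g -> V (f + c *: g)) ->
  (forall P, List.In P Ps -> is_ideal P) ->
  (forall P, List.In P Ps -> exists2 v, V v & ~ P v) ->
  exists2 v, V v & forall P, List.In P Ps -> ~ P v.
Proof.
move=> V0 VD; elim: Ps => [|P Ps IH] PI PV; first by exists 0.
have [||v Vv nv] := IH.
- by move=> Q QP; apply: PI; right.
- by move=> Q QP; apply: PV; right.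
have [u Vu nu] := PV P (or_introl erefl).
have [s sP] : exists s : seq K, forall c, c \notin s ->
    forall Q, List.In Q (P :: Ps) -> ~ Q (v + c *: u).
  have bad Q : is_ideal Q -> ~ Q v \/ ~ Q u -> exists s : seq K,
      forall c, c \notin s -> ~ Q (v + c *: u).
    move=> QI nQ; have [[c Qc]|none] := EM (exists c, Q (v + c *: u)); last first.
      by exists [::] => c _ Qc; apply: none; exists c.
    exists [:: c] => c'; rewrite inE => ne Qc'.
    have Qu : Q u.
      have := idealZ (c' - c)^-1 QI (idealB QI Qc' Qc).
      have -> : v + c' *: u - (v + c *: u) = (c' - c) *: u.
        by rewrite scalerBl opprD addrACA subrr add0r.
      by rewrite scalerA mulVf ?scale1r // subr_eq0.
    case: nQ => // nv'; apply: nv'; rewrite -(addrK (c *: u) v).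
    by apply: idealB => //; apply: idealZ.
  have : forall Q, List.In Q (P :: Ps) -> ~ Q v \/ ~ Q u.
    by move=> Q [<-|/nv]; [right|left].
  elim: (P :: Ps) PI => [|Q Qs IHs] QI nQ; first by exists [::].
  have [||s sP] := IHs.
  - by move=> Q' Q'Q; apply: QI; right.
  - by move=> Q' Q'Q; apply: nQ; right.
  have [s' s'P] := bad Q (QI Q (or_introl erefl)) (nQ Q (or_introl erefl)).
  exists (s ++ s') => c; rewrite mem_cat negb_or => /andP[cs cs'] Q' [<-|]; first exact: s'P.
  exact: sP.
have [c cs] := Kinf s; exists (v + c *: u); first exact: VD.
exact: sP.
Qed.

(** [G] selects the primes to be avoided: the relevant ones, or all of them. *)
Lemma filtration_avoid J Ps (G : (R -> Prop) -> Prop) (V : R -> Prop) :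
  is_ideal J -> filtration J Ps -> V 0 ->
  (forall c f g, V f -> V g -> V (f + c *: g)) ->
  (forall P, List.In P Ps -> G P -> exists2 v, V v & ~ P v) ->
  exists2 v, V v & forall P, List.In P Ps -> G P -> ~ P v.
Proof.
move=> JI fP V0 VD VP.
have [Qs QsP PsQ] : exists2 Qs, (forall P, List.In P Qs -> List.In P Ps /\ G P)
    & forall P, List.In P Ps -> G P -> List.In P Qs.
  elim: {fP VP} Ps => [|P Ps [Qs QsP PsQ]]; first by exists [::].
  have [GP|nGP] := EM (G P).
    exists (P :: Qs) => Q /= [<-|]; try by [left|split; [left|]].
      by move=> /QsP[? ?]; split=> //; right.
    by move=> QPs GQ; right; apply: PsQ.
  exists Qs => Q /=; first by move=> /QsP[? ?]; split=> //; right.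
  by case=> [<- //|]; apply: PsQ.
have [||v Vv vP] := avoidance V0 VD (Ps := Qs).
- by move=> P /QsP[/(filtration_le JI fP)[[]]].
- by move=> P /QsP[]; apply: VP.
by exists v => // P PPs GP; apply/vP/PsQ.
Qed.

End Avoidance.

(** * Dimensions modulo an ideal and their additivity *)

Section LinearCombinations.
Variables (K : fieldType) (n : nat).
Local Notation R := {mpoly K[n]}.
Implicit Types (U V J : R -> Prop) (f g a b p q u : R) (s : seq R) (c : nat -> K).

Definition lin c s : R := \sum_(i < size s) c i *: s`_i.

(* [spanned] and [independent] bound the dimension of [U] modulo [J] from above
   and from below; they need neither a quotient space nor that [J] be homogeneous. *)
Definition spanned U J (h : nat) : Prop := exists s : seq R,
  [/\ (size s <= h)%N, {in s, forall x, U x}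
    & forall u, U u -> exists c, J (u - lin c s)].

Definition independent U J (k : nat) : Prop := exists s : seq R,
  [/\ size s = k, {in s, forall x, U x}
    & forall c, J (lin c s) -> forall i, (i < size s)%N -> c i = 0].

Lemma lin_cat c s s' :
  lin c (s ++ s') = lin c s + lin (fun i => c (size s + i)%N) s'.
Proof.
rewrite /lin size_cat big_split_ord /=; congr (_ + _); apply: eq_bigr => i _.
  by rewrite nth_cat ltn_ord.
by rewrite nth_cat ltnNge leq_addr /= addKn.
Qed.

Lemma lin_cat_split c c' s s' :
  lin c s + lin c' s' =
  lin (fun i => if (i < size s)%N then c i else c' (i - size s)%N) (s ++ s').
Proof.
rewrite lin_cat; congr (_ + _); apply: eq_bigr => i _; first by rewrite ltn_ord.
by rewrite ltnNge leq_addr /= addKn.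
Qed.

Lemma lin_mul c s f : lin c [seq x * f | x <- s] = lin c s * f.
Proof.
rewrite /lin size_map mulr_suml; apply: eq_bigr => i _.
by rewrite (nth_map 0) // scalerAl.
Qed.

Lemma lin_map (T : Type) (a : T -> K) (F : T -> R) (t : seq T) :
  exists c, \sum_(x <- t) a x *: F x = lin c (map F t).
Proof.
exists (nth 0 (map a t)); rewrite /lin size_map.
case: t => [|x0 t]; first by rewrite big_nil big_ord0.
rewrite (big_nth x0) big_mkord; apply: eq_bigr => i _.
by rewrite !(nth_map x0).
Qed.

Lemma spanned_leq U J h h' : (h <= h')%N -> spanned U J h -> spanned U J h'.
Proof. by move=> le [s [sz sU sJ]]; exists s; split=> //; apply: leq_trans le. Qed.

Lemma spanned_le U J J' h : ideal_le J J' -> spanned U J h -> spanned U J' h.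
Proof.
move=> le [s [sz sU sJ]]; exists s; split=> // u /sJ [c /le]; by exists c.
Qed.

Lemma spanned0 U J : (forall u, U u -> J u) -> spanned U J 0.
Proof.
move=> UJ; exists [::]; split=> // u /UJ; exists (fun=> 0).
by rewrite /lin big_ord0 subr0.
Qed.

Lemma independent1 U J f : is_ideal J -> U f -> ~ J f -> independent U J 1.
Proof.
move=> JI Uf nJ; exists [:: f]; split=> // [x|c].
  by rewrite inE => /eqP->.
rewrite /lin big_ord1 /= => Jcf [|//] _; apply/eqP/negPn/negP => c0; apply: nJ.
by rewrite -(scalerK c0 f); apply: idealZ.
Qed.

(** Otherwise the coordinates of the independent family in the spanning one form a matrix with more
    rows than columns, and a nonzero row of its left kernel is a forbidden relation. *)
Lemma independent_leq U J k h : is_ideal J ->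
  independent U J k -> spanned U J h -> (k <= h)%N.
Proof.
move=> JI [s [<- sU sind]] [t [tsz tU tspan]]; apply: leq_trans tsz.
rewrite leqNgt; apply/negP => lt_ts.
have /choice [C CP] : forall i : 'I_(size s), exists c, J (s`_i - lin c t).
  by move=> i; apply/tspan/sU/mem_nth.
pose M := \matrix_(i < size s, j < size t) C i j.
have /rowV0Pn [v vker v0] : kermx M != 0.
  by rewrite -mxrank_eq0 mxrank_ker subn_eq0 -ltnNge (leq_ltn_trans (rank_leq_col _)).
have vM : v *m M = 0 by apply/sub_kermxP.
pose c i := if insub i is Some j then v 0 j else 0.
have cE (i : 'I_(size s)) : c i = v 0 i by rewrite /c valK.
suff /sind cz : J (lin c s).
  by case/eqP: v0; apply/rowP => i; rewrite mxE -cE cz.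
have -> : lin c s = \sum_(i < size s) v 0 i *: (s`_i - lin (C i) t).
  rewrite /lin; under [RHS]eq_bigr => i _ do rewrite scalerBr scaler_sumr.
  rewrite sumrB exchange_big /= [X in _ - X]big1 ?subr0; last first.
    move=> j _; under eq_bigr => i _ do rewrite scalerA.
    have /matrixP/(_ 0 j) := vM; rewrite !mxE => E.
    rewrite -scaler_suml [X in X *: _](_ : _ = 0) ?scale0r // -[RHS]E.
    apply: eq_bigr => i _.
    by rewrite mxE.
  by apply: eq_bigr => i _; rewrite cE.
by apply: ideal_sum => // i _; apply: idealZ.
Qed.

(** Lower half of additivity for R/J -> R/J -> R/J', where the first map is multiplication by f.
    Only an inclusion of J + (f) in J' is assumed, as in the Bezout estimate, where J' is the ideal
    of Z. *)
Lemma independent_add U V J J' f k l : is_ideal J -> is_ideal J' ->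
  ideal_le J J' -> J' f -> (forall c s, {in s, forall x, V x} -> J (lin c s * f) -> J (lin c s)) ->
  (forall g, V g -> U (g * f)) ->
  independent U J' k -> independent V J l -> independent U J (k + l).
Proof.
move=> JI JI' le J'f nzd VU [s [<- sU sind]] [t [<- tV tind]].
exists (s ++ [seq x * f | x <- t]); split=> [|x|c].
- by rewrite size_cat size_map.
- by rewrite mem_cat => /orP[/sU//|/mapP[y /tV Vy ->]]; apply: VU.
rewrite lin_cat lin_mul => Jc i; rewrite size_cat size_map.
have cs0 : forall i, (i < size s)%N -> c i = 0.
  apply: sind; rewrite -[lin _ _](addrK (lin (fun i => c (size s + i)%N) t * f)).
  by apply: idealB => //; [apply: le | apply: idealM].
have [/cs0//|le_i lt_i] := ltnP i (size s).
have -> : i = (size s + (i - size s))%N by rewrite subnKC.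
apply: (tind (fun i => c (size s + i)%N)); last by rewrite ltn_subLR.
apply: nzd tV _; move: Jc; rewrite {1}/lin big1 ?add0r // => j _.
by rewrite cs0 ?scale0r.
Qed.

Lemma exists_dimension U J N : is_ideal J -> spanned U J N ->
  exists2 h, independent U J h & spanned U J h.
Proof.
move=> JI Uspan.
have ex : exists h, `[< independent U J h >].
  by exists 0%N; apply/asboolP; exists [::].
have ub h : `[< independent U J h >] -> (h <= N)%N.
  by move=> /asboolP ind; apply: independent_leq Uspan.
case: (ex_maxnP ex ub) => h /asboolP hind hmax; exists h => //.
have [s [sh sU sind]] := hind; exists s; split=> [||u Uu]; rewrite ?sh //.
apply: contrapT => nspan.
suff /asboolP/hmax : independent U J h.+1 by rewrite ltnn.
exists (s ++ [:: u]); split=> [|x|c].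
- by rewrite size_cat sh addn1.
- by rewrite mem_cat inE => /orP[/sU|/eqP->].
rewrite lin_cat {2}/lin big_ord1 /= addn0 size_cat /= => Jc.
have cu0 : c (size s) = 0.
  apply/eqP/negPn/negP => cu; apply: nspan; exists (fun i => - (c (size s))^-1 * c i).
  have -> : lin (fun i => - (c (size s))^-1 * c i) s = - ((c (size s))^-1 *: lin c s).
    rewrite /lin scaler_sumr -sumrN; apply: eq_bigr => i _.
    by rewrite scalerA -scaleNr mulNr.
  rewrite opprK -{1}(scalerK cu u) -scalerDr addrC.
  exact: idealZ.
move=> i; rewrite addn1 ltnS leq_eqVlt => /predU1P[->//|].
by apply: sind; move: Jc; rewrite cu0 scale0r addr0.
Qed.

Definition hpart (t : nat) f : Prop := f \is t.-homog for mdeg.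

(** Degree at most [t], as [msize] exceeds the degree by one. This filtered counterpart of [hpart]
    serves ideals that are not homogeneous. *)
Definition lepart (t : nat) f : Prop := (msize f <= t.+1)%N.

Lemma hpart_var i : hpart 1 'X_i.
Proof. by rewrite /hpart dhomogX; apply/eqP/mdeg1. Qed.

Lemma lin_hpart t c s : {in s, forall x, hpart t x} -> hpart t (lin c s).
Proof.
move=> sh; rewrite /hpart /lin; apply: rpred_sum => i _; apply: rpredZ.
by apply/sh/mem_nth.
Qed.

Lemma hpart_spanned J t : is_ideal J -> exists N, spanned (hpart t) J N.
Proof.
move=> JI.
pose T := [seq bmnm m | m : 'X_{1..n < t.+1} <- enum {: 'X_{1..n < t.+1}} & mdeg m == t].
exists (size T); exists [seq 'X_[m] | m <- T]; split; first by rewrite size_map.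
  move=> x /mapP[_ /mapP[m mT ->] ->]; rewrite /hpart dhomogX.
  by move: mT; rewrite mem_filter => /andP[].
move=> u hu; have [c cE] := lin_map (fun m => u@_m) (fun m => 'X_[m]) T.
exists c; rewrite -cE big_map big_filter big_enum_cond /=.
suff <- : u = \sum_(m : 'X_{1..n < t.+1} | mdeg m == t) u@_m *: 'X_[m].
  by rewrite subrr; apply: ideal0.
rewrite -{1}(pihomog_dE hu); apply: pihomogwE.
rewrite msizeE; apply/bigmax_leqP_seq => m mu _.
by rewrite (dhomog_mf hu mu).
Qed.

(** Upper half of additivity, in degree t + e of 0 -> R/(J : f)(-e) -> R/J -> R/(J + (f)) -> 0. *)
Lemma spanned_adjoin J f e t h1 h2 : is_ideal J -> homog_ideal J ->
  f \is e.-homog -> spanned (hpart t) (colon J f) h1 ->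
  spanned (hpart (t + e)) (adjoin J f) h2 ->
  spanned (hpart (t + e)) J (h1 + h2).
Proof.
move=> JI Jh hf [s1 [sz1 U1 span1]] [s2 [sz2 U2 span2]].
exists ([seq x * f | x <- s1] ++ s2); split.
- by rewrite size_cat size_map leq_add.
- move=> x; rewrite mem_cat => /orP[/mapP[y /U1 hy ->]|/U2//].
  by rewrite /hpart dhomogM.
move=> u hu; have [c2 uc2] := span2 u hu.
have hu2 : u - lin c2 s2 \is (t + e).-homog for mdeg.
  by apply: rpredB => //; apply: lin_hpart.
have [y [Jy]] := adjoin_homogP JI Jh hf hu2 uc2; rewrite leq_addl addnK => hy.
have [c1 yc1] := span1 y hy; set s := [seq _ | _ <- s1].
exists (fun i => if (i < size s)%N then c1 i else c2 (i - size s)%N).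
rewrite -lin_cat_split lin_mul.
have -> : u - (lin c1 s1 * f + lin c2 s2) =
    (u - lin c2 s2 - y * f) + (y - lin c1 s1) * f by ring.
exact: idealD.
Qed.

Lemma spanned_adjoin_lt J f e t h : is_ideal J -> homog_ideal J ->
  f \is e.-homog -> (t < e)%N ->
  spanned (hpart t) (adjoin J f) h -> spanned (hpart t) J h.
Proof.
move=> JI Jh hf lt_te [s [sz sU span]]; exists s; split=> // u hu.
have [c uc] := span u hu; exists c.
have hu2 : u - lin c s \is t.-homog for mdeg by apply: rpredB => //; apply: lin_hpart.
have [y [Jy]] := adjoin_homogP JI Jh hf hu2 uc.
by rewrite leqNgt lt_te /= => /eqP y0; move: Jy; rewrite y0 mul0r subr0.
Qed.

(** Bounded Hilbert function: the numerical substitute for a projective scheme that is empty or of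
    dimension zero. *)
Definition bounded J : Prop := exists B, forall t, spanned (hpart t) J B.

Lemma bounded_filtration J Ps : is_ideal J -> homog_ideal J -> filtration J Ps ->
  (forall P, List.In P Ps -> bounded P) -> bounded J.
Proof.
move=> JI Jh fP; elim: fP JI Jh => {J Ps} [J J1 JI _ _|J f d Ps hf _ _ _ IH JI Jh bP].
  by exists 0%N => t; apply: spanned0 => u _; rewrite -[u]mulr1; apply: idealM.
have [||P PP|B2 sp2] := IH; [exact: ideal_adjoin|exact: homog_adjoin hf|by apply: bP; right|].
have [B1 sp1] := bP _ (or_introl erefl); exists (B1 + B2)%N => t.
have [lt_td|le_dt] := ltnP t d.
  by apply: spanned_leq (leq_addl _ _) _; apply: (spanned_adjoin_lt JI Jh hf).
by rewrite -(subnK le_dt); exact: spanned_adjoin JI Jh hf (sp1 _) (sp2 _).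
Qed.

End LinearCombinations.

(** * Passage between ideals as propositions and boolean ideals *)

Section BooleanIdeals.
Variable A : comNzRingType.

Definition ideal_pred (J : A -> Prop) of is_ideal J & ~ J 1 : A -> bool :=
  fun a => `[< J a >].

Fact ideal_pred_closed J (JI : is_ideal J) (J1 : ~ J 1) :
  idealr_closed (ideal_pred JI J1).
Proof.
split=> [||a u v]; first by apply/asboolP; apply: ideal0.
  by apply/asboolP.
by move=> /asboolP Ju /asboolP Jv; apply/asboolP; apply: idealD => //; apply: idealM.
Qed.

HB.instance Definition _ J (JI : is_ideal J) (J1 : ~ J 1) :=
  isIdealr.Build A (ideal_pred JI J1) (ideal_pred_closed JI J1).

Lemma exists_idealr J : is_ideal J -> ~ J 1 ->
  exists I : idealr A, forall a, a \in I <-> J a.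
Proof.
by move=> JI J1; exists (ideal_pred JI J1) => a; split=> [/asboolP|/asboolP].
Qed.

Definition prime_pred (P : A -> Prop) (PP : is_prime P) : A -> bool :=
  let: And3 PI P1 _ := PP in ideal_pred PI P1.

Fact prime_pred_ideal P (PP : is_prime P) : idealr_closed (prime_pred PP).
Proof. by case: PP => PI P1 PM; apply: ideal_pred_closed. Qed.

Fact prime_pred_prime P (PP : is_prime P) : prime_idealr_closed (prime_pred PP).
Proof.
case: PP => PI P1 PM u v /asboolP/PM[Pu|Pv]; apply/orP; [left|right]; exact/asboolP.
Qed.

HB.instance Definition _ P (PP : is_prime P) :=
  isIdealr.Build A (prime_pred PP) (prime_pred_ideal PP).
HB.instance Definition _ P (PP : is_prime P) :=
  isPrimeIdealrClosed.Build A (prime_pred PP) (@prime_pred_prime P PP).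

Lemma exists_prime_idealr P : is_prime P ->
  exists I : prime_idealr A, forall a, a \in I <-> P a.
Proof.
move=> PP; exists (prime_pred PP) => a.
by case: PP => PI P1 PM; split=> [/asboolP|/asboolP].
Qed.

Lemma idealr_is_ideal (I : idealr A) : is_ideal (fun a => a \in I).
Proof. by split=> [|a b|a b]; [exact: rpred0 | exact: rpredD | exact: idealMr]. Qed.

Lemma idealr_proper (I : idealr A) : ~ (1 \in I).
Proof. by rewrite idealr1. Qed.

Lemma prime_idealr_is_prime (I : prime_idealr A) : is_prime (fun a => a \in I).
Proof.
split; [exact: idealr_is_ideal|exact: idealr_proper|move=> a b].
by rewrite prime_idealrM => /orP.
Qed.

End BooleanIdeals.

(** * Bounded Hilbert functions *)

Section Dimension.
Variables (K : fieldType) (n : nat).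
Local Notation R := {mpoly K[n]}.
Local Notation hc d p := (pihomog mdeg d p).
Implicit Types (I J P Q : R -> Prop) (f g a b p q u : R).

Lemma bounded_eventually J T B : is_ideal J ->
  (forall t, (T <= t)%N -> spanned (hpart t) J B) -> bounded J.
Proof.
move=> JI sp; suff [B' sp'] : exists B', forall t, (t < T)%N -> spanned (hpart t) J B'.
  exists (maxn B B') => t; have [/sp'|/sp] := ltnP t T; apply: spanned_leq.
    exact: leq_maxr.
  exact: leq_maxl.
elim: {sp} T => [|T [B' IH]]; first by exists 0%N.
have [N spN] := hpart_spanned T JI; exists (maxn N B') => t.
rewrite ltnS leq_eqVlt => /predU1P[->|/IH]; last exact/spanned_leq/leq_maxr.
by apply: spanned_leq spN; apply: leq_maxl.
Qed.

Lemma mono_ideal J N : is_ideal J ->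
  (forall m : 'X_{1..n}, mdeg m = N -> J 'X_[m]) ->
  forall t f, (N <= t)%N -> hpart t f -> J f.
Proof.
move=> JI HN t f le_Nt hf.
have HX k : forall m : 'X_{1..n}, mdeg m = (N + k)%N -> J 'X_[m].
  elim: k => [|k IH] m dm; first by apply: HN; rewrite dm addn0.
  have [i [m' [dm' ->]]] : exists i m', mdeg m' = (N + k)%N /\ m = (m' + U_(i))%MM.
    by apply: monomial_split; rewrite dm addnS.
  by rewrite mpolyXD; apply: idealMl => //; apply: IH.
rewrite [f]mpolyE big_seq_cond; apply: ideal_sum => // m /andP[mf _].
apply: idealZ => //; apply: (HX (t - N)%N).
by rewrite subnKC // (dhomog_mf hf mf).
Qed.

Lemma hpart_vars J : is_ideal J -> (forall i, J 'X_i) ->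
  forall t f, (0 < t)%N -> hpart t f -> J f.
Proof.
move=> JI JX; apply: mono_ideal => // m /eqP; rewrite mdeg_eq1 => /existsP[i /eqP->].
exact: JX.
Qed.

(* [J + (f)] contains all forms of large degree, so multiplication by [f] bounds
   the later values of the Hilbert function of [J] by the earlier ones. *)
Lemma spanned_hyperplane J f T t h : is_ideal J -> homog_ideal J -> hpart 1 f ->
  (forall s g, (T <= s)%N -> hpart s g -> adjoin J f g) ->
  (T <= t.+1)%N -> spanned (hpart t) J h -> spanned (hpart t.+1) J h.
Proof.
move=> JI Jh hf JT le_Tt sp; rewrite -addn1 -[h]addn0.
apply: (spanned_adjoin JI Jh hf).
  by apply: spanned_le sp => g Jg; apply: idealMl.
by apply: spanned0 => u; apply: JT; rewrite addn1.
Qed.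

Lemma bounded_hyperplane J f T : is_ideal J -> homog_ideal J -> hpart 1 f ->
  (forall s g, (T <= s)%N -> hpart s g -> adjoin J f g) -> bounded J.
Proof.
move=> JI Jh hf JT; have [B sp] := hpart_spanned T JI.
apply: (bounded_eventually JI (T := T) (B := B)) => t /subnK <-.
elim: (t - T)%N => [//|k IH]; rewrite addSn.
by apply: (spanned_hyperplane JI Jh hf JT) => //; lia.
Qed.

(** For a variable x_i outside P, all primes in a filtration of P + (x_i) are strictly larger than
    P, hence irrelevant. So P + (x_i) contains all forms of large degree. *)
Lemma bounded_prime P : is_prime P -> homog_ideal P ->
  (forall Q, is_prime Q -> homog_ideal Q -> ideal_le P Q -> ~ ideal_le Q P ->
    forall i, Q 'X_i) -> bounded P.
Proof.
move=> PP Ph Pmax; have [PI P1 PM] := PP.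
have [PX|/existsNP[i nPi]] := EM (forall i, P 'X_i).
  apply: (bounded_eventually PI (T := 1) (B := 0%N)) => t t0.
  by apply: spanned0 => u; apply: hpart_vars.
have hX : hpart 1 ('X_i : R) by apply: hpart_var.
have aI := ideal_adjoin 'X_i PI.
have [Ps fP] := filtration_exists aI (homog_adjoin PI Ph hX).
have [||N HN] := filtration_power (b := 0) (g := 1) aI fP; last first.
- apply: (bounded_hyperplane (T := N) PI Ph hX); apply: mono_ideal => // m.
  by move/HN; rewrite mulr1.
- by rewrite mul0r; apply: ideal0.
move=> Q /(filtration_le aI fP)[QP Qh le] []; apply: Pmax => //.
  by move=> a Pa; apply/le/adjoin_le.
by move=> QlP; apply: nPi; apply/QlP/le/adjoin_gen.
Qed.

End Dimension.

(** * Dimension of schemes through Hilbert functions *)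

Section Schemes.
Variables (K : fieldType) (n : nat).
Local Notation R := {mpoly K[n.+1]}.
Implicit Types (I J P Q : R -> Prop) (X C Z : closed_subscheme K n).

Definition vanishing_ideal X : R -> Prop := fun f => f \in ideal_of X.

Lemma vanishing_is_ideal X : is_ideal (vanishing_ideal X).
Proof. exact: idealr_is_ideal. Qed.

Lemma vanishing_homog X : homog_ideal (vanishing_ideal X).
Proof. by move=> f d Xf; apply: ideal_of_homogeneous. Qed.

Lemma vanishing_proper X : ~ vanishing_ideal X 1.
Proof. exact: idealr_proper. Qed.

Lemma integral_prime X : integral_scheme X -> is_prime (vanishing_ideal X).
Proof.
move=> XP; split; [exact: vanishing_is_ideal|exact: vanishing_proper|].
by move=> a b /XP/orP.
Qed.

Definition relevant P : Prop :=
  [/\ is_prime P, homog_ideal P & exists i, ~ P 'X_i].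

Lemma dimension_chain X d (c : nat -> R -> Prop) e : has_dimension X d ->
  (forall i, (i <= e)%N -> relevant (c i) /\ ideal_le (vanishing_ideal X) (c i)) ->
  (forall i, (i < e)%N -> ideal_le (c i) (c i.+1) /\ ~ ideal_le (c i.+1) (c i)) ->
  (e <= d)%N.
Proof.
move=> [_ dmax] cP cc; apply: dmax.
(* Chains are indexed by all of [nat] and consist of primes throughout, so [c] is frozen beyond
   index [e]. *)
have /choice [D DP] : forall i, exists I : prime_idealr R,
    forall a, a \in I <-> c (minn i e) a.
  by move=> i; have [[cp _ _] _] := cP _ (geq_minr i e); apply: exists_prime_idealr.
exists D; split=> i lei; have := DP i.
  have := DP i.+1; rewrite (minn_idPl lei) (minn_idPl (ltnW lei)) => D1 D0.
  have [le nle] := cc i lei; split=> [a /D0/le/D1//|sub]; apply: nle => a /D1/sub.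
  by move/D0.
rewrite (minn_idPl lei) => D0; have [[_ ch [j nj]] cX] := cP i lei; split.
  split; first by move=> f /D0/ch hf k; apply/D0/hf.
  by exists j; apply/negP => /D0.
by move=> a /cX/D0.
Qed.

Lemma zero_dimensional_bounded Z : zero_dimensional Z -> bounded (vanishing_ideal Z).
Proof.
move=> Zdim; have ZI := vanishing_is_ideal Z; have Zh := vanishing_homog (X := Z).
have [Ps fP] := filtration_exists ZI Zh.
apply: (bounded_filtration ZI Zh fP) => P /(filtration_le ZI fP)[PP Ph le].
apply: bounded_prime => // Q QP Qh PQ nQP i; apply: contrapT => nQi.
pose c k := if k is 0 then P else Q.
have // : (1 <= 0)%N; apply: (dimension_chain (c := c) Zdim).
  case=> [|k] _ /=; split=> //; last by move=> a /le/PQ.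
    by split=> //; exists i => /PQ.
  by split=> //; exists i.
by case=> // _.
Qed.

(** Every prime of a filtration of I_C + (f) strictly contains I_C; a larger relevant prime above it
    would complete a chain of length 2. *)
Lemma curve_bounded C f e : integral_curve C -> hpart e f ->
  ~ vanishing_ideal C f -> bounded (adjoin (vanishing_ideal C) f).
Proof.
move=> [Cint Cdim] hf nf; have CI := vanishing_is_ideal C.
have Ch := vanishing_homog (X := C).
have aI := ideal_adjoin f CI; have ah := homog_adjoin CI Ch hf.
have [Ps fP] := filtration_exists aI ah.
apply: (bounded_filtration aI ah fP) => P /(filtration_le aI fP)[PP Ph le].
apply: bounded_prime => // Q QP Qh PQ nQP i; apply: contrapT => nQi.
have CP : ideal_le (vanishing_ideal C) P by move=> a Ca; apply/le/adjoin_le.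
pose c k := match k with 0 => vanishing_ideal C | 1 => P | _ => Q end.
have // : (2 <= 1)%N; apply: (dimension_chain (c := c) Cdim).
  case=> [|[|k]] _ /=; split=> //; last by move=> a /CP/PQ.
  - by split=> //; [apply: integral_prime | exists i => /CP/PQ].
  - by split=> //; exists i => /PQ.
  - by split=> //; exists i.
case=> [|[|//]] _ //=; split=> // PC; apply: nf; apply/PC/le/adjoin_gen.
exact: CI.
Qed.

Lemma dimension_witness X d : has_dimension X d ->
  exists c : nat -> R -> Prop,
    (forall i, (i <= d)%N -> relevant (c i) /\ ideal_le (vanishing_ideal X) (c i)) /\
    forall i, (i < d)%N -> ideal_le (c i) (c i.+1) /\ ~ ideal_le (c i.+1) (c i).
Proof.
move=> [[c [cc cP]] _]; exists (fun i a => a \in c i); split=> i lei.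
  have [[ch [j nj]] le] := cP i lei; split=> //; split.
  - exact: prime_idealr_is_prime.
  - by move=> f k /ch.
  by exists j; apply/negP.
by have [le nle] := cc i lei.
Qed.

(** In a chain p_0 < p_1 of relevant primes take a form a of degree e in p_1 but not in p_0, and a
    variable x outside p_1. The products a^j x^((k-j)e) with j < k are independent modulo p_0. *)
Lemma curve_unbounded C : integral_curve C -> ~ bounded (vanishing_ideal C).
Proof.
move=> [_ Cdim] [B sp]; have [c [cP cc]] := dimension_witness Cdim.
have [[p0 h0 _] le0] := cP 0%N isT; have [[p1 h1 [i ni]] le1] := cP 1%N isT.
have [le nle] := cc 0%N isT.
have [a c1a nc0a] : exists2 a, c 1%N a & ~ c 0%N a.
  apply: contrapT => no; apply: nle => a c1a; apply: contrapT => nc0.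
  by apply: no; exists a.
have [I0 _ M0] := p0; have [I1 one1 M1] := p1.
have [e ne] := homog_notin I0 nc0a.
have ind k : independent (hpart (k * e)) (c 0%N) k.
  elim: k => [|k IH]; first by exists [::].
  rewrite mulSn addnC -[k.+1]add1n.
  apply: (independent_add (f := pihomog mdeg e a) I0 I1 le) IH.
  - exact: (h1 _ e c1a).
  - by move=> c' s _ /M0[].
  - by move=> g hg; rewrite /hpart dhomogM ?pihomogP.
  apply: (independent1 (f := 'X_i ^+ (k * e + e))) => //.
    have := dhomogMn (k * e + e) (hpart_var K i); rewrite mul1n; exact.
  by elim: (k * e + e)%N => [|j IH]; rewrite ?expr0 // exprS => /M1[].
have := independent_leq I0 (ind B.+1) (spanned_le le0 (sp _)).
by rewrite ltnn.
Qed.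

End Schemes.

(** * Exact graded complexes modulo a regular sequence of linear forms *)

Section GradedComplex.
Variables (K : fieldType) (n : nat).
Local Notation R := {mpoly K[n]}.
Local Notation hc d p := (pihomog mdeg d p).

(* [p] is a form of degree [D] in the twisted module [R(- s)]. *)
Definition shifted_homog (D s : nat) (p : R) : bool :=
  if (s <= D)%N then p \is (D - s).-homog else p == 0.

Definition shifted_part (D s : nat) (p : R) : R :=
  if (s <= D)%N then hc (D - s) p else 0.

Lemma shifted_part_homog D s p : shifted_homog D s (shifted_part D s p).
Proof.
by rewrite /shifted_homog /shifted_part; case: leqP => _; rewrite ?pihomogP ?eqxx.
Qed.

Lemma shifted_part_id D s p : shifted_homog D s p -> shifted_part D s p = p.
Proof.
rewrite /shifted_homog /shifted_part; case: leqP => _; first exact: pihomog_dE.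
by move/eqP.
Qed.

Lemma shifted_part_sum D s (I : finType) (F : I -> R) :
  shifted_part D s (\sum_i F i) = \sum_i shifted_part D s (F i).
Proof.
by rewrite /shifted_part; case: leqP => _; [rewrite raddf_sum | rewrite big1].
Qed.

Lemma shifted_partB D s p q :
  shifted_part D s (p - q) = shifted_part D s p - shifted_part D s q.
Proof. by rewrite /shifted_part; case: leqP => _; [rewrite linearB | rewrite subr0]. Qed.

Lemma shifted_partM D s t p q : shifted_homog t s q ->
  shifted_part D s (p * q) = shifted_part D t p * q.
Proof.
rewrite /shifted_homog /shifted_part; case: (leqP s t) => [le_st hq|_ /eqP->]; last first.
  by rewrite !mulr0; case: ifP => _; rewrite ?linear0.
rewrite mulrC (hc_mul _ _ hq) [RHS]mulrC.
case: (leqP t D) => [le_tD|lt_Dt].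
  by rewrite (leq_trans le_st le_tD) leq_sub2r //; congr (_ * hc _ _); lia.
rewrite mulr0; case: ifP => // le_sD; case: ifP => // le; lia.
Qed.

Lemma shifted_part_linear D s l p : hpart 1 l ->
  shifted_part D.+1 s (l * p) = l * shifted_part D s p.
Proof.
move=> hl; rewrite /shifted_part (hc_mul _ _ hl).
case: (leqP s D) => [le_sD|lt_Ds].
  by rewrite (leq_trans le_sD) // subn_gt0 ltnS le_sD; congr (_ * hc _ _); lia.
by rewrite mulr0; case: ifP => // ?; case: ifP => // ?; lia.
Qed.

Lemma shifted_homog_linear D s l p : hpart 1 l -> shifted_homog D s p ->
  shifted_homog D.+1 s (l * p).
Proof.
by move=> hl hp; rewrite -(shifted_part_id hp) -shifted_part_linear // shifted_part_homog.
Qed.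

Lemma shifted_homogB D s p q :
  shifted_homog D s p -> shifted_homog D s q -> shifted_homog D s (p - q).
Proof.
by move=> hp hq; rewrite -(shifted_part_id hp) -(shifted_part_id hq) -shifted_partB
  shifted_part_homog.
Qed.

Lemma shifted_part_ideal (J : R -> Prop) D s p : is_ideal J -> homog_ideal J ->
  J p -> J (shifted_part D s p).
Proof.
by move=> JI Jh Jp; rewrite /shifted_part; case: ifP => _; [apply: Jh | apply: ideal0].
Qed.

Fixpoint flag (l : nat -> R) (k : nat) : R -> Prop :=
  if k is k'.+1 then adjoin (flag l k') (l k') else fun f => f = 0.

Lemma flag_ideal l k : is_ideal (flag l k).
Proof.
elim: k => [|k IH]; last exact: ideal_adjoin.
split=> [//|a b /= -> ->|a b /= ->]; first exact: addr0.
exact: mulr0.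
Qed.

Variables (rk : nat -> nat) (sh : forall i, 'I_(rk i) -> nat)
  (dd : forall i, 'M[R]_(rk i.+1, rk i)).
Hypothesis dd_graded : forall i j k, shifted_homog (sh j) (sh k) (dd i j k).
Hypothesis dd_exact : forall i (v : 'rV_(rk i.+1)),
  v *m dd i = 0 <-> exists w, v = w *m dd i.+1.

Variables (N : nat) (l : nat -> R) (r : nat).
Hypothesis l_linear : forall k, (k < N)%N -> hpart 1 (l k).
Hypothesis l_regular : forall k, (k < N)%N -> forall f,
  flag l k (f * l k) -> flag l k f.
Hypothesis l_vars : forall i, flag l N 'X_i.

Local Notation "v =[ k ] w" := (forall j, flag l k ((v - w) 0 j))
  (at level 70, k at level 2).

Definition homog_vector i (D : nat) (v : 'rV[R]_(rk i)) : Prop :=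
  forall j, shifted_homog D (sh j) (v 0 j).

Definition vector_part i (D : nat) (v : 'rV[R]_(rk i)) : 'rV[R]_(rk i) :=
  \row_j shifted_part D (sh j) (v 0 j).

Definition boundary k i (v : 'rV[R]_(rk i)) : Prop :=
  exists w, v =[k] (w *m dd i).

Lemma flag_homog k : (k <= N)%N -> homog_ideal (flag l k).
Proof.
elim: k => [_ f d /= ->|k IH lt_k]; first by rewrite linear0.
by apply: homog_adjoin (l_linear lt_k); [apply: flag_ideal | apply/IH/ltnW].
Qed.

Lemma dd_comp i (w : 'rV[R]_(rk i.+2)) : w *m dd i.+1 *m dd i = 0.
Proof. by apply/dd_exact; exists w. Qed.

Lemma flag_mulmx k i (v w : 'rV[R]_(rk i.+1)) : v =[k] w -> (v *m dd i) =[k] (w *m dd i).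
Proof.
move=> E j; rewrite -mulmxBl mxE; apply: ideal_sum => [|x _]; first exact: flag_ideal.
by apply: idealMl; [apply: flag_ideal | apply: E].
Qed.

Lemma flag_trans k i (u v w : 'rV[R]_(rk i)) : u =[k] v -> v =[k] w -> u =[k] w.
Proof.
move=> E F j; rewrite -(subrKA v) mxE; apply: idealD; first exact: flag_ideal.
  exact: E.
exact: F.
Qed.

Lemma flag_sym k i (u v : 'rV[R]_(rk i)) : u =[k] v -> v =[k] u.
Proof.
by move=> E j; rewrite -opprB mxE; apply: idealN; [apply: flag_ideal | apply: E].
Qed.

Lemma flag_scale k i a (u v : 'rV[R]_(rk i)) : u =[k] v -> (a *: u) =[k] (a *: v).
Proof.
by move=> E j; rewrite -scalerBr mxE; apply: idealM; [apply: flag_ideal | apply: E].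
Qed.

Lemma flag_cancel k i (u v : 'rV[R]_(rk i)) : (k < N)%N ->
  (l k *: u) =[k] (l k *: v) -> u =[k] v.
Proof.
move=> lt_k E j; apply: l_regular => //; have := E j.
by rewrite -scalerBr [X in flag _ _ X]mxE mulrC.
Qed.

Lemma flagSP k i (u v : 'rV[R]_(rk i)) : u =[k.+1] v ->
  exists y, u =[k] (v + l k *: y).
Proof.
move=> E; have /choice [y yP] : forall j, exists y, flag l k ((u - v) 0 j - y * l k).
  by move=> j; have [b Jb [y ->]] := E j; exists y; rewrite addrK.
exists (\row_j y j) => j; have := yP j.
by rewrite !mxE opprD addrA [l k * _]mulrC.
Qed.

Lemma flagS_le k i (u v : 'rV[R]_(rk i)) y : u =[k] (v + l k *: y) -> u =[k.+1] v.
Proof.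
move=> E j; exists ((u - (v + l k *: y)) 0 j); first exact: E.
by exists (y 0 j); rewrite !mxE; ring.
Qed.

Lemma homog_part D i (v : 'rV[R]_(rk i)) : homog_vector D (vector_part D v).
Proof. by move=> j; rewrite mxE shifted_part_homog. Qed.

Lemma vector_part_id D i (v : 'rV[R]_(rk i)) : homog_vector D v -> vector_part D v = v.
Proof. by move=> hv; apply/rowP => j; rewrite mxE shifted_part_id. Qed.

Lemma vector_part_mul D i (v : 'rV[R]_(rk i.+1)) :
  vector_part D (v *m dd i) = vector_part D v *m dd i.
Proof.
apply/rowP => j; rewrite !mxE shifted_part_sum; apply: eq_bigr => x _.
by rewrite mxE; apply: shifted_partM.
Qed.

Lemma vector_part_scale D i a (v : 'rV[R]_(rk i)) : hpart 1 a ->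
  vector_part D.+1 (a *: v) = a *: vector_part D v.
Proof. by move=> ha; apply/rowP => j; rewrite !mxE shifted_part_linear. Qed.

Lemma vector_part_flag k D i (u v : 'rV[R]_(rk i)) : (k <= N)%N ->
  u =[k] v -> vector_part D u =[k] vector_part D v.
Proof.
move=> le_k E j; have := E j; rewrite !mxE -shifted_partB => Ej.
by apply: shifted_part_ideal Ej; [apply: flag_ideal | apply: flag_homog].
Qed.

Lemma homog_vector_scale D i a (v : 'rV[R]_(rk i)) : hpart 1 a ->
  homog_vector D v -> homog_vector D.+1 (a *: v).
Proof. by move=> ha hv j; rewrite mxE shifted_homog_linear. Qed.

Lemma homog_vectorB D i (u v : 'rV[R]_(rk i)) :
  homog_vector D u -> homog_vector D v -> homog_vector D (u - v).
Proof. by move=> hu hv j; rewrite !mxE shifted_homogB. Qed.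

Lemma homog_vector_mul D i (v : 'rV[R]_(rk i.+1)) :
  homog_vector D v -> homog_vector D (v *m dd i).
Proof. by move=> hv; rewrite -(vector_part_id hv) -vector_part_mul; apply: homog_part. Qed.

(* The complex modulo the first [k] members of the flag has no homology in index
   [i > a] and degree [>= i + r]. *)
Definition acyclic_above k a : Prop := forall i, (a <= i)%N ->
  forall (v : 'rV[R]_(rk i.+1)) D, (i.+1 + r <= D)%N -> homog_vector D v ->
  (v *m dd i) =[k] 0 -> boundary k v.

Lemma acyclic_above0 : acyclic_above 0 0.
Proof.
move=> i _ v D _ _ dv; have /dd_exact[w ->] : v *m dd i = 0.
  by apply/rowP => j; have := dv j; rewrite subr0 /= => ->; rewrite mxE.
by exists w => j; rewrite subrr mxE.
Qed.

(** Long exact sequence of multiplication by l_k: let d v = l_k y modulo the first k forms. If y = d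
    w, then v - l_k w is a cycle there, hence a boundary. The last hypothesis kills the connecting
    class y. *)
Lemma acyclic_above_core k a i (v : 'rV[R]_(rk i.+1)) D :
  (k < N)%N -> acyclic_above k a -> (a <= i)%N ->
  (i.+1 + r <= D)%N -> homog_vector D v -> (v *m dd i) =[k.+1] 0 ->
  (forall w, homog_vector D.-1 w -> (v *m dd i) =[k] (l k *: w) -> boundary k w) ->
  boundary k.+1 v.
Proof.
move=> lt_k acy le_ai le_D hv cv Hw.
have DS : D = D.-1.+1 by lia.
have [y] := flagSP cv; rewrite add0r => /(vector_part_flag D (ltnW lt_k)).
rewrite {2}DS (vector_part_scale _ _ (l_linear lt_k)) vector_part_id; last exact: homog_vector_mul.
move=> cy; have [w wP] := Hw _ (homog_part _ _) cy.
pose w' := vector_part D.-1 w.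
have {}wP : vector_part D.-1 y =[k] (w' *m dd i).
  have := vector_part_flag D.-1 (ltnW lt_k) wP.
  by rewrite vector_part_mul vector_part_id //; apply: homog_part.
have [||u uP] := acy i le_ai (v - l k *: w') D le_D.
- apply: homog_vectorB => //; rewrite DS; apply: homog_vector_scale; first exact: l_linear.
  exact: homog_part.
- rewrite mulmxBl -scalemxAl => j; rewrite subr0.
  exact: (flag_trans cy (flag_scale (l k) wP)).
exists u; apply: (@flagS_le _ _ _ _ w') => j.
by have := uP j; rewrite opprD addrA addrAC.
Qed.

(** The connecting class is a cycle because l_k is regular, and it lives one index lower; this is
    why one index is lost. *)
Lemma acyclic_aboveS k a : (k < N)%N -> acyclic_above k a -> acyclic_above k.+1 a.+1.
Proof.
move=> lt_k acy [//|i] le_ai v D le_D hv cv.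
apply: (acyclic_above_core lt_k acy _ le_D hv cv); first exact: ltnW.
move=> w hw cw; apply: (acy i le_ai w D.-1) => //; first by lia.
apply: (flag_cancel lt_k) => j; rewrite scaler0.
have := flag_mulmx (flag_sym cw) j.
by rewrite dd_comp scalemxAl.
Qed.

(** No index is lost if l_k is injective in degrees >= r on the cokernel in index 0: this covers the
    one connecting class that acyclicity does not control. *)
Lemma acyclic_above_stable k : (k < N)%N -> acyclic_above k 0 ->
  (forall D (w : 'rV[R]_(rk 0)), (r <= D)%N -> homog_vector D w ->
     boundary k (l k *: w) -> boundary k w) ->
  acyclic_above k.+1 0.
Proof.
move=> lt_k acy inj i _ v D le_D hv cv.
apply: (acyclic_above_core lt_k acy _ le_D hv cv) => // w hw cw.
case: i v le_D hv cv w hw cw => [|i] v le_D hv cv w hw cw.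
  apply: (inj D.-1) => //; first by lia.
  by exists v; apply: flag_sym.
apply: (acy i _ w D.-1) => //; first by lia.
apply: (flag_cancel lt_k) => j; rewrite scaler0.
have := flag_mulmx (flag_sym cw) j.
by rewrite dd_comp scalemxAl.
Qed.

(** A socle element of the whole cokernel of [dd a] modulo the flag, not only of the homology inside
    it. For a resolution of R/I and a = 0 this cokernel is R/I modulo the flag. *)
Definition homology_socle k a t : Prop := exists v : 'rV[R]_(rk a),
  [/\ homog_vector (t + a) v, ~ boundary k v
    & forall x, hpart 1 x -> boundary k (x *: v)].

(** The new element is w with d w = l_k v. Were w a boundary modulo l_k, cancelling l_k would make v
    one. If x v = d z, then x w - l_k z is a cycle of degree t + a + 2 >= a + 1 + r, hence a
    boundary. *)
Lemma homology_socleS k a t : (k < N)%N -> (r <= t)%N -> acyclic_above k a ->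
  homology_socle k a t -> homology_socle k.+1 a.+1 t.
Proof.
move=> lt_k le_rt acy [v [hv nbv sv]].
have sv' x : hpart 1 x -> exists2 w, homog_vector (t + a).+1 w & (x *: v) =[k] (w *m dd a).
  move=> hx; have [w wP] := sv x hx; exists (vector_part (t + a).+1 w).
    exact: homog_part.
  have := vector_part_flag (t + a).+1 (ltnW lt_k) wP.
  by rewrite vector_part_mul vector_part_id //; apply: homog_vector_scale.
have [w hw wP] := sv' _ (l_linear lt_k).
exists w; split; first by rewrite addnS.
  move=> [w' /flagSP[y yP]]; apply: nbv; exists y; apply: (flag_cancel lt_k).
  apply: flag_trans wP _ => j; have := flag_mulmx yP j.
  by rewrite mulmxDl dd_comp add0r scalemxAl.
move=> x hx; have [z hz zP] := sv' x hx.
have [|||u uP] := acy a (leqnn a) (x *: w - l k *: z) (t + a).+2.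
- by lia.
- by apply: homog_vectorB; apply: homog_vector_scale => //; apply: l_linear.
- move=> j; rewrite subr0 mulmxBl -!scalemxAl.
  apply: (flag_trans (flag_scale x (flag_sym wP))) => {}j.
  by have := flag_scale (l k) zP j; rewrite !scalerA mulrC.
exists u; apply: (@flagS_le _ _ _ _ z) => j; have := uP j.
by rewrite opprD addrA addrAC.
Qed.

Hypothesis sh0 : forall j : 'I_(rk 0), sh j = 0%N.
Hypothesis sh_lt : forall i (j : 'I_(rk i.+1)), (sh j < i.+1 + r)%N.

(* Dividing out the remaining linear forms moves a socle element of index [0] to
   a minimal generator of the module of index [N - k]. *)
Lemma socle_degree k t : (k <= N)%N -> acyclic_above k 0 -> homology_socle k 0 t ->
  (r <= t)%N -> t = 0%N.
Proof.
move=> le_k acy soc le_rt.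
have : acyclic_above N (N - k) /\ homology_socle N (N - k) t.
  rewrite -[N in acyclic_above N]addn0 -{1 3}(subnKC le_k) addn0.
  have : (N - k <= N - k)%N by [].
  elim: {1 3 4 5 6}(N - k)%N => [|e IH] lt_e; first by rewrite addn0.
  have [acy' soc'] := IH (ltnW lt_e); have lt_ke : (k + e < N)%N by lia.
  rewrite addnS; split; first exact: acyclic_aboveS.
  exact: homology_socleS.
case=> _ [v [hv nbv _]].
(* The full flag contains every variable, so a coordinate outside it is a nonzero constant, and its
   shift must be t + (N - k). *)
have [j nj] : exists j, ~ flag l N (v 0 j).
  apply: contrapT => no; apply: nbv; exists 0 => j; rewrite mul0mx subr0.
  by apply: contrapT => nj; apply: no; exists j.
have := hv j; rewrite /shifted_homog; case: leqP => [le_sh hvj|_ /eqP v0]; last first.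
  by case: nj; rewrite v0; apply: ideal0 (flag_ideal _ _).
have [lt|ge] := ltnP 0 (t + (N - k) - sh j).
  by case: nj; apply: hpart_vars hvj => //; apply: flag_ideal.
have {ge le_sh} shE : sh j = (t + (N - k))%N by lia.
move: (N - k)%N j shE {hv nbv nj hvj} v => [|a] j shE _; first by rewrite sh0 addn0 in shE.
by have := sh_lt j; rewrite shE; lia.
Qed.

End GradedComplex.

(** * Extension of maps from ideals into injective modules *)

Section Baer.
Variable S : comNzRingType.

Section IdealModule.
Variables (b : S -> Prop) (bI : is_ideal b).

Definition module_pred of is_ideal b : {pred S^o} := fun x => `[< b x >].

Fact module_pred_closed : submod_closed (module_pred bI).
Proof.
split=> [|c u v /asboolP bu /asboolP bv]; apply/asboolP; first exact: (ideal0 bI).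
exact: (idealD bI (idealM bI c bu) bv).
Qed.

HB.instance Definition _ :=
  GRing.isSubmodClosed.Build S S^o (module_pred bI) module_pred_closed.

Record ideal_module := IdealModule {
  ideal_module_val :> S^o; _ : ideal_module_val \in module_pred bI }.

HB.instance Definition _ := [isSub for ideal_module_val].
HB.instance Definition _ := [Choice of ideal_module by <:].
HB.instance Definition _ := [SubChoice_isSubLmodule of ideal_module by <:].

End IdealModule.

(** The rule z y -> z e, zero on a, is well defined on the ideal a + (y) and extends to S; e' is the
    image of 1. Injectivity is used below only in this form. *)
Lemma injective_extension (E : lmodType S) (a : S -> Prop) (y : S) (e : E) :
  injective_module E -> is_ideal a -> (forall z, a (z * y) -> z *: e = 0) ->
  exists2 e', (forall z, a z -> z *: e' = 0) & y *: e' = e.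
Proof.
move=> Einj aI ann; have bI := ideal_adjoin y aI.
pose M : lmodType S := ideal_module bI.
have valP' (x : M) : adjoin a y (ideal_module_val x) by case: x => x xP; apply/asboolP.
have /choice [c cP] : forall x : M, exists z, a (ideal_module_val x - z * y).
  by move=> x; have [w aw [z ->]] := valP' x; exists z; rewrite addrK.
pose g (x : M) : E := c x *: e.
have gE (x : M) z : a (ideal_module_val x - z * y) -> g x = z *: e.
  move=> az; apply/eqP; rewrite -subr_eq0 -scalerBl ann //.
  have -> : (c x - z) * y = (ideal_module_val x - z * y) - (ideal_module_val x - c x * y).
    by ring.
  exact: (idealB aI az (cP x)).
have gL : linear g.
  move=> k u v; apply/eqP; rewrite eq_sym; apply/eqP.
  rewrite [RHS](gE _ (k * c u + c v)) ?scalerDl ?scalerA // /=.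
  have -> : ideal_module_val (k *: u + v) - (k * c u + c v) * y =
      k * (ideal_module_val u - c u * y) + (ideal_module_val v - c v * y).
    rewrite mulrDl mulrBr !mulrA opprD addrACA; congr (_ + _).
  by apply: idealD => //; apply: idealM.
pose gl : {linear M -> E} := HB.pack g (GRing.isLinear.Build S M E _ g gL).
pose f : {linear M -> S^o} := val.
have [h hP] := Einj M S^o f gl val_inj.
have hE (x : S) (bx : adjoin a y x) z : a (x - z * y) -> h x = z *: e.
  move=> az; have xM : x \in module_pred bI by rewrite unfold_in; apply/asboolP.
  by have := hP (IdealModule xM : M); rewrite /= => ->; apply: (gE (IdealModule xM)).
have h1 (x : S) : x *: h 1 = h x by rewrite -linearZ /= [_ *: _]mulr1.
exists (h 1) => [z az|]; rewrite h1.
  by rewrite (hE z (adjoin_le _ az) 0) ?scale0r // mul0r subr0.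
rewrite (hE y (adjoin_gen _ aI) 1) ?scale1r // mul1r subrr; exact: ideal0 aI.
Qed.

End Baer.

(** * Ext groups of cyclic modules from a finite injective resolution *)

Section InjectiveResolution.
Variables (S : comNzRingType) (E : nat -> lmodType S) (eta : {linear S^o -> E 0%N})
  (d : forall i, {linear E i -> E i.+1}) (m : nat).
Hypothesis E_inj : forall i, injective_module (E i).
Hypothesis eta_inj : injective eta.
Hypothesis exact0 : forall y, d 0%N y = 0 <-> exists x, y = eta x.
Hypothesis exactS : forall i y, d i.+1 y = 0 <-> exists x, y = d i x.
Hypothesis E_finite : forall i, (m < i)%N -> forall x : E i, x = 0.
Implicit Types (a : S -> Prop) (h u v y z : S).

Definition killed_by a (i : nat) (e : E i) : Prop := forall z, a z -> z *: e = 0.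

(* [Ext^(i+1)(S / a, S) = 0], computed with the resolution [E]. *)
Definition ext_vanishes (i : nat) a : Prop := forall e : E i.+1,
  d i.+1 e = 0 -> killed_by a e -> exists2 e', killed_by a e' & d i e' = e.

Lemma ddE i (x : E i) : d i.+1 (d i x) = 0.
Proof. by apply/exactS; exists x. Qed.

Lemma ext_vanishes_iff i a b : (forall z, a z <-> b z) ->
  ext_vanishes i a -> ext_vanishes i b.
Proof.
move=> ab Xa e de be; have [z /ab|e' ae' <-] := Xa e de; first exact: be.
by exists e' => // z /ab; apply: ae'.
Qed.

Lemma ext_vanishes_top i a : a 1 -> ext_vanishes i a.
Proof.
move=> a1 e _ /(_ _ a1); rewrite scale1r => ->.
by exists 0; [move=> z _; rewrite scaler0 | rewrite linear0].
Qed.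

Lemma killed_adjoin a y i (e : E i) :
  killed_by a e -> y *: e = 0 -> killed_by (adjoin a y) e.
Proof.
move=> ae ye _ [b ab [w ->]].
by rewrite scalerDl ae // -scalerA ye scaler0 addr0.
Qed.

(** By 0 -> S/(a : y) -> S/a -> S/(a + (y)) -> 0, the group Ext^(i+1)(S/(a : y), S) sits between
    Ext^(i+1)(S/a, S) and Ext^(i+2)(S/(a + (y)), S). *)
Lemma ext_vanishes_colon i a y : is_ideal a -> ext_vanishes i a ->
  ext_vanishes i.+1 (adjoin a y) -> ext_vanishes i (colon a y).
Proof.
move=> aI Xa Xay e de ae.
have [f af yf] := injective_extension (@E_inj i.+1) aI ae.
have [||g ag dg] := Xay (d i.+1 f); first exact: ddE.
  apply: killed_adjoin => [z az|]; first by rewrite -linearZ /= af // linear0.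
  by rewrite -linearZ /= yf.
have [||g' ag' dg'] := Xa (f - g); first by rewrite linearB /= dg subrr.
  by move=> z az; rewrite scalerBr af // ag ?subrr //; apply: adjoin_le.
exists (y *: g'); first by move=> z az; rewrite scalerA ag'.
by rewrite linearZ /= dg' scalerBr yf ag ?subr0 //; apply: adjoin_gen.
Qed.

(** The middle term of the same exact sequence, all three groups being in degree i + 1. *)
Lemma ext_vanishes_extension i a y : is_ideal a -> ext_vanishes i (colon a y) ->
  ext_vanishes i (adjoin a y) -> ext_vanishes i a.
Proof.
move=> aI Xc Xay e de ae.
have [||g ag dg] := Xc (y *: e); first by rewrite linearZ /= de scaler0.
  by move=> z az; rewrite scalerA ae.
have [f af yf] := injective_extension (@E_inj i) aI ag.
have [||g' ag' dg'] := Xay (e - d i f); first by rewrite linearB /= de ddE subrr.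
  apply: killed_adjoin => [z az|].
    by rewrite scalerBr ae // -linearZ /= af // linear0 subrr.
  by rewrite scalerBr -linearZ /= yf dg subrr.
exists (f + g'); last by rewrite linearD /= dg' addrC subrK.
by move=> z az; rewrite scalerDr af // ag' ?addr0 //; apply: adjoin_le.
Qed.

Definition principal h : S -> Prop := adjoin (fun z => z = 0) h.

Lemma zero_is_ideal : is_ideal (fun z : S => z = 0).
Proof. by split=> [|a b -> ->|a b ->]; rewrite ?addr0 ?mulr0. Qed.

Lemma principalP h z : principal h z <-> exists y, z = y * h.
Proof.
split=> [[b -> [y ->]]|[y ->]]; first by exists y; rewrite add0r.
by exists 0 => //; exists y; rewrite add0r.
Qed.

(** * Socle of S/h for a local ring S and a regular element h with Artinian quotient *)

Section Regular.
Variables (h : S) (gens : seq S) (u v : S) (N : nat).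
Hypothesis h_regular : forall z, z * h = 0 -> z = 0.
Local Notation max := (generated_by gens).
Hypothesis max_unit : forall z, ~ max z -> exists w, w * z = 1.
Hypothesis gens_u : {in gens, forall x, principal h (x * u)}.
Hypothesis gens_v : {in gens, forall x, principal h (x * v)}.
Hypothesis u_nonzero : ~ principal h u.

Fixpoint products k : seq S :=
  if k is k'.+1 then [seq x * p | x <- gens, p <- products k'] else [:: 1].

Hypothesis products_h : {in products N, forall p, principal h p}.

Let hI : is_ideal (principal h) := ideal_adjoin h zero_is_ideal.

(** S/h has projective dimension one: a cocycle killed by h is d e', and subtracting from e' the
    differential of a quotient by h makes h kill it. *)
Lemma ext_vanishes_regular i : ext_vanishes i.+1 (principal h).
Proof.
move=> e de he; have /exactS[e' E'] := de.
have hh : principal h h by apply: adjoin_gen zero_is_ideal.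
have /exactS [e'' E''] : d i.+1 (h *: e') = 0 by rewrite linearZ /= -E' he.
have [z|g _ hg] := injective_extension (e := e'') (@E_inj i) zero_is_ideal (y := h).
  by move/h_regular => ->; rewrite scale0r.
exists (e' - d i g); last by rewrite linearB /= ddE subr0.
apply: killed_adjoin => [z -> //|]; first by rewrite scale0r.
by rewrite scalerBr -linearZ /= hg E'' subrr.
Qed.

Lemma principal_max x z : (x = u \/ x = v) -> max z -> principal h (z * x).
Proof.
move=> xuv; rewrite -/(colon (principal h) x z).
apply: generated_by_min; first exact: ideal_colon.
by case: xuv => ->.
Qed.

Lemma max_ext_vanishes i a : is_ideal a -> ideal_le max a ->
  ext_vanishes i max -> ext_vanishes i a.
Proof.
move=> aI le Xm; have [a1|na1] := EM (a 1); first exact: ext_vanishes_top.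
apply: ext_vanishes_iff Xm => z; split=> [/le//|az].
apply: contrapT => /max_unit[w wz]; apply: na1; rewrite -wz; exact: idealM.
Qed.

(** S/a has finite length: adjoining the products of k generators one at a time gives quotients
    S/max or zero. The list [q] holds the products possibly still outside [a]. *)
Lemma ext_vanishes_descent i : ext_vanishes i max -> forall k a, is_ideal a ->
  {in products k, forall p, a p} -> ext_vanishes i a.
Proof.
move=> Xm; elim=> [|k IH] a aI ak; first by apply/ext_vanishes_top/ak/mem_head.
suff H (q : seq S) : forall a, is_ideal a -> {in products k.+1, forall p, a p} ->
    {in products k, forall p, p \in q \/ a p} -> ext_vanishes i a.
  exact: (H (products k) a aI ak (fun p pk => or_introl pk)).
elim: q {a aI ak} => [|p q IHq] a aI ak aq; first by apply: IH => // p /aq[].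
have [pk|npk] := boolP (p \in products k); last first.
  apply: IHq => // p' p'k; have [|] := aq p' p'k; last by right.
  by rewrite inE => /predU1P[pp'|]; [rewrite -pp' p'k in npk|left].
apply: (ext_vanishes_extension (y := p)) => //.
  apply: max_ext_vanishes Xm; first exact: ideal_colon.
  apply: generated_by_min; first exact: ideal_colon.
  by move=> x gx; apply: ak; apply/allpairsP; exists (x, p).
apply: IHq => [|p' /ak|p' p'k]; [exact: ideal_adjoin|exact: adjoin_le|].
have [|/adjoin_le] := aq p' p'k; last by right.
by rewrite inE => /predU1P[->|]; [right; apply: adjoin_gen|left].
Qed.

(** Descending induction from beyond the length of the resolution. As (h) : u = max,
    Ext^(i+2)(S/max, S) sits between Ext^(i+2)(S/h, S) and Ext^(i+3)(S/(h, u), S), both zero; finite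
    length gives the other ideals. *)
Lemma ext_vanishes_all i a : is_ideal a -> ideal_le (principal h) a ->
  ext_vanishes i.+1 a.
Proof.
suff H k : forall i, (m <= i + k)%N -> forall a, is_ideal a ->
    ideal_le (principal h) a -> ext_vanishes i.+1 a.
  by apply: (H m); apply: leq_addl.
elim: k => [|k IH] {}i le_m {}a aI le.
  move=> e _ _; exists 0; first by move=> z _; rewrite scaler0.
  by rewrite linear0 [e]E_finite //; lia.
apply: (@ext_vanishes_descent i.+1 _ N a aI); last by move=> p /products_h/le.
have Xu : ext_vanishes i.+1 (colon (principal h) u).
  apply: ext_vanishes_colon => //; first exact: ext_vanishes_regular.
  apply: IH; [by lia|exact: ideal_adjoin|exact: adjoin_le].
apply: ext_vanishes_iff Xu => z; split=> [Hzu|]; last by apply: principal_max; left.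
apply: contrapT => /max_unit[w wz]; apply: u_nonzero.
by rewrite -[u]mul1r -wz -mulrA; apply: idealM.
Qed.

(* [eps] generates [Ext^1(S / h, S)], which is [S / h]: the multiples [u eps] and
   [v eps] represent [u] and [v], and a map from [S u] extends to [S / h]. *)
Lemma socle_generator : exists c, principal h (v - c * u).
Proof.
(* As h e1 = eta 1, the class of d e1 is the connecting image of 1 in Ext^1(S/h, S). *)
have [z|e1 _ he1] := injective_extension (e := eta 1) (@E_inj 0) zero_is_ideal (y := h).
  by move/h_regular => ->; rewrite scale0r.
pose eps := d 0 e1.
have etaZ s : s *: eta 1 = eta s by rewrite -linearZ /= [_ *: _]mulr1.
have heps : h *: eps = 0 by rewrite -linearZ /= he1; apply/exact0; exists 1.
have hH : principal h h by apply: adjoin_gen zero_is_ideal.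
have killed_eps s : principal h s -> s *: eps = 0.
  by case/principalP => y ->; rewrite -scalerA heps scaler0.
have killedP i (e : E i) : h *: e = 0 -> killed_by (principal h) e.
  by move=> he; apply: killed_adjoin => // z ->; rewrite scale0r.
(* Injectivity of S/h -> Ext^1(S/h, S), s -> s eps. *)
have epsP s g : killed_by (principal h) g -> s *: eps = d 0 g -> principal h s.
  move=> kg; rewrite /eps -linearZ /= => /eqP; rewrite -subr_eq0 -linearB /=.
  move=> /eqP/exact0[w E']; apply/principalP; exists w.
  have := congr1 ( *:%R h) E'; rewrite scalerBr (kg h hH) subr0 scalerA mulrC -scalerA he1.
  by rewrite etaZ -linearZ /= => /eta_inj ->; rewrite [LHS]mulrC.
have [z Hzu|f fH fu] := injective_extension (e := v *: eps) (@E_inj 1) hI (y := u).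
  rewrite scalerA; apply: killed_eps; apply: principal_max; first by right.
  apply: contrapT => /max_unit[w wz]; apply: u_nonzero.
  by rewrite -[u]mul1r -wz -mulrA; apply: idealM.
(* Vanishing of Ext^2(S/(h, u), S) corrects [f] to a cocycle f - g that still satisfies u (f - g) =
   v eps. It equals s eps up to a coboundary, and this s is the coefficient sought. *)
have [||||g gH dg] := @ext_vanishes_all 0 (adjoin (principal h) u) _ _ (d 1 f).
- exact: ideal_adjoin.
- exact: adjoin_le.
- exact: ddE.
- apply: killed_adjoin => [z Hz|]; first by rewrite -linearZ /= fH // linear0.
  by rewrite -linearZ /= fu linearZ /= ddE scaler0.
have /exactS[x fgx] : d 1 (f - g) = 0 by rewrite linearB /= dg subrr.
have hfg : h *: (f - g) = 0 by rewrite scalerBr fH // gH ?subrr //; apply: adjoin_le.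
have /exact0[s hx] : d 0 (h *: x) = 0 by rewrite linearZ /= -fgx.
exists s; apply: (epsP _ (u *: (x - s *: e1))).
  apply: killedP; rewrite scalerA mulrC -scalerA scalerBr hx scalerA mulrC -scalerA.
  by rewrite he1 etaZ subrr scaler0.
rewrite linearZ /= linearB /= -fgx linearZ /= -/eps !scalerBr fu.
rewrite gH ?subr0; last by apply: adjoin_gen.
by rewrite scalerBl scalerA mulrC.
Qed.

End Regular.
End InjectiveResolution.

(** * The socle of a hyperplane section of a Gorenstein coordinate ring *)

Section GorensteinSocle.
Variables (K : fieldType) (n : nat).
Local Notation R := {mpoly K[n.+1]}.
Local Notation hc d p := (pihomog mdeg d p).
Implicit Types (X Z : closed_subscheme K n).

Lemma coordinate_ring_surjection X :
  exists q : {rmorphism R -> coordinate_ring X},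
    (forall b, exists p, q p = b) /\ (forall p, q p = 0 <-> vanishing_ideal X p).
Proof.
pose q : {rmorphism R -> coordinate_ring X} := \pi_(coordinate_ring X)%qT.
exists q; split=> [b|p]; first by exists (repr b); apply: reprK.
rewrite /vanishing_ideal -[p in p \in _]subr0 Quotient.idealrBE -(rmorph0 q).
by split=> [/eqP|/eqP].
Qed.

Lemma hc0 p : hc 0 p = (p@_0)%:MP :> R.
Proof.
have h0 : (hc 0 p : R)@_0 = p@_0.
  have [p0|p0] := posnP (msize p).
    by move/eqP: p0; rewrite msize_poly_eq0 => /eqP->; rewrite linear0.
  rewrite [in RHS](hc_sum p) (bigD1 (Ordinal p0)) //= mcoeffD.
  rewrite [X in _ + X]raddf_sum big1 ?addr0 //= => i.
  rewrite -val_eqE /= => i0; apply: dhomog_nemf_coeff (pihomogP _ _ _) _.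
  by rewrite mf0 eq_sym.
rewrite -h0; apply/mpolyP => m; rewrite mcoeffC.
have [<-|m0] := eqVneq 0%MM m; first by rewrite mulr1.
rewrite mulr0; apply: dhomog_nemf_coeff (pihomogP _ _ _) _.
by rewrite -[_ != _]/(mdeg m != 0%N) mdeg_eq0 eq_sym.
Qed.

Lemma vars_sub (J : R -> Prop) p : is_ideal J -> (forall i, J 'X_i) ->
  p@_0 = 0 -> J p.
Proof.
move=> JI JX p0; apply: homog_mem => // d.
have [->|d0] := posnP d; first by rewrite hc0 p0 mpolyC0; apply: ideal0.
by apply: (hpart_vars JI JX d0); apply: pihomogP.
Qed.

Lemma socle_mul (J : R -> Prop) f p : is_ideal J -> (forall i, J ('X_i * f)) ->
  J (p * f - p@_0 *: f).
Proof.
move=> JI Jf; rewrite -mul_mpolyC -mulrBl.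
apply: (vars_sub (ideal_colon f JI)) => //.
by rewrite mcoeffB mcoeffC eqxx mulr1 subrr.
Qed.

(** After localization at the irrelevant maximal ideal, [socle_generator] gives a fraction a/s as
    coefficient. A polynomial acts on a socle element through its constant coefficient, so the
    fraction becomes the scalar a(0)/s(0). *)
Lemma gorenstein_socle Z h N f g : arithmetically_gorenstein Z ->
  (forall p, vanishing_ideal Z (p * h) -> vanishing_ideal Z p) ->
  (forall m : 'X_{1..n.+1}, mdeg m = N -> adjoin (vanishing_ideal Z) h 'X_[m]) ->
  (forall i, adjoin (vanishing_ideal Z) h ('X_i * f)) ->
  (forall i, adjoin (vanishing_ideal Z) h ('X_i * g)) ->
  ~ adjoin (vanishing_ideal Z) h f ->
  exists c, adjoin (vanishing_ideal Z) h (g - c *: f).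
Proof.
set J := vanishing_ideal Z; move=> [_ Zgor] nzd HN Hf Hg nHf.
have JI : is_ideal J := vanishing_is_ideal Z; have HI := ideal_adjoin h JI.
have [q [qsurj qker]] := coordinate_ring_surjection Z.
pose M (b : coordinate_ring Z) := exists2 p, q p = b & p@_0 = 0.
have MI : is_ideal M.
  split; first by exists 0; rewrite ?rmorph0 ?mcoeff0.
    move=> _ _ [a <- a0] [b <- b0]; exists (a + b); rewrite ?rmorphD //.
    by rewrite /= a0 b0 addr0.
  move=> a' _ [b <- b0]; have [a <-] := qsurj a'; exists (a * b); rewrite ?rmorphM //.
  by rewrite /= b0 mulr0.
have M1 : ~ M 1.
  move=> [p]; rewrite -(rmorph1 q) => /eqP; rewrite -subr_eq0 -rmorphB => /eqP/qker Jp p0.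
  have := vanishing_homog 0%N Jp; rewrite hc0 mcoeffB p0 mcoeff1 eqxx sub0r.
  by rewrite mpolyCN => /(idealN JI); rewrite opprK; apply: vanishing_proper.
have [P PE] := exists_idealr MI M1.
have Pmax : maximal_ideal P.
  move=> I PI b Ib; apply/PE; have [p pb] := qsurj b; exists p => //.
  apply/eqP/negPn/negP => p0; apply: (idealr_proper (I := I)).
  have Ip0 : q (p@_0)%:MP \in I.
    rewrite -(subKr p (p@_0)%:MP) rmorphB; apply: rpredB; first by rewrite pb.
    apply/PI/PE; exists (p - (p@_0)%:MP) => //.
    by rewrite mcoeffB mcoeffC eqxx mulr1 subrr.
  have := idealMr (q ((p@_0)^-1)%:MP) Ip0.
  by rewrite -rmorphM -mpolyCM mulVf // mpolyC1 rmorph1.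
have [S [iota [[iunit ifrac iker] [E [eta [d [Einj etainj ex0 exS [m Em]]]]]]]] := Zgor P Pmax.
pose phi : {rmorphism R -> S} := (iota \o q)%FUN.
have qP s : (q s \notin P) <-> s@_0 != 0.
  split=> [|s0].
    by apply: contraNneq => s0; apply/PE; exists s.
  apply/negP => /PE[p ps p0]; case/negP: s0; apply/eqP.
  have /qker Jsp : q (p - s) = 0 by rewrite rmorphB ps subrr.
  have := vanishing_homog 0%N Jsp; rewrite hc0 mcoeffB p0 sub0r mpolyCN.
  move=> /(idealN JI); rewrite opprK => Js0.
  apply/eqP/negPn/negP => s0; apply: (@vanishing_proper _ _ Z).
  have := idealM JI ((s@_0)^-1)%:MP Js0.
  by rewrite -mpolyCM mulVf // mpolyC1.
have phi_unit s : s@_0 != 0 -> exists w, w * phi s = 1.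
  by move=> /qP/iunit[w wE]; exists w; rewrite mulrC.
have phi_frac b : exists s a, s@_0 != 0 /\ phi s * b = phi a.
  have [a' [s' [sP E']]] := ifrac b.
  have [s sE] := qsurj s'; have [a aE] := qsurj a'; exists s, a.
  by rewrite /= sE aE; split=> //; apply/qP; rewrite sE.
have phi_ker a : phi a = 0 <-> exists2 s, s@_0 != 0 & J (s * a).
  split=> [/iker[s' sP]|[s s0 Jsa]].
    have [s sE] := qsurj s'; rewrite -sE -rmorphM => /qker Jsa.
    by exists s => //; apply/qP; rewrite sE.
  by apply/iker; exists (q s); [apply/qP | rewrite -rmorphM; apply/qker].
have cancel_unit s z : s@_0 != 0 -> phi s * z = 0 -> z = 0.
  by move=> /phi_unit[w wE] sz; rewrite -[z]mul1r -wE -mulrA sz mulr0.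
have prin p : adjoin J h p -> principal (phi h) (phi p).
  move=> [b /qker qb [y ->]]; apply/principalP; exists (phi y).
  by rewrite rmorphD rmorphM /= qb rmorph0 add0r.
have prinV p : principal (phi h) (phi p) -> exists2 s, s@_0 != 0 & adjoin J h (s * p).
  move=> /principalP[y yE]; have [s [a [s0 saE]]] := phi_frac y.
  have /phi_ker[s' s'0 Js'] : phi (s * p - a * h) = 0.
    by rewrite rmorphB !rmorphM yE mulrA saE subrr.
  exists (s' * s); first by rewrite rmorphM mulf_neq0.
  exists (s' * (s * p - a * h)) => //; exists (s' * a); ring.
have scaleV s p : s != 0 -> adjoin J h (s *: p) -> adjoin J h p.
  by move=> s0 Hp; rewrite -(scalerK s0 p); apply: idealZ.
pose gens := [seq phi 'X_i | i <- enum 'I_n.+1].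
have gensX i : generated_by gens (phi 'X_i).
  by apply/generated_by_mem/map_f; rewrite mem_enum.
have [] := @socle_generator S E eta d m Einj etainj ex0 exS Em (phi h) gens (phi f) (phi g) N.
- move=> z zh; have [s [a [s0 saE]]] := phi_frac z.
  apply: (cancel_unit s) => //; rewrite saE; apply/phi_ker.
  have /phi_ker[s' s'0 Js'] : phi (a * h) = 0.
    by rewrite rmorphM -saE -mulrA zh mulr0.
  by exists s' => //; apply: nzd; rewrite -mulrA.
- move=> z nz; have [s [a [s0 saE]]] := phi_frac z; have [w wE] := phi_unit s s0.
  have [a0|/phi_unit[w' w'E]] := eqVneq a@_0 0; last first.
    by exists (w' * phi s); rewrite -mulrA saE.
  case: nz; rewrite -[z]mul1r -wE -mulrA saE.
  have gI := ideal_generated gens; apply: (idealM gI).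
  apply: (@vars_sub (fun p => generated_by gens (phi p))) => //.
  split=> [|x y|x y]; first by rewrite rmorph0; apply: ideal0.
    by rewrite rmorphD; apply: idealD.
  by rewrite rmorphM; apply: idealM.
- by move=> _ /mapP[i _ ->]; rewrite -rmorphM; apply: prin.
- by move=> _ /mapP[i _ ->]; rewrite -rmorphM; apply: prin.
- move=> /prinV[s s0 Hs]; apply: nHf; apply: (scaleV s@_0) => //.
  rewrite -(subKr (s * f) (s@_0 *: f)); apply: idealB => //.
  exact: socle_mul.
- suff H k p : p \in products gens k -> exists2 m' : 'X_{1..n.+1}, mdeg m' = k & p = phi 'X_[m'].
    by move=> p /H[m' /HN Hm ->]; apply: prin.
  elim: k p => [|k IH] p /=.
    by rewrite inE => /eqP->; exists 0%MM; [exact: mdeg0|rewrite mpolyX0 !rmorph1].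
  move=> /allpairsP[[x y] /= [/mapP[i _ ->] /IH[m' dm ->] ->]].
  exists (U_(i) + m')%MM; first by rewrite mdegD mdeg1 dm.
  by rewrite mpolyXD !rmorphM.
move=> c; have [s [a [s0 saE]]] := phi_frac c => Hc.
have /prinV[s' s'0 Hs'] : principal (phi h) (phi (s * g - a * f)).
  rewrite rmorphB !rmorphM -saE -mulrA -mulrBr.
  by apply: idealM => //; apply: ideal_adjoin; apply: zero_is_ideal.
exists (s'@_0 * a@_0 / (s'@_0 * s@_0)).
apply: (scaleV (s'@_0 * s@_0)); first by rewrite mulf_neq0.
rewrite scalerBr scalerA [_ * (_ / _)]mulrC divfK ?mulf_neq0 //.
have Hg' := socle_mul (s' * s) HI Hg; have Hf' := socle_mul (s' * a) HI Hf.
have -> : (s'@_0 * s@_0) *: g - (s'@_0 * a@_0) *: f =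
   s' * (s * g - a * f) - (s' * s * g - (s' * s)@_0 *: g)
   + (s' * a * f - (s' * a)@_0 *: f).
  by rewrite !rmorphM /=; ring.
by apply: idealD => //; apply: idealB.
Qed.

End GorensteinSocle.

(** * Growth of filtered dimensions along chains of ideals *)

Section Growth.
Variables (K : fieldType) (n : nat).
Local Notation R := {mpoly K[n]}.
Local Notation hc d p := (pihomog mdeg d p).
Implicit Types (I J P Q : R -> Prop) (f g a b p q u : R).

Lemma independent_mono (U V J : R -> Prop) k : (forall x, U x -> V x) ->
  independent U J k -> independent V J k.
Proof. by move=> UV [s [sz sU ind]]; exists s; split=> // x /sU/UV. Qed.

Lemma lepart_leq t t' f : (t <= t')%N -> lepart t f -> lepart t' f.
Proof. by move=> le /leq_trans; apply; rewrite ltnS. Qed.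

(* Each step of the chain contributes one order of growth. *)
Lemma independent_chain e (J : nat -> R -> Prop) (a : nat -> R) :
  (forall i, (i <= e)%N -> is_ideal (J i)) ->
  (forall i, (i < e)%N -> ideal_le (J i) (J i.+1)) ->
  (forall i, (i < e)%N -> J i.+1 (a i)) ->
  (forall i, (i < e)%N -> forall g, J i (g * a i) -> J i g) ->
  ~ J e 1 ->
  exists dl, forall m, independent (lepart (m * dl)) (J 0%N) 'C(m + e, e).
Proof.
have one t : lepart t (1 : R) by rewrite /lepart msize1.
elim: e J a => [|e IH] J a JI Jle Ja Jnzd J1.
  by exists 0%N => m; rewrite bin0; apply: (independent1 (f := 1)) => //; apply: JI.
have [||||//|dl' ind'] := IH (fun i => J i.+1) (fun i => a i.+1).
- by move=> i le_i; apply: JI.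
- by move=> i lt_i; apply: Jle.
- by move=> i lt_i; apply: Ja.
- by move=> i lt_i; apply: Jnzd.
(* Multiplication by [a 0] must not leave the next degree window, so [dl] also exceeds the degree of
   [a 0]; the count then follows Pascal's rule. *)
have I0 := JI 0%N isT; pose dl := maxn dl' (msize (a 0%N)).+1; exists dl; elim=> [|m IHm].
  rewrite add0n binn; apply: (independent1 (f := 1)) => // J01; apply: J1.
  suff H k : (k <= e.+1)%N -> J k 1 by apply: H.
  by elim: k => // k IHk lt_k; apply: Jle => //; apply/IHk/ltnW.
rewrite addnS in IHm; rewrite addSn addnS binS [X in independent _ _ X]addnC.
apply: (independent_add I0 (JI 1%N isT) (Jle 0%N isT) (Ja 0%N isT) _ _ _ IHm).
- by move=> c s _; apply: Jnzd.
- move=> g; rewrite /lepart => hg; apply: leq_trans (msizeM_le _ _) _.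
  rewrite mulSn; have : ((msize (a 0%N)).+1 <= dl)%N by apply: leq_maxr.
  by move: hg; lia.
rewrite -addSn; apply: independent_mono (ind' m.+1) => x; apply: lepart_leq.
by rewrite leq_mul2l leq_maxl orbT.
Qed.

Lemma spanned_lepart J B t : is_ideal J ->
  (forall d, spanned (hpart d) J (B * d.+1)) ->
  spanned (lepart t) J (B * t.+1 ^ 2).
Proof.
move=> JI sp.
have H T : (T <= t.+1)%N -> exists s, [/\ (size s <= T * (B * t.+1))%N,
    {in s, forall x, lepart t x}
    & forall u, exists c, J ((\sum_(d < T) hc d u) - lin c s)].
  elim: T => [_|T IH lt_T].
    exists [::]; split=> // u; exists (fun=> 0).
    by rewrite /lin !big_ord0 subr0; apply: ideal0.
  have [s [sz sU sc]] := IH (ltnW lt_T); have [s' [sz' sU' sc']] := sp T.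
  exists (s ++ s'); split.
  - rewrite size_cat mulSn addnC leq_add //; apply: leq_trans sz' _.
    by rewrite leq_mul2l lt_T orbT.
  - move=> x; rewrite mem_cat => /orP[/sU//|/sU' hx].
    rewrite /lepart msizeE; apply/bigmax_leqP_seq => m mx _.
    by apply: leq_trans lt_T; rewrite (dhomog_mf hx mx).
  move=> u; have [c uc] := sc u; have [c' uc'] := sc' (hc T u) (pihomogP _ _ _).
  exists (fun i => if (i < size s)%N then c i else c' (i - size s)%N).
  rewrite -lin_cat_split big_ord_recr /=.
  have -> : \sum_(i < T) hc i u + hc T u - (lin c s + lin c' s') =
    (\sum_(i < T) hc i u - lin c s) + (hc T u - lin c' s') by ring.
  exact: idealD uc uc'.
have [s [sz sU sc]] := H t.+1 (leqnn _); exists s; split=> //.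
  by apply: leq_trans sz _; rewrite mulnCA expnS expn1.
move=> u hu; have [c uc] := sc u; exists c.
by rewrite {1}[u](@pihomog_partitionE _ _ mdeg t.+1).
Qed.

(** For m - 1 = 6 B (dl + 1)^2 one has 6 B (m dl + 1)^2 <= m^2 (m - 1) < (m + 3)(m + 2)(m + 1). *)
Lemma cubic_growth B dl : exists m, (B * (m * dl).+1 ^ 2 < 'C(m + 3, 3))%N.
Proof.
pose m := (6 * B * dl.+1 ^ 2).+1; exists m.
rewrite -(ltn_pmul2r (isT : 0 < 3`!)%N) bin_ffact.
have -> : ((m + 3) ^_ 3 = (m + 3) * ((m + 2) * (m + 1)))%N.
  by rewrite !ffactnS ffactn0 muln1; congr (_ * (_ * _))%N; lia.
apply: (@leq_ltn_trans (m * (m * (m.-1)))%N).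
  have le1 : ((m * dl).+1 <= m * dl.+1)%N by rewrite mulnS; lia.
  rewrite (_ : m.-1 = 6 * B * dl.+1 ^ 2)%N // (_ : 3`! = 6)%N //.
  apply: (@leq_trans (B * (m * dl.+1) ^ 2 * 6)%N).
    by rewrite leq_mul2r /= leq_mul2l leq_exp2r // le1 orbT.
  by rewrite expnMn; lia.
by apply: ltn_mul; [lia | apply: ltn_mul; lia].
Qed.

End Growth.

(** * Division up to homogeneous factors *)

Section PseudoDivision.
Variables (K : fieldType) (n : nat).
Local Notation R := {mpoly K[n]}.
Local Notation hc d p := (pihomog mdeg d p).
Implicit Types (a b c p q s : R).
Variables (I P : R -> Prop).
Hypothesis I_prime : is_prime I.
Hypothesis P_ideal : is_ideal P.
Hypothesis P_not_le : ~ ideal_le P I.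

Let width lo w p := forall d, ~~ (lo <= d < lo + w)%N -> I (hc d p).

(* Modulo [I] and up to homogeneous factors, [P] behaves like an ideal of a ring
   of Laurent polynomials over a field; [q] is an element with the fewest
   homogeneous components. *)
Lemma principal_up_to_homog : exists2 q, P q & forall p, P p ->
  exists c s e, [/\ hpart e c, ~ I c & I (c * p - s * q)].
Proof.
have [II I1 IM] := I_prime.
have ex : exists w, `[< exists lo q, [/\ width lo w q, P q & ~ I q] >].
  have [q Pq nIq] : exists2 q, P q & ~ I q.
    by apply: contrapT => no; apply: P_not_le => q Pq; apply: contrapT => nq; apply: no; exists q.
  exists (msize q); apply/asboolP; exists 0%N, q; split=> // d.
  by rewrite add0n leq0n /= -leqNgt => /hc_ge->; apply: ideal0 II.
case: (ex_minnP ex) => w /asboolP[lo [q [qw Pq nIq]]] wmin; exists q => //.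
have w0 : (0 < w)%N.
  rewrite lt0n; apply/eqP => w0; apply: nIq; apply: homog_mem => // d.
  by apply: qw; rewrite w0; lia.
pose dc := (lo + w).-1; pose c' := hc dc q.
have nc' : ~ I c'.
  move=> Ic'; have : (w <= w.-1)%N; last by lia.
  apply: wmin; apply/asboolP; exists lo, q; split=> // d hd.
  by have [->//|/eqP ne] := eqVneq d dc; apply: qw; move: hd ne; rewrite /dc; lia.
suff H u : forall lp p, width lp u p -> P p ->
    exists c s e, [/\ hpart e c, ~ I c & I (c * p - s * q)].
  move=> p Pp; apply: (H (msize p) 0%N) => // d.
  by rewrite add0n leq0n /= -leqNgt => /hc_ge->; apply: ideal0 II.
elim: u => [|u IH] lp p pw Pp; have [Ip|nIp] := EM (I p).
- exists 1, 0, 0%N; split=> //; first exact: dhomog1.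
  by rewrite mul1r mul0r subr0.
- by case: nIp; apply: homog_mem => // d; apply: pw; lia.
- exists 1, 0, 0%N; split=> //; first exact: dhomog1.
  by rewrite mul1r mul0r subr0.
have le_w : (w <= u.+1)%N by apply: wmin; apply/asboolP; exists lp, p.
(* Cross-multiplication by the top components [c'] of q and [b] of p cancels the top degree.
   Minimality gives w <= u + 1, so b q does not reach below the window of c' p, whose width drops to
   u. *)
pose db := (lp + u)%N; pose b := hc db p.
have [||c [s [e [hc_c nIc Ic]]]] := IH (lp + dc)%N (c' * p - b * q).
- move=> d hd; rewrite linearB /= !(hc_mul _ _ (pihomogP _ _ _)).
  have [->|/eqP ne] := eqVneq d (db + dc)%N.
    rewrite leq_addl addnK leq_addr addKn -/b -/c' mulrC subrr.
    exact: ideal0.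
  apply: idealB => //; case: ifP => le; try exact: ideal0.
    apply: idealM => //; apply: pw; move: hd ne le le_w w0; rewrite /db /dc; lia.
  apply: idealM => //; apply: qw; move: hd ne le le_w w0; rewrite /db /dc; lia.
- by apply: idealB => //; apply: idealM.
exists (c * c'), (s + c * b), (e + dc)%N; split.
- by apply: dhomogM => //; apply: pihomogP.
- by case/IM.
- have -> : c * c' * p - (s + c * b) * q = c * (c' * p - b * q) - s * q by ring.
  by [].
Qed.

End PseudoDivision.

(** * A Cohen-Macaulay criterion for curves *)

Section CohenMacaulay.
Variables (K : fieldType) (n : nat).
Hypothesis Kinf : infinite_type K.
Local Notation R := {mpoly K[n.+1]}.
Local Notation hc d p := (pihomog mdeg d p).
Implicit Types (I J P Q : R -> Prop) (C X : closed_subscheme K n).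

Lemma power_socle J f N : (forall g, (forall i, J ('X_i * g)) -> J g) ->
  (forall m : 'X_{1..n.+1}, mdeg m = N -> J ('X_[m] * f)) -> J f.
Proof.
move=> Jsoc; elim: N f => [|N IH] f HN.
  by have := HN 0%MM mdeg0; rewrite mpolyX0 mul1r.
apply: Jsoc => i; apply: IH => m dm; rewrite mulrA -mpolyXD; apply: HN.
by rewrite mdegD mdeg1 dm addn1.
Qed.

Lemma homog_proper_const J p : is_ideal J -> homog_ideal J -> ~ J 1 -> J p -> p@_0 = 0.
Proof.
move=> JI Jh J1 Jp; apply/eqP/negPn/negP => p0; apply: J1.
have := idealM JI ((p@_0)^-1)%:MP (Jh _ 0%N Jp).
by rewrite hc0 -mpolyCM mulVf // mpolyC1.
Qed.

Section Criterion.
Variables (C : closed_subscheme K n) (i0 : 'I_n.+1).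
Hypothesis C_curve : integral_curve C.
Local Notation I := (vanishing_ideal C).
Local Notation x0 := ('X_i0 : R).
Hypothesis nIx0 : ~ I x0.
Hypothesis no_socle : forall f, (forall i, adjoin I x0 ('X_i * f)) -> adjoin I x0 f.

Let II : is_ideal I := vanishing_is_ideal C.
Let Ih : homog_ideal I := @vanishing_homog _ _ C.
Let Ipr : is_prime I := integral_prime (proj1 C_curve).
Let IM a b : I (a * b) -> I a \/ I b := let: And3 _ _ H := Ipr in H a b.

(** Modulo x_0 the Hilbert function is bounded, so that of R/I grows at most linearly, and its
    partial sums at most quadratically. *)
Lemma curve_spanned : exists B, forall t, spanned (lepart t) I (B * t.+1 ^ 2).
Proof.
have hx : hpart 1 x0 by apply: hpart_var.
have [B sp] := curve_bounded C_curve hx nIx0.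
exists B => t; apply: spanned_lepart => // d; elim: d => [|d IH].
  by rewrite muln1; apply: (spanned_adjoin_lt II Ih hx).
have Ic : ideal_le I (colon I x0) by move=> g Ig; apply: idealMl.
have sp1 := spanned_adjoin (t := d) II Ih hx (spanned_le Ic IH).
by rewrite addn1 in sp1; rewrite mulnSr; apply/sp1/sp.
Qed.

(** Three steps would give C(m + 3, 3) independent elements of degree at most m dl, more than
    quadratic growth allows. Both prime chains and regular sequences are chains of this kind. *)
Lemma chain_length_le2 e (J : nat -> R -> Prop) (a : nat -> R) :
  (forall i, (i <= e)%N -> is_ideal (J i)) -> ideal_le I (J 0%N) ->
  (forall i, (i < e)%N -> ideal_le (J i) (J i.+1)) ->
  (forall i, (i < e)%N -> J i.+1 (a i)) ->
  (forall i, (i < e)%N -> forall g, J i (g * a i) -> J i g) ->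
  ~ J e 1 -> (e <= 2)%N.
Proof.
move=> JI IJ Jle Ja Jnzd J1; rewrite leqNgt; apply/negP => e2.
have J31 : ~ J 3 1.
  move=> J31; apply: J1; suff H k : (3 + k <= e)%N -> J (3 + k)%N 1.
    by have := H (e - 3)%N; rewrite subnKC //; apply.
  elim: k => [|k IH] lt_k; first by rewrite addn0.
  by rewrite addnS; apply: Jle; [lia | apply: IH; lia].
have [||||//|dl ind] := @independent_chain K n.+1 3 J a.
- by move=> i le_i; apply: JI; lia.
- by move=> i le_i; apply: Jle; lia.
- by move=> i le_i; apply: Ja; lia.
- by move=> i le_i; apply: Jnzd; lia.
have [B sp] := curve_spanned; have [m lt] := cubic_growth B dl.
have := independent_leq (JI 0%N isT) (ind m) (spanned_le IJ (sp _)).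
by rewrite leqNgt lt.
Qed.

Variables (q : {rmorphism R -> coordinate_ring C}).
Hypothesis q_surj : forall b, exists p, q p = b.
Hypothesis q_ker : forall p, q p = 0 <-> I p.

Lemma generated_by_nil_image p : generated_by [::] (q p) <-> I p.
Proof. by rewrite generated_by0 q_ker. Qed.

Lemma generated_by_one_image a g : generated_by [:: q a] (q g) <-> adjoin I a g.
Proof.
rewrite (generated_by_rcons [::]); split=> [[c /generated_by0-> [y E]]|].
  have [y' yE] := q_surj y; exists (g - y' * a); last by exists y'; rewrite subrK.
  by apply/q_ker; rewrite rmorphB rmorphM yE E add0r subrr.
move=> [c /q_ker qc [y ->]]; exists 0; first exact/generated_by0.
by exists (q y); rewrite rmorphD rmorphM qc.
Qed.

Definition image (J : R -> Prop) (b : coordinate_ring C) : Prop :=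
  exists2 p, q p = b & J p.

Lemma imageP J p : is_ideal J -> ideal_le I J -> image J (q p) <-> J p.
Proof.
move=> JI IJ; split=> [[p' qp' Jp']|Jp]; last by exists p.
apply/(ideal_subP JI); last exact: Jp'.
by apply/IJ/q_ker; rewrite rmorphB qp' subrr.
Qed.

Lemma image_ideal J : is_ideal J -> is_ideal (image J).
Proof.
move=> JI; split; first by exists 0; [rewrite rmorph0|apply: ideal0].
  move=> _ _ [a <- Ja] [b <- Jb]; exists (a + b); [exact: rmorphD|exact: idealD].
move=> a' _ [b <- Jb]; have [a <-] := q_surj a'.
by exists (a * b); [exact: rmorphM|exact: idealM].
Qed.

Lemma preimage_ideal (J : coordinate_ring C -> Prop) :
  is_ideal J -> is_ideal (fun p => J (q p)).
Proof.
move=> JI; split=> [|a b|a b]; rewrite ?rmorph0 ?rmorphD ?rmorphM.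
- exact: ideal0.
- exact: idealD.
- exact: idealM.
Qed.

Lemma preimage_le (J : coordinate_ring C -> Prop) :
  is_ideal J -> ideal_le I (fun p => J (q p)).
Proof. by move=> JI p /q_ker->; apply: ideal0. Qed.

Lemma coordinate_ring_noetherian : noetherian (coordinate_ring C).
Proof.
move=> J; have JI := idealr_is_ideal J.
have [s sJ] := @hilbert_basis K n.+1 _ (preimage_ideal JI).
exists (map q s) => b; have [p <-] := q_surj b; split=> [/sJ[c ->]|].
  exists (q \o c)%FUN; rewrite size_map rmorph_sum; apply: eq_bigr => i _.
  by rewrite rmorphM (nth_map 0).
apply: (generated_by_min JI) => _ /mapP[x sx ->].
by apply/sJ/generated_by_mem.
Qed.

Section MaximalIdeal.
Variable P : idealr (coordinate_ring C).
Hypothesis P_max : maximal_ideal P.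
Let P' : R -> Prop := fun p => q p \in P.

Let P'I : is_ideal P' := preimage_ideal (idealr_is_ideal P).
Let P'1 : ~ P' 1.
Proof. by rewrite /P' rmorph1; apply: idealr_proper. Qed.
Let IP' : ideal_le I P' := preimage_le (idealr_is_ideal P).

Lemma preimage_maximal J : is_ideal J -> ~ J 1 -> ideal_le P' J -> ideal_le J P'.
Proof.
move=> JI J1 PJ p Jp.
have IJ : ideal_le I J by move=> a /IP'/PJ.
have M1 : ~ image J 1 by rewrite -(rmorph1 q) => /(imageP _ JI IJ).
have [N NE] := exists_idealr (image_ideal JI) M1.
apply: (P_max (J := N)); last by apply/NE; exists p.
move=> b Pb; apply/NE; have [a ab] := q_surj b; exists a => //.
by apply: PJ; rewrite /P' ab.
Qed.

Lemma preimage_prime : is_prime P'.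
Proof.
split=> // a b P'ab; have [P'a|nP'a] := EM (P' a); first by left.
right; have [[c P'c [y E]]|n1] := EM (adjoin P' a 1); last first.
  case: nP'a; apply: preimage_maximal n1 _ _ (adjoin_gen _ P'I).
    exact: ideal_adjoin.
  exact: adjoin_le.
rewrite -[b]mul1r E mulrDl -mulrA.
exact: (idealD P'I (idealMl _ P'I P'c) (idealM P'I _ P'ab)).
Qed.

Lemma prime_lift (Q : R -> Prop) : is_prime Q -> ideal_le I Q ->
  exists QC : prime_idealr (coordinate_ring C), forall p, q p \in QC <-> Q p.
Proof.
move=> [QI Q1 QM] IQ; have QE p := imageP p QI IQ.
have imQ : is_prime (image Q).
  split; [exact: image_ideal|by rewrite -(rmorph1 q) => /QE|move=> a b].
  have [a' <-] := q_surj a; have [b' <-] := q_surj b.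
  by rewrite -rmorphM => /QE/QM[] /QE; [left|right].
by have [QC QCE] := exists_prime_idealr imQ; exists QC => p; rewrite -QE QCE.
Qed.

Lemma height_upper e c : prime_chain c e -> c e =i P -> (e <= 2)%N.
Proof.
move=> cc ce.
have /choice [a aP] : forall i, exists a, (i < e)%N -> q a \in c i.+1 /\ ~ q a \in c i.
  move=> i; have [lt_i|le_i] := ltnP i e; last by exists 0.
  have [_ nle] := cc i lt_i; apply: contrapT => no; apply: nle => b cb.
  have [p pb] := q_surj b; rewrite -pb; apply: contrapT => np; apply: no.
  by exists p => _; rewrite pb in np *.
apply: (@chain_length_le2 e (fun i p => q p \in c i) a).
- by move=> i _; apply: (preimage_ideal (idealr_is_ideal (c i))).
- exact: (preimage_le (idealr_is_ideal (c 0%N))).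
- by move=> i /cc[le _] p; apply: le.
- by move=> i /aP[].
- move=> i /aP[_ na] g; rewrite rmorphM prime_idealrM => /orP[//|].
  by move/na.
- by rewrite rmorph1; apply: idealr_proper.
Qed.

Lemma depth_upper (s : seq (coordinate_ring C)) : regular_sequence s -> (size s <= 2)%N.
Proof.
move=> [s1 sreg]; have /choice [t tP] : forall i, exists p, q p = s`_i by move=> i.
apply: (@chain_length_le2 _ (fun i p => generated_by (take i s) (q p)) t).
- by move=> i _; apply: (preimage_ideal (ideal_generated _)).
- exact: (preimage_le (ideal_generated _)).
- move=> i lt_i p; rewrite (take_nth 0 lt_i) => g; apply/generated_by_rcons.
  exact: adjoin_le.
- move=> i lt_i; rewrite (take_nth 0 lt_i) tP; apply/generated_by_rcons.
  exact/adjoin_gen/ideal_generated.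
- by move=> i lt_i g; rewrite rmorphM tP mulrC; apply: sreg.
- by rewrite take_size rmorph1.
Qed.

Lemma regular_sequence2 a b : ~ I a -> P' a -> P' b ->
  (forall g, adjoin I a (b * g) -> adjoin I a g) ->
  exists s : seq (coordinate_ring C), [/\ regular_sequence s, {subset s <= P} & size s = 2].
Proof.
move=> nIa P'a P'b ab; exists [:: q a; q b].
have sP : {subset [:: q a; q b] <= P}.
  by move=> x; rewrite !inE => /orP[/eqP->|/eqP->].
split=> //; split.
  move/(generated_by_min (idealr_is_ideal P) sP); exact: idealr_proper.
case=> [_ y|[_ y|//]] /=; have [g <-] := q_surj y; rewrite -rmorphM.
  by rewrite !generated_by_nil_image => /IM[/nIa|].
by rewrite !generated_by_one_image; apply: ab.
Qed.

Lemma height_chain2 J Q : is_prime J -> is_prime Q -> ideal_le I J -> ideal_le J Q ->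
  ~ ideal_le Q J -> ideal_le Q P' -> ~ ideal_le P' Q ->
  exists2 c : nat -> prime_idealr (coordinate_ring C), prime_chain c 2 & c 2 =i P.
Proof.
move=> Jpr Qpr IJ JQ nQJ QP nPQ.
have [JC JE] := prime_lift Jpr IJ.
have [QC QE] := prime_lift Qpr (fun a Ia => JQ a (IJ a Ia)).
have [PC PE] := prime_lift preimage_prime IP'.
exists (fun i => match i with 0 => JC | 1 => QC | _ => PC end).
  case=> [|[|//]] _ /=; split.
  - by move=> b; have [p <-] := q_surj b => /JE/JQ/QE.
  - by move=> le; apply: nQJ => p /QE/le/JE.
  - by move=> b; have [p <-] := q_surj b => /QE/QP/PE.
  - by move=> le; apply: nPQ => p /PE/le/QE.
by move=> b; have [p <-] := q_surj b; apply/idP/idP => /PE.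
Qed.

Lemma vars_preimage J : (forall i, P' 'X_i) -> is_ideal J -> homog_ideal J -> ~ J 1 ->
  ideal_le J P'.
Proof.
move=> P'X JI Jh J1 p Jp; apply: vars_sub => //.
exact: homog_proper_const Jp.
Qed.

(** A proper homogeneous ideal lies in the irrelevant ideal; maximality gives equality. *)
Lemma homog_preimage_vars : homog_ideal P' -> forall i, P' 'X_i.
Proof.
move=> P'h i; pose M (p : R) := p@_0 = 0.
have MI : is_ideal M.
  rewrite /M; split=> [|a b a0 b0|a b b0]; first exact: mcoeff0.
    by rewrite mcoeffD a0 b0 addr0.
  by rewrite rmorphM /= b0 mulr0.
apply: (preimage_maximal MI).
- by rewrite /M mcoeff1 eqxx => /eqP; rewrite oner_eq0.
- by move=> p; apply: homog_proper_const.
- by rewrite /M mcoeffX mnm1_eq0.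
Qed.

(** Both numbers are 2. If P' is irrelevant, [b] avoids the relevant primes of I + (x_0) and is
    regular modulo it by absence of socle; the prime chain comes from dim C = 1. Otherwise P' is not
    homogeneous, so it lies in no prime of a filtration of I + (a), and the chain passes through the
    ideal generated by the forms of P'. *)
Lemma depth_height2 d a : hpart d a -> P' a -> ~ I a ->
  exists2 e, has_depth P e & has_height P e.
Proof.
move=> ha P'a nIa.
suff [lower chain] : (exists s : seq (coordinate_ring C), [/\ regular_sequence s, {subset s <= P} & size s = 2]) /\
    exists2 c : nat -> prime_idealr (coordinate_ring C), prime_chain c 2 & c 2 =i P.
  exists 2; split=> //; first by move=> e [s [/depth_upper sle _ <-]].
  by move=> e [c]; apply: height_upper.
have P'D : forall c f g, P' f -> P' g -> P' (f + c *: g).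
  by move=> c f g Pf Pg; apply: idealD => //; apply: idealZ.
have [P'X|/existsNP[j nP'j]] := EM (forall i, P' 'X_i).
  split.
    have hx : hpart 1 x0 by apply: hpart_var.
    have xI := ideal_adjoin x0 II.
    have [Ps fP] := filtration_exists xI (homog_adjoin II Ih hx).
    have [P0 PP|b P'b bP] := filtration_avoid Kinf (G := fun Q => ~ forall i, Q 'X_i)
      xI fP (ideal0 P'I) P'D.
      by move=> /existsNP[i ni]; exists 'X_i.
    apply: (regular_sequence2 (a := x0) (b := b)) => // g xbg.
    have [N HN] := filtration_power xI fP bP xbg.
    exact: (power_socle no_socle HN).
  have [c [cP cc]] := dimension_witness (proj2 C_curve).
  have [[p0 h0 _] le0] := cP 0%N isT; have [[p1 h1 [i ni]] le1] := cP 1%N isT.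
  have [le nle] := cc 0%N isT; have [I1 n1 _] := p1.
  apply: (height_chain2 p0 p1) => //; first exact: vars_preimage.
  by move=> PJ; apply: ni; apply: PJ.
have nP'h : ~ homog_ideal P' by move=> /homog_preimage_vars/(_ j).
split.
  have aI := ideal_adjoin a II.
  have [Ps fP] := filtration_exists aI (homog_adjoin II Ih ha).
  have [Q /(filtration_le aI fP)[[QI Q1 _] Qh _] _|b P'b bP] :=
    filtration_avoid Kinf (G := fun=> True) aI fP (ideal0 P'I) P'D.
    apply: contrapT => no; apply: nP'h.
    have PQ : ideal_le P' Q.
      by move=> f Pf; apply: contrapT => nQf; apply: no; exists f.
    by move=> f e /PQ Qf; apply: (preimage_maximal QI Q1 PQ); apply: Qh.
  apply: (regular_sequence2 (a := a) (b := b)) => // g.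
  by apply: (filtration_nzd aI fP) => Q QPs; apply: bP.
pose Q f := forall d, P' (hc d f).
have QP : ideal_le Q P' by move=> f Qf; apply: homog_mem.
have QI : is_ideal Q.
  split=> [e|f g Qf Qg e|f g Qg e]; first by rewrite linear0; apply: ideal0.
    by rewrite linearD /=; apply: idealD.
  rewrite (hc_sum f) mulr_suml raddf_sum /=; apply: ideal_sum => // i _.
  rewrite (hc_mul _ _ (pihomogP _ _ _)); case: ifP => _; last exact: ideal0.
  exact: idealM.
have Qhom e f : hpart e f -> P' f -> Q f.
  move=> hf Pf e'; rewrite (hcE _ hf); case: ifP => // _; exact: ideal0 P'I.
apply: (height_chain2 Ipr (Q := Q)) => //.
- apply: homog_prime => //.
  + by move=> f e Qf e'; rewrite (hcE _ (pihomogP _ _ _)); case: ifP => _ //; apply: ideal0 P'I.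
  + by move/QP.
  + have [_ _ PM] := preimage_prime.
    move=> e e' f g hf hg /QP/PM[Pf|Pg]; [left; exact: Qhom hf Pf|right; exact: Qhom hg Pg].
- by move=> f If e; apply/IP'/Ih.
- by move=> QI'; apply: nIa; apply: QI'; apply: (Qhom _ _ ha).
- by move=> PQ; apply: nP'h => f e /PQ.
Qed.

(** Both numbers are 1: up to forms outside I, which are then outside P' as well, P' is generated
    modulo I by a single element r. *)
Lemma depth_height1 : (forall d a, hpart d a -> P' a -> I a) ->
  exists2 e, has_depth P e & has_height P e.
Proof.
move=> P'hom; have [_ I1 _] := Ipr.
have nPI : ~ ideal_le P' I.
  move=> PI; apply: nIx0; apply: (PI); apply: homog_preimage_vars => f d Pf.
  by apply/IP'/Ih/PI.
have [r P'r rP] := principal_up_to_homog Ipr P'I nPI.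
have nIhom e c : hpart e c -> ~ I c -> ~ P' c by move=> hc_c nIc /(P'hom _ _ hc_c).
exists 1%N; split.
- have [b P'b nIb] : exists2 b, P' b & ~ I b.
    apply: contrapT => no; apply: nPI => b Pb; apply: contrapT => nb; apply: no.
    by exists b.
  exists [:: q b]; split=> //; last by move=> x; rewrite inE => /eqP->.
  split.
    have sP : {subset [:: q b] <= P} by move=> x; rewrite inE => /eqP->.
    move/(generated_by_min (idealr_is_ideal P) sP); exact: idealr_proper.
  case=> [_ y|//] /=; have [g <-] := q_surj y; rewrite -rmorphM.
  by rewrite !generated_by_nil_image => /IM[/nIb|].
(* Two regular elements a1, a2 are multiples of r up to forms c1, c2. Regularity of a2 modulo a1
   gives c2 s1' = y a1, hence c1 c2 = y r modulo I: a form in P' outside I. *)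
- move=> e [s [[s1 sreg] sP <-]]; rewrite leqNgt; apply/negP.
  case: s s1 sreg sP => [//|y1 [//|y2 s]] s1 sreg sP _.
  have [a1 E1] := q_surj y1; have [a2 E2] := q_surj y2.
  have P'a1 : P' a1 by rewrite /P' E1; apply: sP; rewrite mem_head.
  have P'a2 : P' a2 by rewrite /P' E2; apply: sP; rewrite !inE eqxx orbT.
  have nIa1 : ~ I a1.
    move=> /q_ker a10; apply: s1; have := sreg 0%N isT 1.
    rewrite /= mulr1 -E1 a10 => /(_ (ideal0 (ideal_generated _))) /generated_by0 /eqP.
    by rewrite oner_eq0.
  have [c1 [s1' [e1 [h1 nc1 I1']]]] := rP a1 P'a1.
  have [c2 [s2' [e2 [h2 nc2 I2']]]] := rP a2 P'a2.
  have [z Iz [y Ey]] : adjoin I a1 (c2 * s1').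
    apply/generated_by_one_image; have := sreg 1%N isT (q (c2 * s1')).
    rewrite /= -E1 -E2 -rmorphM; apply; apply/generated_by_one_image.
    exists (s1' * (c2 * a2 - s2' * r) - s2' * (c1 * a1 - s1' * r)).
      by apply: idealB => //; apply: idealM.
    by exists (s2' * c1); ring.
  have : I (a1 * (c1 * c2 - y * r)).
    have Ez : z = c2 * s1' - y * a1 by rewrite Ey addrK.
    have -> : a1 * (c1 * c2 - y * r) = c2 * (c1 * a1 - s1' * r) + z * r.
      by rewrite Ez; ring.
    by apply: idealD => //; [apply: idealM|apply: idealMl].
  case/IM => // Icc; apply: (nIhom (e1 + e2)%N (c1 * c2)); first exact: dhomogM.
    by case/IM.
  rewrite -(subrK (y * r) (c1 * c2)); apply: idealD => //; first exact: IP'.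
  exact: idealM.
- have [IC IE] := prime_lift Ipr (fun a Ia => Ia).
  have [PC PE] := prime_lift preimage_prime IP'.
  exists (fun i => if i is 0 then IC else PC).
    case=> [_|//] /=; split.
      by move=> b; have [p <-] := q_surj b => /IE/IP'/PE.
    by move=> le; apply: nPI => p /PE/le/IE.
  by move=> b; have [p <-] := q_surj b; apply/idP/idP => /PE.
(* An intermediate prime Q has its own generator t, with c0 t = s r. If r is in Q, then P' is
   contained in Q. If s is in Q, it is a multiple of t up to a form c1, and cancelling t puts the
   form c1 c0 in P'. *)
move=> e [c cc ce]; rewrite leqNgt; apply/negP => e1.
pose Q p := q p \in c e.-1.
have Qpr : is_prime (fun b => b \in c e.-1) := prime_idealr_is_prime _.
have [QI0 Q10 QM0] := Qpr.
have QI : is_ideal Q := preimage_ideal QI0.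
have QM x y : Q (x * y) -> Q x \/ Q y by rewrite /Q rmorphM => /QM0.
have IQ : ideal_le I Q := preimage_le QI0.
have [|QP nPQ] := cc e.-1; first by lia.
rewrite prednK in QP nPQ; last by lia.
have QP' : ideal_le Q P' by move=> x Qx; rewrite /P' -ce; apply: QP.
have nP'Q : ~ ideal_le P' Q.
  by move=> le; apply: nPQ => b; have [p <-] := q_surj b; rewrite ce => /le.
have [|QQ nQQ] := cc e.-2; first by lia.
have e2E : e.-2.+1 = e.-1 by lia.
rewrite e2E in QQ nQQ.
have nQI : ~ ideal_le Q I.
  move=> le; apply: nQQ => b; have [p <-] := q_surj b => /le/q_ker->; exact: rpred0.
have Qhom d a : hpart d a -> Q a -> I a by move=> ha /QP'; apply: P'hom ha.
have [t Qt tP] := principal_up_to_homog Ipr QI nQI.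
have [t' Qt' nIt'] : exists2 t', Q t' & ~ I t'.
  apply: contrapT => no; apply: nQI => b Pb; apply: contrapT => nb; apply: no.
  by exists b.
have [nt|nIt] := EM (I t).
  have [c1 [s1 [e1' [h1 nc1 I1']]]] := tP t' Qt'; case: nIt'.
  case: (@IM c1 t') => //; rewrite -(subrK (s1 * t) (c1 * t')).
  by apply: idealD => //; apply: idealM.
have [c0 [s [e0 [h0 nc0 I0']]]] := rP t (QP' _ Qt).
have : Q (s * r).
  rewrite -(subKr (c0 * t) (s * r)).
  exact: (idealB QI (idealM QI _ Qt) (IQ _ I0')).
case/QM => [Qs|Qr]; last first.
  apply: nP'Q => p /rP[c1 [s1 [e1' [h1 nc1 I1']]]].
  have : Q (c1 * p).
    rewrite -(subrK (s1 * r) (c1 * p)).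
    exact: (idealD QI (IQ _ I1') (idealM QI _ Qr)).
  by case/QM => // /(Qhom _ _ h1).
have [c1 [s1 [e1' [h1 nc1 I1']]]] := tP s Qs.
have : I (t * (c1 * c0 - s1 * r)).
  have -> : t * (c1 * c0 - s1 * r) = c1 * (c0 * t - s * r) + (c1 * s - s1 * t) * r.
    by ring.
  by apply: idealD => //; [apply: idealM|apply: idealMl].
case/IM => // Icc; apply: (nIhom (e1' + e0)%N (c1 * c0)); first exact: dhomogM.
  by case/IM.
rewrite -(subrK (s1 * r) (c1 * c0)); apply: idealD => //; first exact: IP'.
exact: idealM.
Qed.

Lemma depth_height : exists2 e, has_depth P e & has_height P e.
Proof.
have [[d [a [ha P'a nIa]]]|no] := EM (exists d a, [/\ hpart d a, P' a & ~ I a]).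
  exact: depth_height2 ha P'a nIa.
apply: depth_height1 => d a ha P'a; apply: contrapT => nIa; apply: no.
by exists d, a.
Qed.

End MaximalIdeal.
End Criterion.

(** Applied in contrapositive form, as the source of the socle element of a curve that is not
    ACM. *)
Theorem ACM_no_socle (C : closed_subscheme K n) i0 : integral_curve C ->
  ~ vanishing_ideal C 'X_i0 ->
  (forall f, (forall i, adjoin (vanishing_ideal C) 'X_i0 ('X_i * f)) ->
    adjoin (vanishing_ideal C) 'X_i0 f) -> ACM C.
Proof.
move=> Cc nI soc; have [q [qsurj qker]] := coordinate_ring_surjection C.
split; first exact: coordinate_ring_noetherian qsurj.
by move=> P Pmax; apply: (depth_height Cc nI soc qsurj qker Pmax).
Qed.

End CohenMacaulay.

(** * Flags of linear forms *)

Section Flags.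
Variables (K : fieldType) (n : nat).
Local Notation R := {mpoly K[n]}.
Local Notation hc d p := (pihomog mdeg d p).
Implicit Types (f g h p q : R) (l : nat -> R).

Lemma linear_formE h : hpart 1 h -> h = \sum_i h@_U_(i) *: 'X_i.
Proof.
move=> hh; apply/mpolyP => m; rewrite raddf_sum /=.
have [/existsP[i /eqP->]|nm] := boolP [exists i : 'I_n, m == U_(i)%MM].
  rewrite (bigD1 i) //= mcoeffZ mcoeffX eqxx mulr1 big1 ?addr0 // => j ne.
  rewrite mcoeffZ mcoeffX; case: eqP => [/(congr1 (fun m : 'X_{1..n} => m j))|_].
    by rewrite !mnm1E eqxx eq_sym (negPf ne).
  by rewrite mulr0.
rewrite big1 => [|i _].
  by apply: dhomog_nemf_coeff hh _; rewrite -[_ != _]/(mdeg m != 1%N) mdeg_eq1.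
rewrite mcoeffZ mcoeffX; case: eqP => [E|_]; last by rewrite mulr0.
by case/existsP: nm; exists i; rewrite E.
Qed.

Lemma hpart_ideal (J : R -> Prop) f h : is_ideal J -> (forall i, J ('X_i * f)) ->
  hpart 1 h -> J (h * f).
Proof. by move=> JI Jf; apply: (hpart_vars (ideal_colon f JI) Jf). Qed.

Lemma hpart_sum t (I : finType) (a : I -> K) (F : I -> R) :
  (forall i, hpart t (F i)) -> hpart t (\sum_i a i *: F i).
Proof. by move=> hF; apply: rpred_sum => i _; apply/rpredZ/hF. Qed.

Lemma ring_endomorphism_sub (th : {rmorphism R -> R}) m :
  (forall c, th c%:MP = c%:MP) -> (forall i, exists y, 'X_i - th 'X_i = y * m) ->
  forall p, exists y, p - th p = y * m.
Proof.
move=> thC thX.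
have thM p q : (exists y, p - th p = y * m) -> (exists y, q - th q = y * m) ->
    exists y, p * q - th (p * q) = y * m.
  move=> [y Ey] [z Ez]; exists (p * z + y * th q).
  by rewrite rmorphM mulrDl -mulrA -Ez mulrAC -Ey; ring.
have thXm k : forall w : 'X_{1..n}, mdeg w = k -> exists y, 'X_[w] - th 'X_[w] = y * m.
  elim: k => [|k IH] w dw.
    move/eqP: dw; rewrite mdeg_eq0 => /eqP->; exists 0.
    by rewrite mpolyX0 rmorph1 subrr mul0r.
  have [i [w' [dw' ->]]] := monomial_split dw.
  by rewrite mpolyXD; apply: thM; [apply: IH | apply: thX].
elim/mpolyind => [|c w p _ _ [y Ey]]; first by exists 0; rewrite rmorph0 subrr mul0r.
have [z Ez] := thXm _ w erefl; exists (c%:MP * z + y).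
rewrite -mul_mpolyC rmorphD rmorphM thC mulrDl -Ey -mulrA -Ez; ring.
Qed.

Lemma flag_mono l i j : (i <= j)%N -> ideal_le (flag l i) (flag l j).
Proof.
by move=> /subnK <-; elim: (j - i)%N => [|k IH] //= f /IH; apply: adjoin_le.
Qed.

Lemma flag_gen l i j : (i < j)%N -> flag l j (l i).
Proof. by move=> lt_ij; apply: (flag_mono lt_ij); apply/adjoin_gen/flag_ideal. Qed.

(* Eliminating one variable per linear form exhibits the ideal of a flag as the
   kernel of a ring endomorphism, hence as a prime ideal. *)
Lemma flag_kernel l k :
  (forall i, (i < k)%N -> hpart 1 (l i) /\ ~ flag l i (l i)) ->
  exists psi : {rmorphism R -> R},
    [/\ forall p, flag l k p <-> psi p = 0, forall p, hpart 1 p -> hpart 1 (psi p)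
      & forall p, flag l k (p - psi p)].
Proof.
elim: k => [_|k IH lP].
  by exists idfun; split=> //= p; rewrite subrr.
have [|psi [psiP psi1 psiB]] := IH; first by move=> i lt_i; apply/lP/ltnW.
have [hl nl] := lP k (leqnn _); pose m := psi (l k).
have m0 : m <> 0 by move/psiP.
have hm : hpart 1 m := psi1 _ hl.
have [a ca] : exists a, m@_U_(a) != 0.
  apply: contrapT => no; apply: m0; rewrite (linear_formE hm) big1 // => i _.
  by apply/eqP; rewrite scaler_eq0; apply/orP; left; apply/negPn/negP => ci; apply: no; exists i.
pose c := m@_U_(a).
(* As c is the coefficient of x_a in m, the substitution x_a -> x_a - m/c kills m and changes each
   polynomial by a multiple of m. *)
pose tup := [tuple (if i == a then 'X_i - c^-1 *: m else 'X_i : R) | i < n].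
pose th : {rmorphism R -> R} := comp_mpoly tup.
have thX i : th 'X_i = if i == a then 'X_i - c^-1 *: m else 'X_i.
  by rewrite /th /= comp_mpolyXU -tnth_nth tnth_mktuple.
have thZ (b : K) p : th (b *: p) = b *: th p by exact: comp_mpolyZ.
have thm : th m = 0.
  rewrite {1}(linear_formE hm) rmorph_sum /= (bigD1 a) //= thZ thX eqxx scalerBr.
  rewrite scalerA divff // scale1r addrAC -[X in X - _](_ : m = _) ?subrr //.
  rewrite {1}(linear_formE hm) (bigD1 a) //=; congr (_ + _).
  by apply: eq_bigr => i /negPf ia; rewrite thZ thX ia.
have th1 p : hpart 1 p -> hpart 1 (th p).
  move=> hp; rewrite (linear_formE hp) rmorph_sum /=.
  under eq_bigr => i _ do rewrite thZ; apply: hpart_sum => i; rewrite thX.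
  case: ifP => _; last exact: hpart_var.
  by apply: rpredB; [apply: hpart_var | apply: rpredZ].
have thB : forall p, exists y, p - th p = y * m.
  apply: ring_endomorphism_sub => [b|i]; first exact: comp_mpolyC.
  rewrite thX; case: ifP => _; last by exists 0; rewrite subrr mul0r.
  by exists (c^-1)%:MP; rewrite mul_mpolyC subKr.
have fm : flag l k.+1 m.
  rewrite -(subKr (l k) m); apply: idealB; first exact: flag_ideal.
    exact: flag_gen.
  by apply: (flag_mono (leqnSn k)); apply: psiB.
have kB p : flag l k.+1 (p - th (psi p)).
  rewrite -(subrKA (psi p)); apply: idealD; first exact: flag_ideal.
    by apply: (flag_mono (leqnSn k)); apply: psiB.
  have [y ->] := thB (psi p); apply: idealM => //; exact: flag_ideal.
exists (th \o psi)%FUN; split=> [p|p /psi1/th1 //|//].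
split=> [[b /psiP b0 [y ->]]|/= p0].
  by rewrite /= rmorphD rmorphM b0 add0r rmorphM thm mulr0.
by have := kB p; rewrite [th _]p0 subr0.
Qed.

Lemma flag_regular l k :
  (forall i, (i < k)%N -> hpart 1 (l i) /\ ~ flag l i (l i)) ->
  ~ flag l k (l k) -> forall f, flag l k (f * l k) -> flag l k f.
Proof.
move=> /flag_kernel[psi [psiP _ _]] nl f /psiP; rewrite rmorphM => /eqP.
by rewrite mulf_eq0 => /orP[/eqP/psiP //|/eqP/psiP].
Qed.

Lemma flag_ext l l' k f : (forall i, (i < k)%N -> l i = l' i) ->
  flag l k f <-> flag l' k f.
Proof.
elim: k f => [//|k IH] f ll' /=.
have E g : flag l k g <-> flag l' k g by apply: IH => i lt_i; apply/ll'/ltnW.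
by rewrite ll' //; split; apply: adjoin_mono => g /E.
Qed.

(** Linear independence of the forms, phrased by ideals so that [flag_regular] makes the sequence
    regular. *)
Definition linear_flag (s : seq R) : Prop := forall k, (k < size s)%N ->
  hpart 1 (nth 0 s k) /\ ~ flag (nth 0 s) k (nth 0 s k).

Lemma linear_flag_rcons s h : linear_flag s -> hpart 1 h ->
  ~ flag (nth 0 s) (size s) h -> linear_flag (rcons s h).
Proof.
move=> sP hh nh k; rewrite size_rcons ltnS => le_k.
have E g : flag (nth 0 (rcons s h)) k g <-> flag (nth 0 s) k g.
  by apply: flag_ext => i lt_i; rewrite nth_rcons (leq_trans lt_i le_k).
rewrite E nth_rcons; case: ltngtP le_k => // [lt_k _|-> _]; last by [].
exact: sP.
Qed.

Lemma linear_flag_complete s : linear_flag s -> exists s',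
  [/\ linear_flag s', (size s <= size s')%N,
      forall i, (i < size s)%N -> nth 0 s' i = nth 0 s i
    & forall i, flag (nth 0 s') (size s') 'X_i].
Proof.
move=> sP; suff [s' [s'P le pre s'X]] : exists s',
    [/\ linear_flag s', (size s <= size s')%N,
      forall i, (i < size s)%N -> nth 0 s' i = nth 0 s i
    & {in enum 'I_n, forall i, flag (nth 0 s') (size s') 'X_i}].
  by exists s'; split=> // i; apply: s'X; rewrite mem_enum.
elim: (enum 'I_n) => [|i e [s' [s'P le pre s'X]]]; first by exists s.
have [fi|nfi] := EM (flag (nth 0 s') (size s') 'X_i).
  by exists s'; split=> // j; rewrite inE => /predU1P[->|/s'X].
have E k g : (k <= size s')%N ->
    flag (nth 0 (rcons s' 'X_i)) k g <-> flag (nth 0 s') k g.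
  move=> le_k; apply: flag_ext => j lt_j.
  by rewrite nth_rcons (leq_trans lt_j le_k).
exists (rcons s' 'X_i); split.
- by apply: linear_flag_rcons => //; apply: hpart_var.
- by rewrite size_rcons ltnW.
- by move=> j lt_j; rewrite nth_rcons (leq_trans lt_j le) pre.
move=> j; rewrite size_rcons inE => /predU1P[->|/s'X fj].
  have := @flag_gen (nth 0 (rcons s' 'X_i)) (size s') _ (leqnn _).
  by rewrite nth_rcons ltnn eqxx.
by apply: (flag_mono (leqnSn _)); apply/E.
Qed.

End Flags.

(** * Multiplication by a general linear form *)

Section Surjectivity.
Variables (K : fieldType) (n : nat).
Local Notation R := {mpoly K[n]}.
Local Notation hc d p := (pihomog mdeg d p).
Implicit Types (J : R -> Prop) (f g h p q : R).

Lemma power_socle_ge J s0 :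
  (forall s g, (s0 <= s)%N -> hpart s g -> (forall i, J ('X_i * g)) -> J g) ->
  forall N s g, (s0 <= s)%N -> hpart s g ->
    (forall m : 'X_{1..n}, mdeg m = N -> J ('X_[m] * g)) -> J g.
Proof.
move=> Jsoc; elim=> [|N IH] s g le_s hg HN.
  by have := HN 0%MM mdeg0; rewrite mpolyX0 mul1r.
apply: (Jsoc s) => // i; apply: (IH s.+1) => [||m dm]; first exact: leqW.
  by rewrite -add1n; apply: dhomogM => //; apply: hpart_var.
by rewrite mulrA -mpolyXD; apply: HN; rewrite mdegD mdeg1 dm addn1.
Qed.

(** A form outside J could be multiplied by variables as long as the product stays outside J; since
    J contains all forms of large degree, this ends at a socle element. *)
Lemma power_socle_eventually J s0 T :
  (forall s g, (s0 <= s)%N -> hpart s g -> (forall i, J ('X_i * g)) -> J g) ->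
  (forall s g, (T <= s)%N -> hpart s g -> J g) ->
  forall s g, (s0 <= s)%N -> hpart s g -> J g.
Proof.
move=> Jsoc JT s g le_s hg; apply: (power_socle_ge Jsoc (N := T) le_s hg) => m dm.
apply: (JT (T + s)%N); first exact: leq_addr.
by apply: dhomogM => //; rewrite dhomogX; apply/eqP.
Qed.

Lemma independent_hyperplane J h t k : is_ideal J -> hpart 1 h ->
  (forall g, hpart t g -> J (g * h) -> J g) ->
  forall e, independent (hpart t.+1) (adjoin J h) e ->
  independent (hpart t) J k -> independent (hpart t.+1) J (e + k).
Proof.
move=> JI hh nzd e; apply: independent_add => //.
- exact: ideal_adjoin.
- exact: adjoin_le.
- exact: adjoin_gen.
- by move=> c s st; apply: nzd; apply: lin_hpart.
- by move=> g hg; rewrite /hpart -addn1 dhomogM.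
Qed.

Lemma independent_nil U J : @independent K n U J 0.
Proof. by exists [::]. Qed.

(** From degree s0 on the Hilbert function is nondecreasing by injectivity, and each failure of
    surjectivity raises it; boundedness allows finitely many failures. *)
Lemma eventually_surjective J h s0 : is_ideal J -> bounded J -> hpart 1 h ->
  (forall t g, (s0 <= t)%N -> hpart t g -> J (g * h) -> J g) ->
  exists T, forall t g, (T <= t)%N -> hpart t g -> adjoin J h g.
Proof.
move=> JI [B sp] hh nzd; apply: contrapT => no.
have bad T : exists t g, [/\ (T <= t)%N, hpart t g & ~ adjoin J h g].
  apply: contrapT => nbad; apply: no; exists T => t g le_T hg.
  by apply: contrapT => ng; apply: nbad; exists t, g.
have ind_le t t' k : (s0 <= t)%N -> (t <= t')%N -> independent (hpart t) J k ->
    independent (hpart t') J k.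
  move=> le_s /subnK <- ind; elim: (t' - t)%N => [//|j IH]; rewrite addSn.
  have := @independent_hyperplane J h (j + t) k JI hh _ 0 (independent_nil _ _) IH.
  by apply=> g; apply: nzd; rewrite (leq_trans le_s) ?leq_addl.
have ind k : exists2 t, (s0 <= t)%N & independent (hpart t) J k.
  elim: k => [|k [t le_t ind]]; first by exists s0 => //; apply: independent_nil.
  have [[|t'] [g [le_t' hg ng]]] := bad t.+1; first by [].
  exists t'.+1; first by apply: leq_trans le_t _; apply: ltnW.
  rewrite -[k.+1]add1n; apply: (independent_hyperplane JI hh).
  - by move=> g'; apply: nzd; apply: leq_trans le_t _.
  - by apply: independent1 ng => //; apply: ideal_adjoin.
  - exact: ind_le ind.
have [t _ it] := ind B.+1.
by have := independent_leq JI it (sp t); rewrite ltnn.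
Qed.

Lemma hilbert_constant J h s0 : is_ideal J -> homog_ideal J -> hpart 1 h ->
  (forall t g, (s0 <= t)%N -> hpart t g -> J (g * h) -> J g) ->
  (forall t g, (s0 < t)%N -> hpart t g -> adjoin J h g) ->
  exists c, forall t, (s0 <= t)%N ->
    independent (hpart t) J c /\ spanned (hpart t) J c.
Proof.
move=> JI Jh hh nzd sur; have [N spN] := hpart_spanned s0 JI.
have [c ind sp] := exists_dimension JI spN; exists c => t /subnK <-.
elim: (t - s0)%N => [//|k [indk spk]]; rewrite addSn; split.
  rewrite -[c]add0n; apply: (independent_hyperplane JI hh) indk.
    by move=> g; apply: nzd; apply: leq_addl.
  exact: independent_nil.
by apply: (spanned_hyperplane JI Jh hh sur) => //; rewrite ltnS leq_addl.
Qed.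

Lemma generic_linear_form J (Kinf : infinite_type K) Ps : is_ideal J ->
  filtration J Ps ->
  exists2 h, hpart 1 h & forall P, List.In P Ps -> ~ (forall i, P 'X_i) -> ~ P h.
Proof.
move=> JI fP; pose G P := ~ forall i : 'I_n, P ('X_i : R).
apply: (filtration_avoid Kinf (G := G) JI fP).
- by rewrite /hpart dhomog0.
- by move=> c f g hf hg; apply: rpredD => //; apply: rpredZ.
- by move=> P _ /existsNP[i ni]; exists 'X_i => //; apply: hpart_var.
Qed.

End Surjectivity.

(** * The resolution of R/I *)

Section Resolution.
Variables (K : fieldType) (n : nat).
Local Notation R := {mpoly K[n.+1]}.
Variables (I : {pred R}) (F : min_free_resolution I).

(* The resolution of [R / I]: that of [I], preceded by [R] in index [0]. *)
Definition complex_rank (i : nat) : nat := if i is i'.+1 then res_rank F i' else 1.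

Definition complex_shift (i : nat) : 'I_(complex_rank i) -> nat :=
  match i with
  | 0 => fun=> 0%N
  | i'.+1 => fun j => res_shift j
  end.

Definition complex_diff (i : nat) : 'M[R]_(complex_rank i.+1, complex_rank i) :=
  match i with
  | 0 => res_aug F
  | i'.+1 => res_diff F i'
  end.

Lemma complex_graded i j k :
  shifted_homog (complex_shift j) (complex_shift k) (complex_diff i j k).
Proof.
case: i j k => [|i] j k; last exact: (res_diff_graded j k).
by rewrite /shifted_homog /= subn0 ord1 res_aug_graded.
Qed.

Lemma complex_exact i (v : 'rV_(complex_rank i.+1)) :
  v *m complex_diff i = 0 <-> exists w, v = w *m complex_diff i.+1.
Proof. by case: i v => [|i] v; [apply: res_aug_exact | apply: res_diff_exact]. Qed.

Lemma complex_boundary0 l k f :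
  boundary complex_diff l k (i := 0) f%:M <-> exists2 a, a \in I & flag l k (f - a).
Proof.
have dE (w : 'rV_(complex_rank 1)) (a : R) : a%:M = w *m complex_diff 0 ->
    (f%:M - w *m complex_diff 0) 0 0 = f - a.
  by move=> <-; rewrite -raddfB /= mxE eqxx mulr1n.
split=> [[w wP]|[a aI fa]]; last first.
  have [w wE] := (res_aug_image F a).1 aI.
  by exists w => j; rewrite [j]ord1 (dE w a).
pose a := (w *m complex_diff 0) 0 0; have aE : a%:M = w *m complex_diff 0.
  by rewrite [RHS]mx11_scalar.
exists a; first by apply/(res_aug_image F a).2; exists w.
by rewrite -(dE w a aE).
Qed.

End Resolution.

(** * Regularity and the hyperplane section of the curve *)

Section RegularCurve.
Variables (K : fieldType) (n : nat) (Kinf : infinite_type K).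
Local Notation R := {mpoly K[n.+1]}.
Local Notation hc d p := (pihomog mdeg d p).
Variables (C : closed_subscheme K n) (i0 : 'I_n.+1) (r : nat).
Hypothesis C_curve : integral_curve C.
Hypothesis C_reg : has_regularity (ideal_of C) r.
Local Notation I := (vanishing_ideal C).
Local Notation x0 := ('X_i0 : R).
Local Notation D := (adjoin I x0).
Hypothesis nIx0 : ~ I x0.

Let II : is_ideal I := vanishing_is_ideal C.
Let Ih : homog_ideal I := @vanishing_homog _ _ C.
Let hx0 : hpart 1 x0 := hpart_var K i0.
Let DI : is_ideal D := ideal_adjoin x0 II.
Let Dh : homog_ideal D := homog_adjoin II Ih hx0.
Let nzd_x0 f : I (f * x0) -> I f.
Proof. by have [_ _ IM] := integral_prime (proj1 C_curve); case/IM. Qed.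

Lemma curve_no_power N : ~ forall t g, (N <= t)%N -> hpart t g -> D g.
Proof.
by move=> HN; apply: (curve_unbounded C_curve); apply: (bounded_hyperplane II Ih hx0 HN).
Qed.

Lemma boundary_one (F : min_free_resolution (ideal_of C)) (l : nat -> R) f :
  l 0 = x0 -> boundary (complex_diff F) l 1 (i := 0) f%:M <-> D f.
Proof.
move=> l0; rewrite complex_boundary0 /= l0; split.
  move=> [a Ia [b b0 [y E]]]; exists a => //; exists y.
  by rewrite -[f](subrK a) E b0 add0r addrC.
move=> [a Ia [y ->]]; exists a => //; exists 0 => //; exists y.
by rewrite addrAC subrr.
Qed.

Lemma boundary_two (F : min_free_resolution (ideal_of C)) (l : nat -> R) h f :
  l 0 = x0 -> l 1%N = h ->
  boundary (complex_diff F) l 2 (i := 0) f%:M <-> adjoin D h f.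
Proof.
move=> l0 l1; rewrite complex_boundary0 /= l0 l1; split.
  move=> [a Ia [_ [b b0 [y ->]] [z E]]]; exists (a + y * x0).
    by exists a => //; exists y.
  by exists z; rewrite -[f](subrK a) E b0 add0r; ring.
move=> [_ [a Ia [y ->]] [z ->]]; exists a => //; exists (y * x0).
  by exists 0 => //; exists y; rewrite add0r.
by exists z; ring.
Qed.

Section Flag.
Variables (F : min_free_resolution (ideal_of C)) (s : seq R).
Hypothesis shift_le : forall i (j : 'I_(res_rank F i)), (res_shift j <= r + i)%N.
Hypothesis s_flag : linear_flag s.
Hypothesis s_vars : forall i, flag (nth 0 s) (size s) 'X_i.
Hypothesis s0 : (0 < size s)%N.
Hypothesis s_head : nth 0 s 0 = x0.
Local Notation l := (nth 0 s).
Local Notation acyclic := (acyclic_above (@complex_shift _ _ _ F) (complex_diff F) l r).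

Let l_linear k (lt_k : (k < size s)%N) : hpart 1 (l k) := proj1 (s_flag lt_k).

Let l_regular k : (k < size s)%N -> forall f, flag l k (f * l k) -> flag l k f.
Proof.
move=> lt_k; apply: flag_regular; last exact: proj2 (s_flag lt_k).
by move=> i lt_i; apply/s_flag/(ltn_trans lt_i).
Qed.

Let step k := @acyclic_above_stable _ _ _ (@complex_shift _ _ _ F) _
  (@complex_graded _ _ _ F) (@complex_exact _ _ _ F) _ _ r l_linear l_regular k.

(** I is prime, so x_0 is injective on R/I and the first step loses no index. *)
Lemma acyclic_one : acyclic 1 0.
Proof.
apply: step => //; first by apply: acyclic_above0; apply: complex_exact.
move=> d w _ _; rewrite [w]mx11_scalar s_head scale_scalar_mx !complex_boundary0.
case=> a Ia /= /eqP; rewrite subr_eq0 => /eqP E; exists (w 0 0); last by rewrite /= subrr.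
by apply: nzd_x0; rewrite mulrC E.
Qed.

Lemma socle_boundary k t f : (k <= size s)%N -> acyclic k 0 -> (r <= t)%N -> (0 < t)%N ->
  hpart t f ->
  (forall x, hpart 1 x -> boundary (complex_diff F) l k (i := 0) (x * f)%:M) ->
  boundary (complex_diff F) l k (i := 0) f%:M.
Proof.
move=> le_k acy le_rt t0 hf sf; apply: contrapT => nf.
suff tE : t = 0%N by rewrite tE in t0.
apply: (@socle_degree _ _ _ (@complex_shift _ _ _ F) _ (@complex_graded _ _ _ F)
  (@complex_exact _ _ _ F) _ _ r l_linear l_regular s_vars _ _ k) => //.
- by move=> i j; rewrite /= addSn ltnS addnC; apply: shift_le.
- exists f%:M; split=> // [j|x hx].
    by rewrite addn0 [j]ord1 mxE eqxx mulr1n /shifted_homog /= subn0.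
  by rewrite scale_scalar_mx; apply: sf.
Qed.

Lemma acyclic_two h : (1 < size s)%N -> nth 0 s 1 = h ->
  (forall t g, (r <= t)%N -> hpart t g -> D (g * h) -> D g) -> acyclic 2 0.
Proof.
move=> s1 hE inj; apply: step => //; first exact: acyclic_one.
move=> d w le_d hw; rewrite hE [w]mx11_scalar scale_scalar_mx !boundary_one //.
rewrite mulrC; apply: (inj d) => //.
by have := hw 0; rewrite /shifted_homog /= subn0.
Qed.

End Flag.

Let resolution : exists F : min_free_resolution (ideal_of C),
  forall i (j : 'I_(res_rank F i)), (res_shift j <= r + i)%N.
Proof.
have [F [_ rmax]] := C_reg; exists F => i j.
have [lt|le] := ltnP (res_shift j) i; first by lia.
have : (res_shift j - i <= r)%N by apply: rmax; exists i, j; rewrite subnK.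
by lia.
Qed.

Lemma curve_socle t f : (r <= t)%N -> hpart t f -> (forall i, D ('X_i * f)) -> D f.
Proof.
(* Degree 0 is apart because [socle_degree] allows it: a nonzero constant in the socle would put
   every variable in D, so D would contain all forms of positive degree. *)
move=> le_rt hf sf; have [t0|t0] := posnP t.
  apply: contrapT => nDf; apply: (@curve_no_power 1) => k g k0 hg.
  apply: (hpart_vars DI _ k0 hg) => i.
  have fE : f = (f@_0)%:MP by rewrite -hc0 pihomog_dE //; rewrite t0 in hf.
  have f0 : f@_0 != 0.
    by apply/eqP => f0; apply: nDf; rewrite fE f0 mpolyC0; apply: ideal0.
  rewrite -(scalerK f0 'X_i); apply: idealZ => //.
  by rewrite -mul_mpolyC -fE mulrC.
have [F Fle] := resolution.
have xflag : linear_flag [:: x0].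
  by case=> [_|//] /=; split=> // x00; apply: nIx0; rewrite x00; apply: ideal0.
have [s [sP le_s pre sX]] := linear_flag_complete xflag.
have sh : nth 0 s 0 = x0 by rewrite pre.
apply/(boundary_one F f sh); apply: (socle_boundary Fle sP sX _ (t := t)) => //.
  exact: acyclic_one.
by move=> x hx; apply/boundary_one => //; apply: hpart_ideal.
Qed.

(** Injectivity holds because D has no socle in degrees >= r. It lets h be the second member of the
    flag without loss of index, so D + (h) has no socle in degrees > r; with eventual surjectivity
    this gives surjectivity there. *)
Lemma generic_hyperplane : exists h,
  [/\ hpart 1 h, forall t g, (r <= t)%N -> hpart t g -> D (g * h) -> D g
    & forall t g, (r < t)%N -> hpart t g -> adjoin D h g].
Proof.
have [Ps fP] := filtration_exists DI Dh.
have [h hh hP] := generic_linear_form Kinf DI fP.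
have inj t g : (r <= t)%N -> hpart t g -> D (g * h) -> D g.
  move=> le_rt hg; rewrite mulrC => Dhg.
  have [N HN] := filtration_power DI fP hP Dhg.
  by apply: (power_socle_ge (s0 := r) _ le_rt hg HN) => u g'; apply: curve_socle.
exists h; split=> //.
have Db : bounded D := curve_bounded C_curve hx0 nIx0.
have [T HT] := eventually_surjective DI Db hh inj.
have hI := ideal_adjoin h DI.
apply: (power_socle_eventually _ HT) => t g lt_rt hg sg.
(* For x_0, h to start a flag: if h were a multiple of x_0, it would lie in all primes of the
   filtration of D, so these would be irrelevant and D would contain a power of the irrelevant
   ideal. *)
have nx0h : ~ flag (nth 0 [:: x0; h]) 1 h.
  case=> b b0 [y hE]; have Dh' : D h.
    by rewrite hE b0 add0r; apply: idealM => //; apply: adjoin_gen.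
  have [||N HN] := @filtration_power _ _ _ _ 0 1 DI fP.
  - move=> P PPs nP _; apply: (hP P PPs nP).
    by have [_ _] := filtration_le DI fP PPs; apply.
  - by rewrite mul0r; apply: (ideal0 DI).
  apply: (@curve_no_power N); apply: mono_ideal => // m /HN.
  by rewrite mulr1.
have [F Fle] := resolution.
have xflag : linear_flag [:: x0; h].
  case=> [|[|//]] _ /=; split=> //.
  by move=> x00; apply: nIx0; rewrite x00; apply: ideal0.
have [s [sP le_s pre sX]] := linear_flag_complete xflag.
have sh0 : nth 0 s 0 = x0 by rewrite pre.
have sh1 : nth 0 s 1 = h by rewrite pre.
have s2 : (1 < size s)%N := le_s.
apply/(boundary_two F g sh0 sh1).
apply: (socle_boundary Fle sP sX _ (t := t)) => //; try by lia.
  exact: (acyclic_two sP (ltnW s2) sh0 s2 sh1 inj).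
by move=> x hx; apply/(boundary_two _ _ sh0 sh1); apply: hpart_ideal.
Qed.

(** This constant is the degree of C, available before any Hilbert polynomial. *)
Lemma hyperplane_section_constant : exists c, forall t, (r < t)%N ->
  independent (hpart t) D c /\ spanned (hpart t) D c.
Proof.
have [h [hh inj sur]] := generic_hyperplane.
apply: (hilbert_constant DI Dh hh (s0 := r.+1)) => t g lt_t; first exact/inj/ltnW.
exact/sur/ltnW.
Qed.

End RegularCurve.

(** * Hilbert functions, Hilbert polynomials and degree *)

Section HilbertFunction.
Variables (K : fieldType) (n : nat).
Local Notation R := {mpoly K[n.+1]}.
Implicit Types (X : closed_subscheme K n).

Lemma hilbert_function_dimension X t h : hilbert_function X t h ->
  independent (hpart t) (vanishing_ideal X) h /\ spanned (hpart t) (vanishing_ideal X) h.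
Proof.
case=> V [VE ->]; rewrite -dimv_compl.
pose b := vbasis (V^C)%VS; pose s := map (@mpoly_of_dhomog n.+1 K t) b.
have sz : size s = \dim (V^C)%VS by rewrite size_map size_tuple.
pose w (c : nat -> K) : dhomog n.+1 K t := \sum_(i < \dim (V^C)%VS) c i *: b`_i.
have wE c : mpoly_of_dhomog (w c) = lin c s.
  rewrite /lin sz raddf_sum; apply: eq_bigr => i _.
  by rewrite (nth_map 0) ?size_tuple.
have sU : {in s, forall x, hpart t x}.
  by move=> _ /mapP[x _ ->]; apply: dhomog_is_dhomog.
split; exists s; split=> //; last first.
- move=> u hu; have : DHomog hu \in (V + V^C)%VS by rewrite addv_complf memvf.
  case/memv_addP => v vV [v' v'C E].
  pose c i := if insub i is Some j then coord b j v' else 0.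
  have v'E : v' = w c.
    rewrite {1}(coord_vbasis v'C); apply: eq_bigr => i _.
    by rewrite /c valK.
  exists c; rewrite -wE -v'E.
  have -> : u - mpoly_of_dhomog v' = mpoly_of_dhomog v.
    by rewrite -[u]/(mpoly_of_dhomog (DHomog hu)) E raddfD addrK.
  by rewrite /vanishing_ideal -VE.
- by rewrite sz.
move=> c Xc i; rewrite sz => lt_i.
have w0 : w c = 0.
  apply/eqP; rewrite -memv0 -(capv_compl V) memv_cap VE wE Xc /=.
  by apply: memv_suml => j _; apply/memvZ/vbasis_mem/mem_nth; rewrite size_tuple.
have /freeP/(_ (fun j => c j) w0 (Ordinal lt_i)) := basis_free (vbasisP (V^C)%VS).
by [].
Qed.

Lemma dimension_unique (U J : R -> Prop) h h' : is_ideal J ->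
  independent U J h -> spanned U J h -> independent U J h' -> spanned U J h' -> h = h'.
Proof.
move=> JI i1 s1 i2 s2; apply/eqP; rewrite eqn_leq.
by rewrite (independent_leq JI i1 s2) (independent_leq JI i2 s1).
Qed.

Lemma poly_eventually_eq (p q : {poly rat}) T :
  (forall t, (T <= t)%N -> p.[t%:R] = q.[t%:R]) -> p = q.
Proof.
move=> pq; apply/eqP; rewrite -subr_eq0; apply/negPn/negP => pq0.
pose s := [seq (T + i)%:R : rat | i <- iota 0 (size (p - q))].
have : (size s < size (p - q)%R)%N; last by rewrite size_map size_iota ltnn.
apply: max_poly_roots => //.
  apply/allP => _ /mapP[i _ ->]; rewrite rootE hornerD hornerN pq ?subrr //.
  exact: leq_addr.
rewrite map_inj_uniq ?iota_uniq // => i j /eqP.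
by rewrite Num.Theory.eqr_nat eqn_add2l => /eqP.
Qed.

Lemma degree_constant X d c T : has_degree X d ->
  (forall t, (T <= t)%N -> independent (hpart t) (vanishing_ideal X) c /\
    spanned (hpart t) (vanishing_ideal X) c) -> d = c.
Proof.
case=> p [t0 hp] dE Xc; have pE : p = (c%:R)%:P.
  apply: (@poly_eventually_eq _ _ (t0 + T)) => t le_t; rewrite hornerC.
  have [|h /hilbert_function_dimension[i1 s1] ->] := hp t; first by lia.
  have [|i2 s2] := Xc t; first by lia.
  by congr (_%:R); apply: dimension_unique i1 s1 i2 s2; apply: vanishing_is_ideal.
move: dE; rewrite pE lead_coefC.
(* The case c = 0 is included: the zero polynomial has size 0, with predecessor 0. *)
have -> : (size (c%:R%:P : {poly rat})).-1 = 0%N by rewrite size_polyC; case: eqP.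
by rewrite mul1r => /eqP; rewrite Num.Theory.eqr_nat => /eqP.
Qed.

Lemma degree_linear X e c T h0 : has_degree X e -> (0 < c)%N ->
  (forall k, independent (hpart (T + k)) (vanishing_ideal X) (h0 + k * c) /\
    spanned (hpart (T + k)) (vanishing_ideal X) (h0 + k * c)) -> e = c.
Proof.
case=> p [t0 hp] dE c0 Xc.
(* The line of slope c with value h0 at T. *)
pose q : {poly rat} := c%:R *: 'X + (h0%:R - T%:R * c%:R)%:P.
have pE : p = q.
  apply: (@poly_eventually_eq _ _ (t0 + T)) => t le_t.
  rewrite /q hornerD hornerZ hornerX hornerC.
  have [|h /hilbert_function_dimension[i1 s1] ->] := hp t; first by lia.
  have [i2 s2] := Xc (t - T)%N; have tE : (T + (t - T))%N = t by lia.
  rewrite tE in i2 s2.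
  rewrite (dimension_unique (vanishing_is_ideal X) i1 s1 i2 s2).
  rewrite natrD natrM natrB; last by lia.
  by ring.
have c0' : (c%:R : rat) != 0 by rewrite Num.Theory.pnatr_eq0 -lt0n.
have sz : size (c%:R *: 'X : {poly rat}) = 2 by rewrite size_scale // size_polyX.
have sz' : (size ((h0%:R - T%:R * c%:R)%:P : {poly rat}) < size (c%:R *: 'X : {poly rat}))%N.
  by rewrite sz ltnS size_polyC leq_b1.
move: dE; rewrite pE /q size_polyDl // sz lead_coefDl // lead_coefZ lead_coefX mulr1 mul1r.
by move/eqP; rewrite Num.Theory.eqr_nat => /eqP.
Qed.

End HilbertFunction.

(** * The hypersurface through Z and the degree bound *)

Section Main.
Variables (K : fieldType) (n : nat) (Kinf : infinite_type K).
Local Notation R := {mpoly K[n.+1]}.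
Local Notation hc d p := (pihomog mdeg d p).
Implicit Types (C Z : closed_subscheme K n).

Lemma curve_variable C : integral_curve C -> exists i, ~ vanishing_ideal C 'X_i.
Proof.
move=> [_ Cdim]; have [c [cP _]] := dimension_witness Cdim.
have [[_ _ [i ni]] le] := cP 0%N isT; exists i => /le; exact: ni.
Qed.

(** A general h avoids the relevant primes, so if h g is in I_Z, then so is g times all monomials of
    some degree, and saturation concludes. *)
Lemma zero_dimensional_linear Z : zero_dimensional Z ->
  exists h, [/\ hpart 1 h, forall g, vanishing_ideal Z (g * h) -> vanishing_ideal Z g
    & exists T, forall t g, (T <= t)%N -> hpart t g -> adjoin (vanishing_ideal Z) h g].
Proof.
move=> Zdim; have JI := vanishing_is_ideal Z; have Jh := @vanishing_homog _ _ Z.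
have [Ps fP] := filtration_exists JI Jh.
have [h hh hP] := generic_linear_form Kinf JI fP.
have nzd g : vanishing_ideal Z (g * h) -> vanishing_ideal Z g.
  rewrite mulrC => Jhg; apply: ideal_of_saturated.
  exact: (filtration_power JI fP hP Jhg).
exists h; split=> //.
apply: (eventually_surjective (s0 := 0) JI (zero_dimensional_bounded Zdim) hh).
by move=> t g _ _; apply: nzd.
Qed.

Lemma zero_dimensional_degree Z d : zero_dimensional Z -> has_degree Z d ->
  exists T, forall t, (T <= t)%N -> independent (hpart t) (vanishing_ideal Z) d.
Proof.
move=> Zdim Zd; have JI := vanishing_is_ideal Z; have Jh := @vanishing_homog _ _ Z.
have [h [hh nzd [T HT]]] := zero_dimensional_linear Zdim.
have [c cP] : exists c, forall t, (T <= t)%N ->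
    independent (hpart t) (vanishing_ideal Z) c /\ spanned (hpart t) (vanishing_ideal Z) c.
  apply: (hilbert_constant JI Jh hh) => t g lt_t; first by move=> _; apply: nzd.
  by apply: HT; apply: ltnW.
rewrite (degree_constant Zd cP).
by exists T => t /cP[].
Qed.

(* The socle element [x0^-1 h f] of [R / (I, h)] corresponds to [f]. *)
Lemma socle_transfer (I : R -> Prop) i0 h t f : is_prime I -> homog_ideal I ->
  ~ I 'X_i0 -> ~ I h -> hpart 1 h -> hpart t f -> ~ adjoin I 'X_i0 f ->
  (forall i, adjoin I 'X_i0 ('X_i * f)) ->
  exists q, [/\ hpart t q, ~ adjoin I h q & forall i, adjoin I h ('X_i * q)].
Proof.
move=> [II I1 IM] Ih nx nh hh hf nf sf.
have /choice [q qP] : forall i, exists q, I ('X_i * f - q * 'X_i0) /\ hpart t q.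
  move=> i; have hXf : 'X_i * f \is (1 + t).-homog for mdeg.
    by apply: dhomogM => //; apply: hpart_var.
  have [y [Iy]] := adjoin_homogP II Ih (hpart_var K i0) hXf (sf i).
  by rewrite add1n /= subn1 /=; exists y.
(* From x_i f = q_i x_0 modulo I, the coefficients of h combine to h f = Q x_0. *)
pose Q := \sum_i h@_U_(i) *: q i.
have hfQ : I (h * f - Q * 'X_i0).
  rewrite {1}(linear_formE hh) !mulr_suml -sumrB; apply: ideal_sum => // i _.
  by rewrite -!scalerAl -scalerBr; apply: idealZ => //; have [] := qP i.
exists Q; split.
- by apply: hpart_sum => i; have [] := qP i.
- move=> [a Ia [p E]]; apply: nf.
  have : I (h * (f - p * 'X_i0)).
    have -> : h * (f - p * 'X_i0) = h * f - Q * 'X_i0 + a * 'X_i0 by rewrite E; ring.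
    by apply: idealD => //; apply: idealMl.
  by case/IM => // Ifp; exists (f - p * 'X_i0) => //; exists p; rewrite subrK.
- move=> i; have [Iq _] := qP i.
  have : I ('X_i0 * ('X_i * Q - q i * h)).
    have -> : 'X_i0 * ('X_i * Q - q i * h) =
        h * ('X_i * f - q i * 'X_i0) - 'X_i * (h * f - Q * 'X_i0) by ring.
    by apply: idealB => //; apply: idealM.
  case/IM => // IXQ; exists ('X_i * Q - q i * h) => //; exists (q i).
  by rewrite subrK.
Qed.

Lemma gorenstein_hypersurface C r Z : integral_curve C -> ~ ACM C ->
  has_regularity (ideal_of C) r -> zero_dimensional Z -> arithmetically_gorenstein Z ->
  subscheme_of Z C ->
  exists j f, [/\ (j <= r)%N, hpart j f, vanishing_ideal Z f & ~ vanishing_ideal C f].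
Proof.
move=> Cc nACM Creg Zdim Zgor ZC.
set I := vanishing_ideal C; set J := vanishing_ideal Z.
apply: contrapT => no.
have JI_I j f : (j <= r)%N -> hpart j f -> J f -> I f.
  by move=> le_j hf Jf; apply: contrapT => nIf; apply: no; exists j, f.
have II : is_ideal I := vanishing_is_ideal C; have Ih : homog_ideal I := @vanishing_homog _ _ C.
have JI : is_ideal J := vanishing_is_ideal Z; have Jh : homog_ideal J := @vanishing_homog _ _ Z.
have IJ : ideal_le I J by move=> f; apply: ZC.
have [i0 nx0] := curve_variable Cc; have hx0 := hpart_var K i0.
have DI := ideal_adjoin 'X_i0 II; have Dh := homog_adjoin II Ih hx0.
have [t [f [hf nDf sf]]] : exists t f, [/\ hpart t f, ~ adjoin I 'X_i0 f
    & forall i, adjoin I 'X_i0 ('X_i * f)].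
  apply: contrapT => nsoc; apply: nACM; apply: (ACM_no_socle Kinf Cc nx0) => f sf.
  apply: contrapT => nDf; have [t nDt] := homog_notin DI nDf.
  apply: nsoc; exists t, (hc t f); split=> //; first exact: pihomogP.
  move=> i; have := Dh _ t.+1 (sf i).
  by rewrite (hc_mul _ _ (hpart_var K i)) /= subn1.
have lt_tr : (t < r)%N.
  rewrite ltnNge; apply/negP => le_rt; apply: nDf.
  exact: (curve_socle Cc Creg nx0 le_rt hf sf).
have [h [hh nzd [T HT]]] := zero_dimensional_linear Zdim.
have nIh : ~ I h.
  by move=> /IJ Jh1; apply: (@vanishing_proper _ _ Z); apply: nzd; rewrite mul1r.
have [q [hq nIq sq]] := socle_transfer (integral_prime (proj1 Cc)) Ih nx0 nIh hh hf nDf sf.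
(* Under the assumption to be refuted, I and J have the same forms in degrees at most r, so
   membership modulo h descends. *)
have adjI s g : (s <= r)%N -> hpart s g -> adjoin J h g -> adjoin I h g.
  move=> le_s hg /(adjoin_homogP JI Jh hh hg)[y [Jy hy]].
  exists (g - y * h); last by exists y; rewrite subrK.
  apply: (JI_I s) => //; apply: rpredB => //.
  case: s hg le_s hy => [|s] hg le_s /=; first by move/eqP->; rewrite mul0r rpred0.
  by rewrite subn1 /= => hy; have := dhomogM hy hh; rewrite addn1.
have HI := ideal_adjoin h JI; have Hh := homog_adjoin JI Jh hh.
have nHq : ~ adjoin J h q by move=> /(adjI t q (ltnW lt_tr) hq).
have sHq i : adjoin J h ('X_i * q) by apply: adjoin_mono (sq i).
have HTm (m : 'X_{1..n.+1}) : mdeg m = T -> adjoin J h 'X_[m].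
  by move=> dm; apply: (HT T) => //; rewrite /hpart dhomogX; apply/eqP.
(* A socle form of degree s > t is a scalar multiple of q modulo J + (h); the component of degree s
   of this relation puts it in J + (h). *)
have Htop : forall s g, (t < s)%N -> hpart s g -> adjoin J h g.
  apply: (power_socle_eventually _ HT) => s g lt_ts hg sg.
  have [c Hc] := gorenstein_socle Zgor nzd HTm sHq sg nHq.
  have := Hh _ s Hc; rewrite linearB linearZ /= (pihomog_dE hg) (hcE _ hq).
  by rewrite ltn_eqF // scaler0 subr0.
apply: (curve_unbounded Cc); apply: (bounded_hyperplane (T := t.+1) II Ih hh).
apply: (mono_ideal (ideal_adjoin h II)) => m dm.
have hm : hpart t.+1 ('X_[m] : R) by rewrite /hpart dhomogX; apply/eqP.
exact: (adjI t.+1 _ lt_tr hm (Htop _ _ (leqnn _) hm)).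
Qed.

Lemma curve_hilbert_step (I : R -> Prop) x t c h : is_ideal I -> homog_ideal I ->
  hpart 1 x -> (forall g, I (g * x) -> I g) ->
  independent (hpart t.+1) (adjoin I x) c -> spanned (hpart t.+1) (adjoin I x) c ->
  (independent (hpart t) I h -> independent (hpart t.+1) I (c + h)) /\
  (spanned (hpart t) I h -> spanned (hpart t.+1) I (h + c)).
Proof.
move=> II Ih hx nzd ic sc; split=> [ih|sh].
  by apply: (independent_hyperplane II hx _ ic ih) => g _; apply: nzd.
have Ix : ideal_le I (colon I x) by move=> g Ig; apply: idealMl.
have sx := spanned_adjoin (t := t) II Ih hx (spanned_le Ix sh).
by rewrite addn1 in sx; apply: sx.
Qed.

Lemma curve_hilbert_linear C r c i0 : integral_curve C -> ~ vanishing_ideal C 'X_i0 ->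
  (forall t, (r < t)%N ->
    independent (hpart t) (adjoin (vanishing_ideal C) 'X_i0) c /\
    spanned (hpart t) (adjoin (vanishing_ideal C) 'X_i0) c) ->
  exists h0, forall k,
    independent (hpart (r + k)) (vanishing_ideal C) (h0 + k * c) /\
    spanned (hpart (r + k)) (vanishing_ideal C) (h0 + k * c).
Proof.
move=> Cc nx0 cP; have II := vanishing_is_ideal C.
have Ih : homog_ideal (vanishing_ideal C) := @vanishing_homog _ _ C.
have [N spN] := hpart_spanned r II; have [h0 ih sh] := exists_dimension II spN.
exists h0; elim=> [|k [ik sk]]; first by rewrite addn0 mul0n addn0.
have nzd g : vanishing_ideal C (g * 'X_i0) -> vanishing_ideal C g.
  by have [_ _ IM] := integral_prime (proj1 Cc); case/IM.
have [ic sc] : independent (hpart (r + k).+1) (adjoin (vanishing_ideal C) 'X_i0) c /\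
    spanned (hpart (r + k).+1) (adjoin (vanishing_ideal C) 'X_i0) c.
  by apply: cP; rewrite ltnS leq_addr.
have [Hi Hs] := curve_hilbert_step (h0 + k * c) II Ih (hpart_var K i0) nzd ic sc.
have E : (h0 + k.+1 * c)%N = (h0 + k * c + c)%N by rewrite mulSnr addnA.
by rewrite addnS E; split; [rewrite [X in independent _ _ X]addnC; apply: Hi | apply: Hs].
Qed.

(* Bezout: [Z] is contained in the intersection of [C] with a hypersurface of degree
   at most [r] not containing [C]. *)
Lemma degree_bound C r c i0 Z d : integral_curve C -> ~ ACM C ->
  has_regularity (ideal_of C) r -> ~ vanishing_ideal C 'X_i0 ->
  (forall t, (r < t)%N ->
    independent (hpart t) (adjoin (vanishing_ideal C) 'X_i0) c /\
    spanned (hpart t) (adjoin (vanishing_ideal C) 'X_i0) c) ->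
  zero_dimensional Z -> arithmetically_gorenstein Z ->
  subscheme_of Z C -> has_degree Z d -> (d <= c * r)%N.
Proof.
move=> Cc nACM Creg nx0 cP Zdim Zgor ZC Zd.
have [j [f [le_jr hf Jf nIf]]] := gorenstein_hypersurface Cc nACM Creg Zdim Zgor ZC.
have [h0 hP] := curve_hilbert_linear Cc nx0 cP.
have [T TP] := zero_dimensional_degree Zdim Zd.
have [it _] := hP T; have [_ st] := hP (T + j)%N.
(* In this degree d dimensions come from Z, and h0 + T c from the multiples of f by forms of degree
   r + T. The total is at most h0 + (T + j) c, whence d <= j c. *)
have ind : independent (hpart (r + (T + j))) (vanishing_ideal C) (d + (h0 + T * c)).
  apply: (independent_add (f := f) (vanishing_is_ideal C) (vanishing_is_ideal Z) _ Jf _ _ _ it).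
  - by move=> g; apply: ZC.
  - have [_ _ IM] := integral_prime (proj1 Cc).
    by move=> a s _ /IM[].
  - by move=> g hg; rewrite addnA; apply: dhomogM.
  - by apply: TP; lia.
have := independent_leq (vanishing_is_ideal C) ind st.
have : (j * c <= c * r)%N by rewrite mulnC leq_mul2l le_jr orbT.
by rewrite mulnDl; lia.
Qed.

End Main.

Theorem proposition6p7 (K : fieldType) (n : nat) (Kinf : infinite_type K) :
  (exists N : nat -> nat,
     forall (C : closed_subscheme K n) (r : nat),
       integral_curve C -> ~ ACM C -> has_regularity (ideal_of C) r ->
     forall (Z : closed_subscheme K n) (d : nat),
       zero_dimensional Z -> arithmetically_gorenstein Z ->
       subscheme_of Z C -> has_degree Z d -> (d <= N r)%N) /\
  (forall (C : closed_subscheme K n) (r e : nat),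
     integral_curve C -> ~ ACM C -> has_regularity (ideal_of C) r ->
     has_degree C e ->
   forall (Z : closed_subscheme K n) (d : nat),
     zero_dimensional Z -> arithmetically_gorenstein Z ->
     subscheme_of Z C -> has_degree Z d -> (d <= e * r)%N).
Proof.
split.
  (* [B t] bounds the dimension of all forms of degree t. As c is the dimension of a quotient of the
     forms of degree r + 1, the bound [B r.+1] for it is the same for all curves of regularity r. *)
  have /choice [B BP] : forall t, exists B,
      spanned (hpart t) (fun f : {mpoly K[n.+1]} => f = 0) B.
    by move=> t; apply/hpart_spanned/zero_is_ideal.
  exists (fun r => B r.+1 * r)%N => C r Cc nACM Creg Z d Zdim Zgor ZC Zd.
  have [i0 nx0] := curve_variable Cc.
  have [c cP] := hyperplane_section_constant Kinf Cc Creg nx0.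
  apply: leq_trans (degree_bound Kinf Cc nACM Creg nx0 cP Zdim Zgor ZC Zd) _.
  rewrite leq_mul2r; apply/orP; right; have [ic _] := cP r.+1 (leqnn _).
  have DI := ideal_adjoin 'X_i0 (vanishing_is_ideal C).
  apply: (independent_leq DI ic); apply: spanned_le (BP r.+1) => _ ->.
  exact: ideal0 DI.
move=> C r e Cc nACM Creg Ce Z d Zdim Zgor ZC Zd.
have [i0 nx0] := curve_variable Cc.
have [c cP] := hyperplane_section_constant Kinf Cc Creg nx0.
have [h0 hP] := curve_hilbert_linear Cc nx0 cP.
(* For c = 0 the Hilbert function of C would be constant from degree r on. *)
have c0 : (0 < c)%N.
  rewrite lt0n; apply/eqP => c0; apply: (curve_unbounded Cc).
  apply: (bounded_eventually (vanishing_is_ideal C) (T := r) (B := h0)) => t /subnKC <-.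
  by have [_] := hP (t - r)%N; rewrite c0 muln0 addn0.
rewrite (degree_linear Ce c0 hP).
exact: (degree_bound Kinf Cc nACM Creg nx0 cP Zdim Zgor ZC Zd).
Qed.
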